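(* Let $M$ be a smooth (second countable) $n$-dimensional manifold, let $N$ be a Polish space, and let $\mu$ and $\nu$ be Borel probability measures on $M$ and $N$ respectively. Assume that the cost $c:M\times N\to\mathbb{R}$ is lower semicontinuous and bounded from below, that the family of maps $x\mapsto c(x,y)$ is locally semi-concave in $x$ locally uniformly in $y$, that $c$ satisfies the left twist condition, that $\mu$ is absolutely continuous with respect to Lebesgue measure, and that $\inf_{\gamma\in\Pi(\mu,\nu)}\int_{M\times N}c\,d\gamma$ is finite. Then for any calibrated pair $(\varphi,\psi)$, the function $\varphi$ is approximately differentiable $\mu$-a.e., and the optimal transport map $T$ from $\mu$ to $\nu$ for the cost $c$ is uniquely determined $\mu$-a.e., thanks to the twist condition, by $$\frac{\partial c}{\partial x}(x,T(x))=-\tilde d_x\varphi,$$ where $\tilde d_x\varphi$ is the approximate differential of $\varphi$ at $x$. Moreover, there exists a Borel subset $A\subset M$ of full $\mu$-measure such that $\tilde d_x\varphi$ exists for every $x\in A$, the map $x\mapsto\tilde d_x\varphi$ is Borel measurable on $A$, and $\frac{\partial c}{\partial x}(x,T(x))$ exists for every $x\in A$.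
   Context: Manifolds are Hausdorff; absolute continuity with respect to Lebesgue measure is understood in charts. Transport: $\Pi(\mu,\nu)$ is the set of Borel probability measures (plans) on $M\times N$ with marginals $\mu$ and $\nu$. An optimal plan is a minimizer of $\gamma\mapsto\int c\,d\gamma$ over $\Pi(\mu,\nu)$. An optimal transport map is a measurable $T:M\to N$ with $T_\sharp\mu=\nu$ minimizing $\int_Mc(x,S(x))\,d\mu(x)$ among all measurable $S$ with $S_\sharp\mu=\nu$; under the present hypotheses it exists and is unique $\mu$-a.e. A $c$-subsolution is a pair $\varphi:M\to\mathbb{R}\cup\{+\infty\}$, $\psi:N\to\mathbb{R}\cup\{-\infty\}$ with $\psi(y)-\varphi(x)\le c(x,y)$ for all $(x,y)$. A calibrated pair is a $c$-subsolution $(\varphi,\psi)$ with $\varphi,\psi$ Borel measurable and $\psi(y)-\varphi(x)=c(x,y)$ for $\gamma$-a.e. $(x,y)$, for an optimal plan $\gamma\in\Pi(\mu,\nu)$. Semi-concavity: a modulus is a continuous non-decreasing $\omega:[0,\infty)\to[0,\infty)$ with $\omega(0)=0$. For $U\subset\mathbb{R}^n$ open, $f:U\to\mathbb{R}$ is $\omega$-semi-concave if for each $x\in U$ there is a linear form $l_x$ with $f(y)-f(x)\le l_x(y-x)+\|y-x\|\,\omega(\|y-x\|)$ for all $y\in U$. A family $(f_i)_{i\in I}$ of functions on $M$ is uniformly locally semi-concave if $M$ is covered by domains $U_j$ of charts $\theta_j$ such that, for each $j$, there is a single modulus $\omega_j$ for which all $f_i\circ\theta_j^{-1}$, $i\in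 I$, are $\omega_j$-semi-concave on $\theta_j(U_j)$. ''Locally semi-concave in $x$ locally uniformly in $y$'' means: each $y_0\in N$ has a neighborhood $V_0$ such that $(c(\cdot,y))_{y\in V_0}$ is uniformly locally semi-concave on $M$. Left twist condition: the map $(x,y)\mapsto(x,\frac{\partial c}{\partial x}(x,y))\in T^*M$ is injective on the set of those $(x,y)\in M\times N$ for which $\frac{\partial c}{\partial x}(x,y)$ exists. Approximate differential: $f$ (defined on $M$ with values in $\mathbb{R}$ or $\mathbb{R}\cup\{+\infty\}$) has an approximate differential at $x\in M$ if there is $h:M\to\mathbb{R}$ differentiable at $x$ such that the set $\{f=h\}$ has density $1$ at $x$ with respect to Lebesgue measure (in charts); then $\tilde d_xf=d_xh$, which does not depend on the choice of $h$. *)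

(* Defs.v *)
From HB Require Import structures.
From mathcomp Require Import all_boot all_order all_algebra.
From mathcomp Require Import all_classical all_reals all_analysis.
From mathcomp Require Import measurable_realfun.

Set Implicit Arguments.
Unset Strict Implicit.
Unset Printing Implicit Defensive.
Import Order.TTheory GRing.Theory Num.Theory.
Import numFieldNormedType.Exports.
Local Open Scope classical_set_scope.
Local Open Scope ring_scope.

Notation borel T := (g_sigma_algebraType (@open T)).

(** Separable and metrizable by a complete distance. *)
Definition polish_space (R : realType) (T : topologicalType) :=
  (exists2 D : set T, countable D & dense D) /\
  exists d : T -> T -> R,
    [/\ forall x y, (0 <= d x y) /\ (d x y = 0 <-> x = y),
        forall x y, d x y = d y x,
        forall x y z, d x z <= d x y + d y z,
        forall x (A : set T),
          nbhs x A <-> exists2 e : R, 0 < e & [set y | d x y < e] `<=` A &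
        forall u : nat -> T,
          (forall e : R, 0 < e -> exists k : nat, forall i j : nat,
            (k <= i)%N -> (k <= j)%N -> d (u i) (u j) < e) ->
          exists l : T, u @ \oo --> l].

(** * Lebesgue measure on R^n

    [lebesgue_rV] is the Lebesgue outer measure; it is only ever evaluated at
    Borel sets, where it is the Lebesgue measure. The covers are indexed by a
    subset [D] of [nat], and not by [nat] itself, because the boxes of R^0 are
    not empty: all of them have volume 1. *)
Section lebesgue_rV.
Context {R : realType} {n : nat}.

Definition box (a b : 'rV[R]_n) : set 'rV[R]_n :=
  [set x | forall i, x 0 i \in `]a 0 i, b 0 i]].

Definition box_volume (a b : 'rV[R]_n) : R :=
  \prod_(i < n) Num.max 0 (b 0 i - a 0 i).

Definition lebesgue_rV (E : set 'rV[R]_n) : \bar R :=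
  ereal_inf [set v | exists (D : pred nat) (a b : nat -> 'rV[R]_n),
    E `<=` \bigcup_(k in [set k | D k]) box (a k) (b k) /\
    v = (\sum_(0 <= k <oo | D k) (box_volume (a k) (b k))%:E)%E].

(** For a Lebesgue measurable [E], asking for a Borel subset of density 1 is
    the same as asking that [E] itself has density 1; this form makes sense for
    all [E]. The balls are those of the sup norm, which does not change the
    notion of density 1. *)
Definition density_one (E : set 'rV[R]_n) (a : 'rV[R]_n) :=
  exists F : set (borel 'rV[R]_n),
    [/\ measurable F, F `<=` E &
        (fun r : R => fine (lebesgue_rV (F `&` ball a r)) /
                      fine (lebesgue_rV (ball a r))) @ 0^'+ --> (1 : R)].

End lebesgue_rV.

(** * Smooth manifolds *)
Section smooth_map.
Context {R : realType} {m n : nat}.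

Fixpoint class_C (k : nat) (U : set 'rV[R]_m) (f : 'rV[R]_m -> 'rV[R]_n)
    : Prop :=
  (forall x, U x -> {for x, continuous f}) /\
  if k is k'.+1 then
    forall i : 'I_m, (forall x, U x -> derivable f x (delta_mx 0 i)) /\
                     class_C k' U (fun x => 'D_(delta_mx 0 i) f x)
  else True.

Definition smooth_on (U : set 'rV[R]_m) (f : 'rV[R]_m -> 'rV[R]_n) :=
  forall k, class_C k U f.

End smooth_map.

(** A homeomorphism from the open set [dom] onto the open set [codom] of R^n.
    The values of [cmap] outside [dom] and of [cinv] outside [codom] are
    irrelevant. *)
Record chart (R : realType) (n : nat) (M : topologicalType) := Chart {
  dom : set M;
  cmap :> M -> 'rV[R]_n;
  cinv : 'rV[R]_n -> M;
  open_dom : open dom;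
  open_image : open (cmap @` dom);
  cmapK : forall x, dom x -> cinv (cmap x) = x;
  continuous_cmap : forall x, dom x -> {for x, continuous cmap};
  continuous_cinv : forall x, dom x -> {for cmap x, continuous cinv} }.

Definition codom (R : realType) (n : nat) (M : topologicalType)
  (th : chart R n M) : set 'rV[R]_n := th @` dom th.

Definition transition (R : realType) (n : nat) (M : topologicalType)
  (th1 th2 : chart R n M) : 'rV[R]_n -> 'rV[R]_n := th2 \o cinv th1.

Definition compatible (R : realType) (n : nat) (M : topologicalType)
    (th1 th2 : chart R n M) :=
  smooth_on (th1 @` (dom th1 `&` dom th2)) (transition th1 th2) /\
  smooth_on (th2 @` (dom th1 `&` dom th2)) (transition th2 th1).

Record smooth_structure (R : realType) (n : nat) (M : topologicalType) :=
  SmoothStructure {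
    atlas : set (chart R n M);
    atlas_cover : forall x, exists2 th, atlas th & dom th x;
    atlas_compatible : forall th1 th2,
      atlas th1 -> atlas th2 -> compatible th1 th2;
    atlas_maximal : forall th,
      (forall th', atlas th' -> compatible th th') -> atlas th }.

(** * The cotangent bundle

    An element of T*M is given by its base point and by its coordinates in each
    chart around the base point: the coordinates of [p] in the chart [th] are
    the column [coord p th] that represents the linear form
    [v |-> v *m coord p th] on row vectors. They obey the chain rule. The
    coordinates in irrelevant charts are set to 0, so that equality in T*M is
    Leibniz equality. *)
Record cotangent (R : realType) (n : nat) (M : topologicalType)
    (S : smooth_structure R n M) := Cotangent {
  base : M;
  coord : chart R n M -> 'cV[R]_n;
  coord_change : forall th1 th2, atlas S th1 -> atlas S th2 ->
    dom th1 base -> dom th2 base ->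
    coord th1 = jacobian (transition th1 th2) (th1 base) *m coord th2;
  coord_out : forall th, ~ (atlas S th /\ dom th base) -> coord th = 0 }.

Section cotangent_theory.
Context {R : realType} {n : nat} {M : ptopologicalType}.
Variable S : smooth_structure R n M.
Implicit Type p : cotangent S.

Program Definition cotangent_zero (x : M) : cotangent S :=
  @Cotangent R n M S x (fun=> 0) _ _.
Next Obligation. by move=> *; rewrite mulmx0. Qed.
Next Obligation. by []. Qed.

Program Definition cotangent_opp p : cotangent S :=
  @Cotangent R n M S (base p) (fun th => - coord p th) _ _.
Next Obligation.
by move=> p th1 th2 a1 a2 d1 d2; rewrite mulmxN -coord_change.
Qed.
Next Obligation. by move=> p th h /=; rewrite coord_out ?oppr0. Qed.

HB.instance Definition _ := gen_eqMixin (cotangent S).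
HB.instance Definition _ := gen_choiceMixin (cotangent S).
HB.instance Definition _ := isPointed.Build (cotangent S) (cotangent_zero point).

Definition bundle_chart (th : chart R n M) p : 'rV[R]_n * 'cV[R]_n :=
  (th (base p), coord p th).

(** The vector bundle topology: the one for which the maps [bundle_chart th],
    restricted to the covectors based in [dom th], are homeomorphisms onto
    [codom th `*` setT]. *)
Definition cotangent_open (W : set (cotangent S)) :=
  forall p th, W p -> atlas S th -> dom th (base p) ->
    \forall z \near bundle_chart th p,
      forall q, dom th (base q) -> bundle_chart th q = z -> W q.

Lemma cotangent_openT : cotangent_open setT.
Proof. by move=> p th _ _ _; near=> z. Unshelve. all: by end_near. Qed.

Lemma cotangent_openI : setI_closed cotangent_open.
Proof.
move=> A B oA oB p th [Ap Bp] ath dp.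
have nA := oA p th Ap ath dp; have nB := oB p th Bp ath dp.
by apply: filterS2 nA nB => z hA hB q dq qz; split; [exact: hA|exact: hB].
Qed.

Lemma cotangent_open_bigU (I : Type) (f : I -> set (cotangent S)) :
  (forall i, cotangent_open (f i)) -> cotangent_open (\bigcup_i f i).
Proof.
move=> of_ p th [i _ fip] ath dp.
by apply: filterS (of_ i p th fip ath dp) => z h q dq qz; exists i => //; exact: h.
Qed.

HB.instance Definition _ := isOpenTopological.Build (cotangent S)
  cotangent_openT cotangent_openI cotangent_open_bigU.

(** [f] is differentiable at [base p], with differential [p]. *)
Definition is_differential (f : M -> R) p :=
  forall th, atlas S th -> dom th (base p) ->
    is_diff (th (base p)) (f \o cinv th)
            (fun v : 'rV[R]_n => (v *m coord p th) 0 0).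

(** The value of the function [h] at [base p] need not be that of [f]. *)
Definition is_approx_differential (f : M -> \bar R) p :=
  exists2 h : M -> R, is_differential h p &
    forall th, atlas S th -> dom th (base p) ->
      density_one (th @` (dom th `&` [set x | f x = (h x)%:E])) (th (base p)).

Definition absolutely_continuous (mu : set M -> \bar R) :=
  forall th (B : set (borel 'rV[R]_n)), atlas S th -> measurable B ->
    lebesgue_rV B = 0%E -> mu (dom th `&` th @^-1` B) = 0%E.

End cotangent_theory.

(** * Semi-concavity *)
Section semiconcavity.
Context {R : realType}.

Definition modulus (w : R -> R) :=
  [/\ {within `[0, +oo[, continuous w},
      {in `[0, +oo[ &, {homo w : s t / s <= t}},
      forall t, 0 <= t -> 0 <= w t &
      w 0 = 0].

(** The norm of ['rV_n] is the sup norm; all the norms of R^n define the same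
    functions that are semi-concave for some modulus. *)
Definition semiconcave (n : nat) (w : R -> R) (U : set 'rV[R]_n)
    (f : 'rV[R]_n -> R) :=
  forall x, U x -> exists l : {linear 'rV[R]_n -> R^o}, forall y, U y ->
    f y - f x <= l (y - x) + `|y - x| * w `|y - x|.

Definition unif_locally_semiconcave (n : nat) (M : topologicalType)
    (S : smooth_structure R n M) (I : Type) (D : set I) (f : I -> M -> R) :=
  forall x : M, exists th : chart R n M,
    [/\ atlas S th, dom th x &
        exists2 w, modulus w &
          forall i, D i -> semiconcave w (codom th) (f i \o cinv th)].

End semiconcavity.

(** * Costs and transport *)
Section cost.
Context {R : realType} {n : nat} {M N : ptopologicalType}.
Variables (S : smooth_structure R n M) (c : M * N -> R).

Definition semiconcave_loc_unif :=
  forall y0 : N, exists2 V : set N, nbhs y0 V &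
    unif_locally_semiconcave S V (fun y x => c (x, y)).

(** The partial derivative of [c] with respect to its first variable exists at
    [z], and [p] is the element of T*M made of [z.1] and of this derivative. *)
Definition is_partial1 (z : M * N) (p : cotangent S) :=
  base p = z.1 /\ is_differential (fun x => c (x, z.2)) p.

Definition left_twist :=
  forall z z' p, is_partial1 z p -> is_partial1 z' p -> z = z'.

End cost.

Section transport.
Context {R : realType} {M N : ptopologicalType}.
Variables (mu : probability (borel M) R) (nu : probability (borel N) R).
Variable c : M * N -> R.
Local Open Scope ereal_scope.

Definition is_plan (g : probability (borel (M * N)%type) R) :=
  (forall A : set (borel M), measurable A -> g (fst @^-1` A) = mu A) /\
  (forall B : set (borel N), measurable B -> g (snd @^-1` B) = nu B).

Definition plan_cost (g : probability (borel (M * N)%type) R) : \bar R :=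
  \int[g]_z (c z)%:E.

Definition is_optimal_plan (g : probability (borel (M * N)%type) R) :=
  is_plan g /\ forall g', is_plan g' -> plan_cost g <= plan_cost g'.

Definition is_transport_map (T : borel M -> borel N) :=
  measurable_fun setT T /\
  forall B : set (borel N), measurable B -> mu (T @^-1` B) = nu B.

Definition map_cost (T : borel M -> borel N) : \bar R :=
  \int[mu]_x (c (x, T x))%:E.

Definition is_optimal_map (T : borel M -> borel N) :=
  is_transport_map T /\
  forall T', is_transport_map T' -> map_cost T <= map_cost T'.

Definition c_subsolution (phi : M -> \bar R) (psi : N -> \bar R) :=
  [/\ forall x, phi x != -oo, forall y, psi y != +oo &
      forall x y, psi y - phi x <= (c (x, y))%:E].

Definition calibrated_pair (phi : M -> \bar R) (psi : N -> \bar R) :=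
  [/\ c_subsolution phi psi,
      measurable_fun setT (phi : borel M -> \bar R),
      measurable_fun setT (psi : borel N -> \bar R) &
      exists2 g, is_optimal_plan g &
        {ae g, forall z, psi z.2 - phi z.1 = (c z)%:E}].

End transport.

(* Main.v *)
Require Import Defs.
From HB Require Import structures.
From mathcomp Require Import all_boot all_order all_algebra.
From mathcomp Require Import all_classical all_reals all_analysis.
From mathcomp Require Import measurable_realfun.
From mathcomp Require Import ring lra.
Set Implicit Arguments.
Unset Strict Implicit.
Unset Printing Implicit Defensive.
Import Order.TTheory GRing.Theory Num.Theory.
Import numFieldNormedType.Exports.
Local Open Scope classical_set_scope.
Local Open Scope ring_scope.

(** Let g be the optimal plan of the calibrated pair (phi, psi), and call contact
    set the set of the (x, y) where psi y - phi x = c (x, y). If (x0, y) is in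
    contact then phi is touched from below at x0 by the function
    x |-> psi y - c (x, y), which is locally semi-convex.

    Differentiability. The manifold and N are cut into countably many pieces: a
    chart domain, and a slice of N on which psi is bounded from above and the cost
    is semi-concave in this chart with a single modulus. On each piece the supremum
    over the slice of the functions psi y - c (., y) is an [envelope] that is at
    most phi and equals phi at each point in contact with the slice. It satisfies
    an approximate Jensen inequality, so it is differentiable at almost every point
    where it has a subgradient ([semiconvex_gradient_ae]): a point of
    non-differentiability is steep in a coordinate direction, sets of uniformly
    steep points are porous ([steep_porous]), and porous sets are null by the
    Lebesgue density theorem. The set where phi equals the envelope is Borel, and
    almost all its points are density points of it ([density_one_ae]). Hence at
    almost every point in contact with the slice phi has an approximate
    differential, which is the differential of the envelope. The functions
    psi y - c (., y) that touch the envelope from below at such a point have the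
    same differential ([has_gradient_touch]); so the partial derivative of c at
    every (x, y) in contact is minus the approximate differential of phi at x.
    The latter is unique, and the twist condition leaves one y ([contact_unique]):
    over a set of full measure the contact set is a graph.

    Transport. Truncated potentials have the same integrals against all the plans,
    which implies that every plan that costs at most as much as g is concentrated
    on the contact set ([calibrated_coupling]). Exhausting the contact set by closed
    sets over compact subsets of N, whose projections to M are closed, makes the
    graph that of a Borel map ([graph_map]), and this map costs as much as g.
    Hence the plan of an optimal map costs no more than g, the graph of the map is
    almost everywhere in the contact set, and this gives the formula, the
    uniqueness and the set A. The approximate differential is Borel on A because its
    coordinates are limits of difference quotients of the envelopes. *)

(** * The Lebesgue outer measure of boxes *)

Section lebesgue_outer.
Context {R : realType} {n : nat}.
Local Notation V := 'rV[R]_n.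
Local Notation lam := (@lebesgue_rV R n).
Implicit Types (a b : V) (E : set V).

Lemma box_volume_ge0 a b : 0 <= box_volume a b.
Proof. by apply: prodr_ge0 => i _; rewrite le_max lexx. Qed.

(** Covers indexed by a countable type are re-indexed by [nat] through [pickle]; this
    treats single boxes, the empty cover and covers of covers alike. *)
Lemma lebesgue_cover (I : countType) (P : set I) (a b : I -> V) E :
  E `<=` \bigcup_(i in P) box (a i) (b i) ->
  (lam E <= \esum_(i in P) (box_volume (a i) (b i))%:E)%E.
Proof.
move=> EP; apply: ereal_inf_lbound.
pose D := [pred k | `[< (pickle @` P) k >]].
pose a' k := if unpickle k is Some i then a i else 0.
pose b' k := if unpickle k is Some i then b i else 0.
exists D, a', b'; split.
  move=> x /EP[i Pi xi]; exists (pickle i).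
    by apply/asboolP; exists i.
  by rewrite /a' /b' pickleK.
rewrite nneseries_esum; last by move=> k _; rewrite lee_fin box_volume_ge0.
rewrite (_ : [set x | D x] = pickle @` P); last first.
  by apply/seteqP; split => [x /asboolP|x ?] //; apply/asboolP.
rewrite esum_image; last by move=> i j _ _; apply: (pcan_inj pickleK).
by apply: eq_esum => i _; rewrite /a' /b' pickleK.
Qed.

Lemma lebesgue_ge0 E : (0 <= lam E)%E.
Proof.
apply: le_ereal_inf_tmp => _ [D [a [b [_ ->]]]].
by apply: nneseries_ge0 => k _ _; rewrite lee_fin box_volume_ge0.
Qed.

Lemma lebesgue_le_box a b E : E `<=` box a b -> (lam E <= (box_volume a b)%:E)%E.
Proof.
move=> Eab.
have := @lebesgue_cover unit setT (fun=> a) (fun=> b) E.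
rewrite (_ : [set: unit] = [set tt]); last by apply/seteqP; split => // -[].
rewrite esum_set1 ?lee_fin ?box_volume_ge0//; apply.
by move=> x /Eab ?; exists tt.
Qed.

Lemma lebesgue0 : lam set0 = 0.
Proof.
apply/eqP; rewrite eq_le lebesgue_ge0 andbT.
have := @lebesgue_cover nat set0 (fun=> 0) (fun=> 0) set0.
by rewrite esum_set0; apply; exact: sub0set.
Qed.

Lemma le_lebesgue : {homo lam : A B / A `<=` B >-> (A <= B)%E}.
Proof.
move=> A B AB; apply: le_ereal_inf => _ [D [a [b [Bab ->]]]].
by exists D, a, b; split => //; exact: subset_trans Bab.
Qed.

Lemma lebesgue_adherent E (e : R) : (lam E < +oo)%E -> 0 < e ->
  exists (D : pred nat) (a b : nat -> V),
    E `<=` \bigcup_(k in [set k | D k]) box (a k) (b k) /\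
    (\sum_(0 <= k <oo | D k) (box_volume (a k) (b k))%:E <= lam E + e%:E)%E.
Proof.
move=> Efin e0.
have : lam E \is a fin_num by rewrite ge0_fin_numE ?lebesgue_ge0.
move=> /(lb_ereal_inf_adherent e0)[_ [D [a [b [Eab ->]]]] /ltW h].
by exists D, a, b.
Qed.

Lemma lebesgue_sigma_subadditive : sigma_subadditive lam.
Proof.
move=> A; have [[i ioo]|] := pselect (exists i, lam (A i) = +oo%E).
  rewrite (eseries_pinfty _ _ ioo) ?leey// => k _.
  by rewrite -ltNye (lt_le_trans _ (lebesgue_ge0 _)).
rewrite -forallNE => Aoo; apply/lee_addgt0Pr => e e0.
rewrite (le_trans _ (epsilon_trick _ _ (ltW e0)))//; last first.
  by move=> k; exact: lebesgue_ge0.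
pose P k (u : pred nat * (nat -> V) * (nat -> V)) :=
  A k `<=` \bigcup_(j in [set j | u.1.1 j]) box (u.1.2 j) (u.2 j) /\
  (\sum_(0 <= j <oo | u.1.1 j) (box_volume (u.1.2 j) (u.2 j))%:E
     <= lam (A k) + (e / (2 ^ k.+1)%:R)%:E)%E.
have [G PG] : {G : nat -> pred nat * (nat -> V) * (nat -> V) & forall k, P k (G k)}.
  apply: (@choice _ _ P) => k.
  have ek : 0 < e / (2 ^ k.+1)%:R by rewrite divr_gt0// ltr0n expn_gt0.
  have Ak : (lam (A k) < +oo)%E by rewrite ltey; apply/eqP/Aoo.
  have [D [a [b [h1 h2]]]] := lebesgue_adherent Ak ek.
  by exists (D, a, b).
pose Q : set (nat * nat) := [set ij | (G ij.1).1.1 ij.2].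
pose v ij := (box_volume ((G ij.1).1.2 ij.2) ((G ij.1).2 ij.2))%:E.
have v0 ij : (0 <= v ij)%E by rewrite lee_fin box_volume_ge0.
apply: (@le_trans _ _ (\esum_(ij in Q) v ij)).
  apply: (@lebesgue_cover (nat * nat)%type Q (fun ij => (G ij.1).1.2 ij.2)
    (fun ij => (G ij.1).2 ij.2)) => x [i _ /(PG i).1[j Gj xj]].
  by exists (i, j).
rewrite (_ : Q = [set ij | setT ij.1 /\ [set j | (G ij.1).1.1 j] ij.2]); last first.
  by apply/seteqP; split => -[i j] //= [].
rewrite -(@esum_esum _ _ _ setT (fun i => [set j | (G i).1.1 j]) (fun i j => v (i, j)))//.
rewrite -nneseries_esumT; last by move=> i; apply: esum_ge0.
apply: lee_nneseries => k _; first by move=> _; apply: esum_ge0.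
rewrite -(@nneseries_esum _ (fun j => v (k, j)) (G k).1.1)//.
exact: (PG k).2.
Qed.

End lebesgue_outer.

HB.instance Definition _ (R : realType) (n : nat) :=
  isOuterMeasure.Build R 'rV[R]_n (@lebesgue_rV R n) lebesgue0 lebesgue_ge0
    le_lebesgue lebesgue_sigma_subadditive.

Section box_split.
Context {R : realType} {n : nat}.
Local Notation V := 'rV[R]_n.
Local Notation lam := (@lebesgue_rV R n).
Implicit Types (a b : V) (E : set V).

(** Moves one face of a box. *)
Definition upd a (i : 'I_n) (s : R) : V := \row_j if j == i then s else a 0 j.

(** The hyperplane x_i = s cuts a box into two boxes, one of which may be empty; the
    maximum with 0 in [box_volume] makes this case true as well. *)
Lemma box_volume_split a b i s :
  box_volume a (upd b i (Num.min (b 0 i) s)) +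
  box_volume (upd a i (Num.max (a 0 i) s)) b = box_volume a b.
Proof.
rewrite /box_volume (bigD1 i)//= [X in _ + X](bigD1 i)//= [RHS](bigD1 i)//=.
under eq_bigr => j ji do rewrite mxE (negbTE ji).
under [X in _ + _ * X]eq_bigr => j ji do rewrite mxE (negbTE ji).
rewrite -mulrDl !mxE eqxx; congr (_ * _).
rewrite /Num.max /Num.min.
by case: (ltP (b 0 i) s) => ?; case: (ltP (a 0 i) s) => ?; do ! case: ltP => ?; lra.
Qed.

(** Cutting every box of a cover by the hyperplane keeps the total volume. Half-spaces
    generate the boxes, and the boxes the Borel sets. *)
Lemma half_space_caratheodory i s :
  (caratheodory_measurable lam) [set x : V | x 0 i <= s].
Proof.
apply: le_caratheodory_measurable => X.
apply: le_ereal_inf_tmp => _ [D [a [b [Xab ->]]]].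
under eq_eseriesr => k _ do
  rewrite -(box_volume_split (a k) (b k) i s) EFinD.
rewrite nneseriesD//; [|by move=> *; rewrite lee_fin box_volume_ge0..].
apply: leeD; apply: ereal_inf_lbound; do 3 eexists; (split; last by []).
- move=> x [/Xab[k Dk xk] /= xs]; exists k => // j; have := xk j.
  rewrite !in_itv/= mxE; case: eqP => [->|//] /andP[-> h] /=.
  by rewrite le_min h.
- move=> x [/Xab[k Dk xk] /= /negP]; rewrite -ltNge => xs; exists k => // j.
  have := xk j; rewrite !in_itv/= mxE; case: eqP => [->|//] /andP[h ->].
  by rewrite gt_max h xs.
Qed.

End box_split.

Section volume_lower_bound.
Context {R : realType}.

Definition tail n (a : 'rV[R]_n.+1) : 'rV[R]_n := \row_j a 0 (lift ord0 j).

Lemma box_volumeS n (a b : 'rV[R]_n.+1) :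
  box_volume a b = Num.max 0 (b 0 0 - a 0 0) * box_volume (tail a) (tail b).
Proof.
rewrite /box_volume big_ord_recl; congr (_ * _).
by apply: eq_bigr => i _; rewrite !mxE.
Qed.

(** Induction on the dimension. The boxes whose first side contains t give, by their
    other sides, a cover of the section of the box at t; integrating over t the
    inequality between the volumes of the sections gives the result. *)
Lemma box_volume_le_cover n (D : pred nat) (a b : 'rV[R]_n)
    (A B : nat -> 'rV[R]_n) :
  box a b `<=` \bigcup_(k in [set k | D k]) box (A k) (B k) ->
  ((box_volume a b)%:E <= \sum_(0 <= k <oo | D k) (box_volume (A k) (B k))%:E)%E.
Proof.
elim: n D a b A B => [|n IH] D a b A B sub.
  have [k /= Dk _] : (\bigcup_(k in [set k | D k]) box (A k) (B k)) 0.
    by apply: sub => -[].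
  rewrite (nneseriesD1 (n := k))//; last first.
    by move=> *; rewrite lee_fin box_volume_ge0.
  rewrite /box_volume !big_ord0 leeDl// nneseries_ge0// => *.
  by rewrite lee_fin prodr_ge0// => i _; rewrite le_max lexx.
pose I (u v : R) : set R := `]u, v]%classic.
have key (t : R) : ((box_volume (tail a) (tail b) * \1_(I (a 0 0) (b 0 0)) t)%:E <=
  \sum_(0 <= k <oo | D k)
    (box_volume (tail (A k)) (tail (B k)) * \1_(I (A k 0 0) (B k 0 0)) t)%:E)%E.
  rewrite [in leLHS]indicE; case: (boolP (t \in I (a 0 0) (b 0 0))) => [/set_mem tab|_]; last first.
    rewrite mulr0 nneseries_ge0// => k _ _.
    by rewrite lee_fin mulr_ge0// box_volume_ge0.
  rewrite mulr1.
  pose Dt k := D k && (A k 0 0 < t <= B k 0 0).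
  apply: (@le_trans _ _
    (\sum_(0 <= k <oo | Dt k) (box_volume (tail (A k)) (tail (B k)))%:E)%E).
    apply: IH => y yab.
    pose x : 'rV[R]_n.+1 := \row_j if unlift ord0 j is Some i then y 0 i else t.
    have x0 : x 0 0 = t by rewrite mxE unlift_none.
    have xS j : x 0 (lift ord0 j) = y 0 j by rewrite mxE liftK.
    have [j|k Dk xk] := sub x.
      case: (unliftP ord0 j) => [i ->|->].
        by rewrite xS; have := yab i; rewrite !mxE.
      by rewrite x0; exact: tab.
    exists k; first by rewrite /= /Dt Dk; have := xk 0; rewrite x0 in_itv.
    by move=> i; have := xk (lift ord0 i); rewrite xS !mxE.
  rewrite eseries_mkcond [in leRHS]eseries_mkcond.
  apply: lee_nneseries => k _.
    by move=> _; case: ifP => _//; rewrite lee_fin box_volume_ge0.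
  rewrite /Dt indicE; case: (D k) => //=; case: ifPn => [h|_].
    by rewrite mem_set ?mulr1//= /I/= in_itv.
  by rewrite lee_fin mulr_ge0// box_volume_ge0.
have mI u v : measurable (I u v) by exact: measurable_itv.
have intI (c u v : R) : 0 <= c ->
    (\int[lebesgue_measure]_t (c * \1_(I u v) t)%:E = (Num.max 0 (v - u) * c)%:E)%E.
  move=> c0; under eq_integral do rewrite EFinM.
  rewrite ge0_integralZl//; last first.
    by apply/measurable_EFinP; apply: measurable_indic; exact: mI.
  rewrite integral_indic; [|by []|exact: mI].
  have mes : lebesgue_measure (I u v) = (Num.max 0 (v - u))%:E.
    rewrite /I lebesgue_measure_itv/= lte_fin -subr_gt0 /Num.max.
    by case: ifP => // _; rewrite EFinB.
  by rewrite setIT EFinM muleC -mes.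
rewrite box_volumeS -intI ?box_volume_ge0//.
under eq_eseriesr => k _ do rewrite box_volumeS -intI ?box_volume_ge0//.
rewrite eseries_mkcond.
pose f k t : \bar R := if D k then
  (box_volume (tail (A k)) (tail (B k)) * \1_(I (A k 0 0) (B k 0 0)) t)%:E else 0%E.
rewrite (_ : (\sum_(0 <= k <oo) _)%E =
  (\sum_(0 <= k <oo) \int[lebesgue_measure]_t f k t)%E); last first.
  apply: eq_eseriesr => k _; rewrite /f; case: (D k) => //.
  by rewrite integral0.
have f0 k t : (0 <= f k t)%E.
  by rewrite /f; case: (D k) => //; rewrite lee_fin mulr_ge0// box_volume_ge0.
have mf k : measurable_fun setT (f k).
  rewrite /f; case: (D k) => //; apply/measurable_EFinP.
  by apply: measurable_funM => //; apply: measurable_indic; exact: mI.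
rewrite -integral_nneseries//.
apply: ge0_le_integral => //.
- by move=> t _; rewrite lee_fin mulr_ge0// box_volume_ge0.
- apply/measurable_EFinP.
  by apply: measurable_funM => //; apply: measurable_indic; exact: mI.
- by apply: ge0_emeasurable_sum => [k x _ _|k _]; [exact: f0|exact: mf].
- by move=> t _; rewrite (le_trans (key t))// eseries_mkcond.
Qed.

Lemma lebesgue_box n (a b : 'rV[R]_n) : lebesgue_rV (box a b) = (box_volume a b)%:E.
Proof.
apply/eqP; rewrite eq_le lebesgue_le_box//=.
apply: le_ereal_inf_tmp => _ [D [A [B [sub ->]]]].
exact: box_volume_le_cover.
Qed.

End volume_lower_bound.

(** * Second countable spaces and Borel sets *)

Lemma exists_invS_lt (R : realType) (e : R) : 0 < e -> exists k, k.+1%:R^-1 < e.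
Proof. by move=> /ltr_add_invr[k]; rewrite add0r; exists k. Qed.

Section second_countable.

Lemma countable_image (T U : Type) (f : T -> U) (A : set T) :
  countable A -> countable (f @` A).
Proof. by move=> cA; apply: sub_countable cA; exact: card_image_le. Qed.

Lemma openX (T U : topologicalType) (A : set T) (B : set U) :
  open A -> open B -> open (A `*` B).
Proof.
move=> oA oB; rewrite openE => -[x y] [/= Ax By].
by exists (A, B) => //; split; exact: open_nbhs_nbhs.
Qed.

(** Each [O x] contains a basic neighbourhood of x; there are countably many of them,
    and one center is kept for each. *)
Lemma lindelof (T : topologicalType) (A : set T) (O : T -> set T) :
  @second_countable T -> (forall x, A x -> nbhs x (O x)) ->
  exists D : set T, [/\ countable D, D `<=` A & A `<=` \bigcup_(x in D) O x].
Proof.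
move=> [B cB [oB bB]] AO.
have [[x0 _]|A0] := pselect (A !=set0); last first.
  exists set0; split => // x Ax; exfalso; apply: A0; by exists x.
pose B' : set (set T) := [set b | B b /\ exists2 x, A x & b `<=` O x].
have [g gP] : {g : set T -> T & forall b, B' b -> A (g b) /\ b `<=` O (g b)}.
  apply: (@choice _ _ (fun b x => B' b -> A x /\ b `<=` O x)) => b.
  by have [[Bb [x Ax bx]]|nb] := pselect (B' b); [exists x|exists x0].
exists (g @` B'); split.
- apply: countable_image.
  by apply: sub_countable cB; apply: subset_card_le => b [].
- by move=> _ [b B'b <-]; have [] := gP _ B'b.
- move=> x Ax; have [b [Bb bx] bO] := bB x _ (AO x Ax).
  have B'b : B' b by split => //; exists x.
  by exists (g b); [exists b|have [_] := gP _ B'b; exact].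
Qed.

Lemma basis_prod (T U : topologicalType) (B : set (set T)) (C : set (set U)) :
  basis B -> basis C -> basis ((fun p => p.1 `*` p.2) @` (B `*` C)).
Proof.
move=> [oB bB] [oC bC]; split.
  by move=> _ [[b c] [/= Bb Cc] <-]; apply: openX; [exact: oB|exact: oC].
move=> [x y] A [[P Q] [/= xP yQ] PQA].
have [b [Bb bx] bP] := bB x _ xP; have [c [Cc cy] cQ] := bC y _ yQ.
exists (b `*` c); first by split; [exists (b, c)|].
by move=> [u v] [/= bu cv]; apply: PQA; split; [exact: bP|exact: cQ].
Qed.

Lemma second_countable_prod (T U : topologicalType) :
  @second_countable T -> @second_countable U -> @second_countable (T * U)%type.
Proof.
move=> [B cB bB] [C cC bC]; exists ((fun p => p.1 `*` p.2) @` (B `*` C)).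
  by apply: countable_image; exact: countableX.
exact: basis_prod.
Qed.

Lemma second_countable_dense (R : realType) (T : pseudoMetricType R) (D : set T) :
  countable D ->
  (forall x (e : R), 0 < e -> exists2 d, D d & ball x e d) -> @second_countable T.
Proof.
move=> cD dD.
exists ((fun p : T * nat => (ball p.1 (p.2.+1%:R^-1 : R))°) @` (D `*` setT)).
  by apply: countable_image; apply: countableX.
split; first by move=> _ [p _ <-]; exact: open_interior.
move=> x A /nbhs_ballP[e /= e0 xeA].
have [k ke] : exists k, k.+1%:R^-1 < e / 2 by apply: exists_invS_lt; rewrite divr_gt0.
have k0 : 0 < k.+1%:R^-1 :> R by [].
have [d Dd xd] := dD x _ (divr_gt0 k0 (ltr0n _ 2)).
exists (ball d k.+1%:R^-1)°; first split.
- by exists (d, k).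
- apply/nbhs_ballP; exists (k.+1%:R^-1 / 2) => /=; first by rewrite divr_gt0.
  move=> z xz; rewrite [_^-1]splitr; apply: ball_triangle xz.
  exact/ball_sym.
- move=> z /interior_subset dz; apply: xeA.
  apply: (@le_ball _ _ x (k.+1%:R^-1 / 2 + k.+1%:R^-1)).
    rewrite (splitr e) lerD// (le_trans _ (ltW ke))// ler_pdivrMr// ler_peMr// ?invr_ge0//.
    by rewrite ler1n.
  exact: ball_triangle xd dz.
Qed.

Lemma second_countable_mx (R : realType) m n : @second_countable 'M[R]_(m, n).
Proof.
apply: (@second_countable_dense R _ (range (map_mx (@ratr R) : 'M[rat]_(m, n) -> _))).
  by apply: countable_image.
move=> x e e0.
have [q qP] : {q : 'I_m * 'I_n -> rat & forall ij,
    ratr (q ij) \in `]x ij.1 ij.2 - e, x ij.1 ij.2 + e[}.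
  apply: (@choice _ _ (fun ij r => ratr r \in `]x ij.1 ij.2 - e, x ij.1 ij.2 + e[)).
  move=> ij; have [|r rP] := @rat_in_itvoo R (x ij.1 ij.2 - e) (x ij.1 ij.2 + e).
    by rewrite ltrD2l gt0_cp.
  by exists r.
exists (map_mx ratr (\matrix_(i, j) q (i, j))); first by eexists.
split => // i j; rewrite !mxE /ball/= distrC.
by have := qP (i, j); rewrite in_itv/= ltr_distl.
Qed.

End second_countable.

(** Lets the lemmas on [borel T] apply to products. *)
HB.instance Definition _ (T U : ptopologicalType) :=
  Pointed.on (T * U)%type.

Section borel_measurable.

Lemma measurable_bigcup_countable d (T : measurableType d) (I : Type)
    (P : set I) (F : I -> set T) :
  countable P -> (forall i, P i -> measurable (F i)) ->
  measurable (\bigcup_(i in P) F i).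
Proof.
move=> cP mF; rewrite bigcup_set_type; apply: countable_bigcupT_measurable.
  by rewrite (eq_countable (card_setT P)).
by move=> i; apply: mF; exact: set_valP.
Qed.

Lemma open_borel (T : ptopologicalType) (A : set T) :
  open A -> measurable (A : set (borel T)).
Proof. by move=> oA; exact: sub_sigma_algebra. Qed.

Lemma closed_borel (T : ptopologicalType) (A : set T) :
  closed A -> measurable (A : set (borel T)).
Proof.
move=> cA; rewrite -[A]setCK; apply: measurableC.
by apply: open_borel; exact: closed_openC.
Qed.

Section into_borel.
Context d (X : measurableType d) (U : ptopologicalType).
Implicit Types (D : set X) (f : X -> U).

Lemma measurable_fun_borel D f :
  (forall A, open A -> measurable (D `&` f @^-1` A)) ->
  measurable_fun D (f : X -> borel U).
Proof.
move=> mf; apply: (@measurability _ _ X (borel U) D f (@open U)) => //.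
by move=> _ [A oA <-]; exact: mf.
Qed.

Lemma measurable_fun_basis (B : set (set U)) D f :
  countable B -> basis B ->
  (forall b, B b -> measurable (D `&` f @^-1` b)) ->
  measurable_fun D (f : X -> borel U).
Proof.
move=> cB [oB bB] mf; apply: measurable_fun_borel => O oO.
rewrite (_ : D `&` _ =
    \bigcup_(b in [set b | B b /\ b `<=` O]) (D `&` f @^-1` b)).
  apply: measurable_bigcup_countable => [|b [Bb _]]; last exact: mf.
  by apply: sub_countable cB; apply: subset_card_le => b [].
apply/seteqP; split => [x [Dx Ofx]|x [b [Bb bO] [Dx bfx]]].
  have [b [Bb bx] bO] := bB (f x) O (open_nbhs_nbhs (conj oO Ofx)).
  by exists b.
by split => //; exact: bO.
Qed.

End into_borel.

Lemma continuous_borel (T U : ptopologicalType) (D : set T) (f : T -> U) :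
  open D -> (forall x, D x -> {for x, continuous f}) ->
  measurable_fun (D : set (borel T)) (f : borel T -> borel U).
Proof.
move=> oD cf; apply: measurable_fun_borel => O oO; apply: open_borel.
rewrite openE => x [Dx Ox]; apply: filterI; first exact: open_nbhs_nbhs.
by apply: (cf x Dx); exact: open_nbhs_nbhs.
Qed.

Lemma measurable_pair_borel d (X : measurableType d) (T U : ptopologicalType)
    (D : set X) (f : X -> T) (g : X -> U) : measurable D ->
  @second_countable T -> @second_countable U ->
  measurable_fun D (f : X -> borel T) -> measurable_fun D (g : X -> borel U) ->
  measurable_fun D ((fun x => (f x, g x)) : X -> borel (T * U)%type).
Proof.
move=> mD [B cB bB] [C cC bC] mf mg.
apply: (@measurable_fun_basis _ X (T * U)%type
  ((fun p : set T * set U => p.1 `*` p.2) @` (B `*` C)) D (fun x => (f x, g x))).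
- by apply: countable_image; exact: countableX.
- exact: basis_prod.
- move=> _ [[b c] [/= Bb Cc] <-].
  rewrite (_ : _ `&` _ = (D `&` f @^-1` b) `&` (D `&` g @^-1` c)).
    apply: measurableI; [apply: mf => //|apply: mg => //]; apply: open_borel.
      exact: bB.1.
    exact: bC.1.
  by apply/seteqP; split => x /=; tauto.
Qed.

End borel_measurable.

(** * Borel sets and balls for the Lebesgue measure *)

Lemma max0_continuous (R : realType) : continuous (fun t : R => Num.max 0 t).
Proof.
move=> t; apply: (continuous_max (f := cst 0 : R -> R^o) (g := id : R -> R^o)).
  exact: cvg_cst.
exact: cvg_id.
Qed.

Section lebesgue_borel.
Context {R : realType} {n : nat}.
Local Notation V := 'rV[R]_n.
Local Notation lam := (@lebesgue_rV R n).
Local Notation cara := (caratheodory_type lam).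
Implicit Types (a b x : V) (E : set V) (r : R).

Lemma mem_ballP x r y : 0 < r ->
  (ball x r y <-> forall i, `|x 0 i - y 0 i| < r).
Proof.
move=> r0; split=> [[_ xy] i|xy]; first exact: xy.
by split => // i j; rewrite ord1; exact: xy.
Qed.

Lemma box_caratheodory a b : measurable (box a b : set cara).
Proof.
rewrite (_ : box a b = \bigcap_(i in [set: 'I_n])
    ([set x | x 0 i <= b 0 i] `&` ~` [set x | x 0 i <= a 0 i])).
  apply: fin_bigcap_measurable => [|i _]; first exact: finite_finset.
  apply: measurableI; last apply: measurableC; exact: half_space_caratheodory.
apply/seteqP; split => x.
  move=> xab i _; have := xab i; rewrite in_itv/= => /andP[h ->]; split => //=.
  by apply/negP; rewrite -ltNge.
move=> xab i; have [/= h1 /negP h2] := xab i I.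
by rewrite in_itv/= h1 andbT ltNge.
Qed.

(** Countably many boxes suffice, so that open sets inherit measurability from boxes. *)
Lemma open_rat_boxes (O : set V) : open O ->
  O = \bigcup_(p in [set p : 'rV[rat]_n * 'rV[rat]_n |
        box (map_mx ratr p.1) (map_mx ratr p.2) `<=` O])
      box (map_mx ratr p.1) (map_mx ratr p.2).
Proof.
move=> oO; apply/seteqP; split => [x Ox|x [p pO]]; last exact: pO.
have /nbhs_ballP[e /= e0 xeO] := open_nbhs_nbhs (conj oO Ox).
have aux s (i : 'I_n) : {q : rat | ratr q \in `]x 0 i + s - e, x 0 i + s[}.
  apply: cid; have [|r rP] := @rat_in_itvoo R (x 0 i + s - e) (x 0 i + s); last by exists r.
  by rewrite ltrBlDr ltrDl.
pose p : 'rV[rat]_n * 'rV[rat]_n := (\row_i sval (aux 0 i), \row_i sval (aux e i)).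
have h1 (i : 'I_n) : x 0 i - e < ratr (p.1 0 i) < x 0 i.
  by rewrite mxE; case: (aux 0 i) => q /=; rewrite in_itv/= addr0.
have h2 (i : 'I_n) : x 0 i < ratr (p.2 0 i) < x 0 i + e.
  by rewrite mxE; case: (aux e i) => q /=; rewrite in_itv/= addrK.
exists p => [y yp|i]; last first.
  by rewrite in_itv/= mxE [X in _ <= X]mxE; have /andP[_ ->] := h1 i; have /andP[/ltW ->] := h2 i.
apply: xeO; apply/mem_ballP => // i.
have := yp i; rewrite in_itv/= mxE [X in _ <= X]mxE => /andP[y1 y2].
have /andP[? ?] := h1 i; have /andP[? ?] := h2 i.
by rewrite ltr_distl; apply/andP; split; lra.
Qed.

Lemma open_caratheodory (O : set V) : open O -> measurable (O : set cara).
Proof.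
move=> /open_rat_boxes ->; apply: measurable_bigcup_countable => [|p _].
  exact: countableP.
exact: box_caratheodory.
Qed.

Lemma borel_caratheodory (E : set (borel V)) : measurable E ->
  measurable (E : set cara).
Proof.
move: E; apply: smallest_sub; first exact: sigma_algebra_measurable.
exact: open_caratheodory.
Qed.

Lemma box_volume_cube x r : 0 <= r ->
  box_volume (x - const_mx r) (x + const_mx r) = (2 * r) ^+ n.
Proof.
move=> r0; rewrite /box_volume.
under eq_bigr => i _ do rewrite !mxE.
rewrite (eq_bigr (fun=> 2 * r)) ?prodr_const ?card_ord// => i _.
by rewrite /Num.max; case: ltP => ?; lra.
Qed.

Lemma ball_sub_cube x r : ball x r `<=` box (x - const_mx r) (x + const_mx r).
Proof.
move=> y xy i; have r0 : 0 < r by case: xy.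
have /(mem_ballP _ _ r0)/(_ i) := xy; rewrite ltr_distl => /andP[? ?].
by rewrite in_itv/= !mxE; apply/andP; split; lra.
Qed.

Lemma cube_sub_ball x r s : 0 < r -> r < s ->
  box (x - const_mx r) (x + const_mx r) `<=` ball x s.
Proof.
move=> r0 rs y xy; apply/mem_ballP; first exact: lt_trans rs.
move=> i; have := xy i; rewrite in_itv/= !mxE => /andP[? ?].
by rewrite ltr_distl; apply/andP; split; lra.
Qed.

Lemma lebesgue_ball x r : 0 < r -> lam (ball x r) = ((2 * r) ^+ n)%:E.
Proof.
move=> r0; apply/eqP; rewrite eq_le; apply/andP; split.
  rewrite -(box_volume_cube x (ltW r0)); apply: lebesgue_le_box.
  exact: ball_sub_cube.
have lfin : lam (ball x r) \is a fin_num.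
  rewrite ge0_fin_numE ?lebesgue_ge0//.
  by rewrite (le_lt_trans (lebesgue_le_box (@ball_sub_cube x r)))// ltry.
rewrite -(fineK lfin) lee_fin.
have cvg : (fun s : R => (2 * s) ^+ n) @ r^'- --> (2 * r) ^+ n.
  apply: cvg_at_left_filter.
  apply: (continuous_comp (f := fun s : R => 2 * s) (g := fun t => t ^+ n)).
    exact: mulrl_continuous.
  exact: exprn_continuous.
apply: (cvgr_to_le cvg); near=> s.
have s0 : 0 < s by near: s; exact: nbhs_left_gt.
have sr : s < r by near: s; exact: nbhs_left_lt.
rewrite -lee_fin fineK// -(box_volume_cube x (ltW s0)) -lebesgue_box.
by apply: le_lebesgue; exact: cube_sub_ball.
Unshelve. all: by end_near. Qed.

Lemma box_volume_open a b (e : R) : 0 < e -> exists2 d : R, 0 < d &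
  box_volume a (b + const_mx d) <= box_volume a b + e.
Proof.
move=> e0.
have cvg : (fun d : R => box_volume a (b + const_mx d)) @ 0^'+ --> box_volume a b.
  rewrite /box_volume; apply: cvg_big => [|i _].
    exact: mul_continuous.
  under eq_fun do rewrite !mxE.
  rewrite -[X in X - a 0 i]addr0.
  apply: cvg_at_right_filter.
  apply: (@continuous_cvg _ _ _ _ _ (fun d : R => b 0 i + d - a 0 i) (fun t : R => Num.max 0 t)).
    exact: max0_continuous.
  by apply: cvgB; [apply: cvgD; [exact: cvg_cst|exact: cvg_id]|exact: cvg_cst].
near (0:R)^'+ => d.
exists d; first by near: d; exact: nbhs_right_gt.
near: d; apply: (cvgr_le (box_volume a b)) => //.
by rewrite ltrDl.
Unshelve. all: by end_near. Qed.

(** The boxes of an almost optimal cover are half open: pushing their closed faces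
    outwards by a small amount gives open sets that still cover. *)
Lemma lebesgue_outer_regular E e : (lam E < +oo)%E -> 0 < e ->
  exists G, [/\ open G, E `<=` G & (lam G <= lam E + e%:E)%E].
Proof.
move=> Efin e0.
have e20 : 0 < e / 2 by rewrite divr_gt0.
have [D [a [b [Eab hab]]]] := lebesgue_adherent Efin e20.
have [d dP] : {d : nat -> R & forall k, 0 < d k /\
    box_volume (a k) (b k + const_mx (d k)) <=
    box_volume (a k) (b k) + e / 2 / (2 ^ k.+1)%:R}.
  apply: (@choice _ _ (fun k d => 0 < d /\ box_volume (a k) (b k + const_mx d) <=
    box_volume (a k) (b k) + e / 2 / (2 ^ k.+1)%:R)) => k.
  have [|d d0 dP] := box_volume_open (a k) (b k) (e := e / 2 / (2 ^ k.+1)%:R).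
    by rewrite divr_gt0// ltr0n expn_gt0.
  by exists d.
exists (\bigcup_(k in [set k | D k]) (box (a k) (b k + const_mx (d k)))°); split.
- by apply: bigcup_open => k _; exact: open_interior.
- move=> x /Eab[k Dk xk]; exists k => //; apply/nbhs_ballP.
  have : \forall s \near (0:R)^'+, forall i, a k 0 i < x 0 i - s /\ s <= d k.
    apply: filter_forall => i; have := xk i; rewrite in_itv/= => /andP[axi _].
    near=> s; split; last by near: s; apply: nbhs_right_le; exact: (dP k).1.
    by rewrite ltrBrDr -ltrBrDl; near: s; apply: nbhs_right_lt; rewrite subr_gt0.
  move=> H; near (0:R)^'+ => s; exists s => /=; first by near: s; exact: nbhs_right_gt.
  have s0 : 0 < s by near: s; exact: nbhs_right_gt.
  move=> y /(mem_ballP _ _ s0) xy i.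
  have [as_ sd] : a k 0 i < x 0 i - s /\ s <= d k.
    by move: i; near: s.
  have := xk i; rewrite !in_itv/= => /andP[_ xb].
  by have := xy i; rewrite ltr_distl !mxE => /andP[? ?]; apply/andP; split; lra.
- apply: (@le_trans _ _ (\sum_(0 <= k <oo | D k)
     ((box_volume (a k) (b k))%:E + (e / 2 / (2 ^ k.+1)%:R)%:E))%E).
    rewrite nneseries_esum; last first.
      move=> k _; rewrite -EFinD lee_fin addr_ge0 ?box_volume_ge0//.
      by rewrite divr_ge0// ltW.
    apply: (@le_trans _ _ (\esum_(k in [set k | D k])
        (box_volume (a k) (b k + const_mx (d k)))%:E)%E).
      apply: (@lebesgue_cover _ _ nat _ a (fun k => b k + const_mx (d k))).
      by apply: subset_bigcup => k _; exact: interior_subset.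
    apply: le_esum => k _; rewrite -EFinD lee_fin; exact: (dP k).2.
  apply: le_trans (epsilon_trick _ _ (ltW e20)) _.
    by move=> k; rewrite lee_fin box_volume_ge0.
  by rewrite [e in leRHS]splitr EFinD addeA leeD2r.
Unshelve. all: by end_near. Qed.

(** A countable intersection of open sets of small measure. *)
Lemma lebesgue_null_borel E : lam E = 0%E ->
  exists B : set (borel V), [/\ measurable B, E `<=` B & lam B = 0%E].
Proof.
move=> E0.
have [G GP] : {G : nat -> set V & forall k, [/\ open (G k), E `<=` G k &
    (lam (G k) <= (k.+1%:R^-1)%:E)%E]}.
  apply: (@choice _ _ (fun k G => [/\ open G, E `<=` G &
    (lam G <= (k.+1%:R^-1)%:E)%E])) => k.
  have [|//|G [oG EG lG]] := @lebesgue_outer_regular E (k.+1%:R^-1).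
    by rewrite E0 ltry.
  by exists G; rewrite E0 add0e in lG.
exists (\bigcap_k (G k)); split.
- by apply: bigcapT_measurable => k; apply: open_borel; have [] := GP k.
- by move=> x Ex k _; have [_ + _] := GP k; exact.
- apply/eqP; rewrite eq_le lebesgue_ge0 andbT; apply/lee_addgt0Pr => e e0.
  rewrite add0e; have [k ke] := exists_invS_lt e0.
  have [_ _ lG] := GP k; apply: (@le_trans _ _ (lam (G k))).
    by apply: le_lebesgue => x; exact.
  by rewrite (le_trans lG)// lee_fin ltW.
Qed.

End lebesgue_borel.

Section null_sets.
Context {R : realType} {n : nat}.
Local Notation V := 'rV[R]_n.
Local Notation lam := (@lebesgue_rV R n).
Local Notation cara := (caratheodory_type lam).

Lemma lebesgue_null_sub (A B : set V) : A `<=` B -> lam B = 0%E -> lam A = 0%E.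
Proof.
by move=> AB B0; apply/eqP; rewrite eq_le lebesgue_ge0 -B0 le_lebesgue.
Qed.

Lemma lebesgue_null_bigcup (I : countType) (F : I -> set V) :
  (forall i, lam (F i) = 0%E) -> lam (\bigcup_i F i) = 0%E.
Proof.
move=> F0; pose G k := if unpickle k is Some i then F i else set0.
apply: (@lebesgue_null_sub _ (\bigcup_k G k)).
  by move=> x [i _ Fix]; exists (pickle i) => //; rewrite /G pickleK.
apply/eqP; rewrite eq_le lebesgue_ge0 andbT.
apply: le_trans (lebesgue_sigma_subadditive G) _.
rewrite eseries0// => k _ _; rewrite /G; case: unpickle => [i|]; first exact: F0.
exact: lebesgue0.
Qed.

Lemma lebesgueU2 (A B : set V) : (lam (A `|` B) <= lam A + lam B)%E.
Proof. exact: outer_measureU2. Qed.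

Lemma lebesgue_null_setU (A B : set V) :
  lam A = 0%E -> lam B = 0%E -> lam (A `|` B) = 0%E.
Proof.
move=> A0 B0; apply/eqP; rewrite eq_le lebesgue_ge0 andbT.
by rewrite (le_trans (lebesgueU2 _ _))// A0 B0 adde0.
Qed.

Let leb : {outer_measure set V -> \bar R} := lam.
Let lebm : {measure set cara -> \bar R} :=
  (leb : {measure set (caratheodory_type leb) -> \bar R}).

Lemma lebesgueU (A B : set cara) : measurable A -> measurable B ->
  A `&` B = set0 -> lam (A `|` B) = (lam A + lam B)%E.
Proof. exact: (measureU lebm). Qed.

Lemma lebesgue_bigcup_cvg (F : nat -> set cara) :
  (forall k, measurable (F k)) -> nondecreasing_seq F ->
  lam (F k) @[k --> \oo] --> lam (\bigcup_k F k).
Proof.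
move=> mF ndF; apply: (@nondecreasing_cvg_mu _ _ _ lebm) => //.
exact: bigcup_measurable.
Qed.

Lemma lebesgueID (A X : set cara) : measurable A ->
  lam X = (lam (X `&` A) + lam (X `\` A))%E.
Proof. by move=> mA; rewrite setDE; exact: mA. Qed.

Lemma lebesgueD (A X : set cara) : measurable A -> A `<=` X ->
  lam X = (lam A + lam (X `\` A))%E.
Proof. by move=> mA AX; rewrite {1}(lebesgueID X mA) setIidr. Qed.

Lemma lebesgue_fin (A B : set V) : A `<=` B -> (lam B < +oo)%E ->
  lam A \is a fin_num.
Proof.
by move=> AB Bfin; rewrite ge0_fin_numE ?lebesgue_ge0// (le_lt_trans (le_lebesgue AB)).
Qed.

End null_sets.

(** * The Lebesgue density theorem and porous sets *)

Section vitali.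
Context {R : realType} {n : nat}.
Local Notation V := 'rV[R]_n.
Local Notation lam := (@lebesgue_rV R n).
Local Notation cara := (caratheodory_type lam).
Implicit Types (p q : V * R) (s D : seq (V * R)).

Let B p : set V := ball p.1 p.2.
Let disj p q := `[< B p `&` B q = set0 >].

(** Greedy selection: a ball of largest radius is kept, and those that meet it are
    discarded because the tripled ball contains them. *)
Lemma finite_vitali s : exists D, [/\ {subset D <= s}, pairwise disj D &
  forall p, p \in s -> exists2 q, q \in D & B p `<=` ball q.1 (3 * q.2)].
Proof.
have [m] := ubnP (size s); elim: m s => // m IH s; rewrite ltnS => sm.
have [->|s0] := eqVneq s [::]; first by exists [::].
have [p ps pmax] : exists2 p, p \in s & forall q, q \in s -> q.2 <= p.2.
  elim: s s0 {sm} => // p [|p' s'] ih _.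
    by exists p; rewrite ?mem_head// => q; rewrite inE => /eqP ->.
  have [//|q qs qmax] := ih.
  have [pq|/ltW qp] := leP p.2 q.2.
    exists q; first by rewrite inE qs orbT.
    by move=> r; rewrite inE => /orP[/eqP ->//|]; exact: qmax.
  exists p; first by rewrite mem_head.
  move=> r; rewrite inE => /orP[/eqP ->//|/qmax rq]; exact: le_trans qp.
pose s' := [seq q <- s | disj p q].
have [pp|pp] := boolP (disj p p).
  have {}pp : B p = set0 by have /asboolP := pp; rewrite setIid.
  have rp q : q \in s -> B q = set0.
    move=> /pmax qp; apply/seteqP; split => // x [q0 _].
    have : B p p.1 by apply: ballxx; exact: lt_le_trans q0 qp.
    by rewrite pp.
  exists [:: p]; split => // [q|q qs]; first by rewrite inE => /eqP ->.
  by exists p; rewrite ?mem_head// rp.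
have [|D [Ds' pD cD]] := IH s'.
  rewrite size_filter (leq_trans _ sm)// ltnNge; apply: contra pp => h.
  have : all (disj p) s by rewrite all_count eqn_leq count_size.
  by move=> /allP; exact.
exists (p :: D); split.
- move=> q; rewrite inE => /orP[/eqP ->//|/Ds']; by rewrite mem_filter => /andP[].
- rewrite pairwise_cons pD andbT; apply/allP => q /Ds'.
  by rewrite mem_filter => /andP[].
- move=> q qs; have [dq|dq] := boolP (disj p q).
    have [|r rD qr] := cD q; first by rewrite mem_filter dq.
    by exists r => //; rewrite inE rD orbT.
  exists p; first exact: mem_head.
  have /asboolPn/eqP/set0P[z [pz qz]] := dq.
  move=> x qx; apply: (@le_ball _ _ p.1 (p.2 + (q.2 + q.2))).
    by have := pmax q qs; lra.
  by apply: (ball_triangle pz); apply: ball_triangle qx; exact: ball_sym.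
Qed.

Lemma lebesgue_disjoint_balls D : all (fun p => 0 < p.2) D ->
  pairwise disj D ->
  lam (\big[setU/set0]_(p <- D) B p) = (\sum_(p <- D) (2 * p.2) ^+ n)%:E /\
  measurable (\big[setU/set0]_(p <- D) B p : set cara).
Proof.
elim: D => [_ _|p D IH /= /andP[p0 D0] /andP[/allP pD dD]].
  by rewrite !big_nil; split; [exact: lebesgue0|exact: measurable0].
rewrite !big_cons; have [IH1 IH2] := IH D0 dD.
have mp : measurable (B p : set cara) by apply: open_caratheodory; exact: ball_open.
split; last exact: measurableU.
rewrite EFinD -IH1 -(lebesgue_ball p.1 p0).
apply: lebesgueU => //.
apply/seteqP; split => // x [px]; rewrite -bigcup_seq => -[q qD qx].
by have /asboolP/seteqP[+ _] := pD q qD; apply.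
Qed.

(** The cover has a countable subcover, whose finite subfamilies increase to an open
    set of finite measure. *)
Lemma finite_cover_countable (A : set V) (r : V -> R) (e : R) :
  A !=set0 -> (forall x, A x -> 0 < r x) ->
  (lam (\bigcup_(x in A) ball x (r x)) < +oo)%E -> 0 < e ->
  exists s : seq V, (forall x, x \in s -> A x) /\
    (lam (A `\` \big[setU/set0]_(x <- s) ball x (r x)) <= e%:E)%E.
Proof.
move=> A0 r0 fin e0.
have [|D [cD DA cov]] := @lindelof V A (fun x => ball x (r x)) (second_countable_mx R 1 n).
  by move=> x Ax; apply: nbhsx_ballx; exact: r0.
have [x0 Ax0] := A0.
have [D0|[g]] := pfcard_geP cD.
  by have := cov x0 Ax0; rewrite D0 => -[].
have gA i : A (g i) by apply: DA; exact: (@funS _ _ _ _ g i I).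
pose F k := \bigcup_(i in `I_k) ball (g i) (r (g i)).
pose W := \bigcup_k F k.
have oF k : open (F k).
  by apply: bigcup_open => i _; apply: ball_open; exact: r0.
have ndF : nondecreasing_seq F.
  by move=> i j ij; apply/subsetPset => x [l li xl]; exists l => //; exact: leq_trans ij.
have AW : A `<=` W.
  move=> x /cov[y Dy xy]; have [k _ gk] := @surj _ _ _ _ g y Dy.
  by exists k.+1 => //; exists k; rewrite ?gk //=.
have WA : W `<=` \bigcup_(x in A) ball x (r x).
  move=> x [k _] [i _ xi].
  by exists (g i).
have Wfin := lebesgue_fin WA fin.
have mF k : measurable (F k : set cara) by apply: open_caratheodory.
have := @lebesgue_bigcup_cvg _ _ F mF ndF; rewrite -/W -(fineK Wfin).
move=> /(_ _ (nbhs_open_ereal_gt (f := fun t => t - e) _)) => /(_ _)[|k _ Fk].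
  by rewrite gtrBl.
have {Fk} Fk := Fk k (leqnn k).
exists [seq g i | i <- iota 0 k]; split.
  by move=> x /mapP[i _ ->].
rewrite (_ : \big[setU/set0]_(x <- _) _ = F k); last first.
  rewrite -bigcup_seq; apply/seteqP; split => [x [_ /mapP[i ik ->] xi]|x [i ik xi]].
    by exists i => //; move: ik; rewrite mem_iota.
  by exists (g i) => //; apply/mapP; exists i; rewrite ?mem_iota.
apply: (@le_trans _ _ (lam (W `\` F k))); first by apply: le_lebesgue; exact: setSD.
have FW : F k `<=` W by exact: bigcup_sup.
have := lebesgueD (mF k) FW.
have Ffin := lebesgue_fin (subset_trans FW WA) fin.
have Dfin := lebesgue_fin (subset_trans (@subDsetl _ W (F k)) WA) fin.
move: Fk; rewrite /= -(fineK Wfin) -(fineK Ffin) -(fineK Dfin) -EFinD lte_fin lee_fin => Fk [].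
lra.
Qed.

(** The exceptional points in a bounded region form a set A. It is covered by balls
    that lie in an open set barely larger than A and that E, hence A, fills up to the
    fraction 1 - t at most. Finitely many of them cover almost all A, and among these
    [finite_vitali] selects disjoint ones, of total volume S. As A misses the volume
    t * S of the open set, S is small; as the tripled balls cover almost all A, the
    measure of A is at most 3 ^ n * S up to a small error. The set E is arbitrary,
    since it will be a set of points of bad behaviour given without any structure. *)
Theorem lebesgue_rV_density (E : set V) (t : R) : 0 < t ->
  lam [set x | E x /\ forall d : R, 0 < d -> exists r : R, 0 < r < d /\
    (lam (E `&` ball x r) <= ((1 - t) * (2 * r) ^+ n)%:E)%E] = 0%E.
Proof.
move=> t0; set Z := [set x | _].
suff bounded m : lam (Z `&` ball 0 m.+1%:R) = 0%E.
  apply: (@lebesgue_null_sub _ _ _ (\bigcup_m (Z `&` ball 0 m.+1%:R))).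
    move=> x Zx; exists (Num.truncn `|x|) => //; split => //.
    by rewrite -ball_normE /= sub0r normrN truncnS_gt.
  exact: lebesgue_null_bigcup.
set A := Z `&` _.
have [A0|] := pselect (A !=set0); last first.
  by move=> /set0P/negP/negPn/eqP ->; exact: lebesgue0.
have Afin : lam A \is a fin_num.
  rewrite ge0_fin_numE ?lebesgue_ge0//.
  apply: (@le_lt_trans _ _ (lam (ball (0 : V) m.+1%:R))).
    by apply: le_lebesgue => x [].
  by rewrite lebesgue_ball ?ltry.
apply/eqP; rewrite eq_le lebesgue_ge0 andbT -(fineK Afin) lee_fin.
apply/ler_addgt0Pr => e e0; rewrite add0r.
pose c : R := (3 ^+ n / t + 1).
have c0 : 0 < c by rewrite ltr_pwDr// divr_ge0 ?exprn_ge0// ltW.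
(* with S <= h / t, the final bound 3 ^ n * S + h is at most e *)
pose h := e / c.
have h0 : 0 < h by rewrite divr_gt0.
have [|G [oG AG lG]] := @lebesgue_outer_regular _ _ A h _ h0.
  by rewrite -ge0_fin_numE ?lebesgue_ge0.
have [r rP] : {r : V -> R & forall x, A x -> [/\ 0 < r x, ball x (r x) `<=` G &
    (lam (E `&` ball x (r x)) <= ((1 - t) * (2 * r x) ^+ n)%:E)%E]}.
  apply: (@choice _ _ (fun x r => A x -> [/\ 0 < r, ball x r `<=` G &
    (lam (E `&` ball x r) <= ((1 - t) * (2 * r) ^+ n)%:E)%E])) => x.
  have [Ax|nAx] := pselect (A x); last by exists 0.
  have /nbhs_ballP[d /= d0 xdG] := open_nbhs_nbhs (conj oG (AG _ Ax)).
  have [[_ /(_ d d0)[r [/andP[r0 rd] rE]]] _] := Ax.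
  exists r => _; split => //; apply: subset_trans xdG; apply: le_ball; exact: ltW.
have Gfin : lam G \is a fin_num.
  by rewrite ge0_fin_numE ?lebesgue_ge0// (le_lt_trans lG)// -(fineK Afin) ltry.
have UG : \bigcup_(x in A) ball x (r x) `<=` G.
  by move=> y [x Ax]; have [_ + _] := rP x Ax; exact.
have [||s [sA ls]] := @finite_cover_countable A r h A0 _ _ h0.
- by move=> x /rP[].
- by rewrite (le_lt_trans (le_lebesgue UG))// -ge0_fin_numE ?lebesgue_ge0.
have [D [Ds dD cD]] := finite_vitali [seq (x, r x) | x <- s].
have DP p : p \in D -> [/\ 0 < p.2, B p `<=` G &
    (lam (E `&` B p) <= ((1 - t) * (2 * p.2) ^+ n)%:E)%E].
  by move=> /Ds/mapP[x /sA/rP + ->]; exact.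
have D0 : all (fun p => 0 < p.2) D by apply/allP => p /DP[].
have [lU mU] := lebesgue_disjoint_balls D0 dD.
set U := \big[setU/set0]_(p <- D) B p in lU mU.
set S := \sum_(p <- D) _ in lU.
have UsubG : U `<=` G.
  by rewrite /U -bigcup_seq => x [p /DP[_ + _]]; exact.
(* A takes at most the fraction 1 - t of the selected balls *)
have h1 : (lam A <= ((1 - t) * S)%:E + (lam G - S%:E))%E.
  rewrite (lebesgueID A mU); apply: leeD.
    rewrite /U big_distrr/= /S mulr_sumr -sumEFin.
    apply: (@le_trans _ _ (\sum_(p <- D) lam (A `&` B p))%E).
      elim: (D) => [|p D' IH]; first by rewrite !big_nil lebesgue0.
      by rewrite !big_cons (le_trans (lebesgueU2 _ _))// leeD2l.
    rewrite big_seq [in leRHS]big_seq; apply: lee_sum => p /DP[_ _].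
    apply: le_trans; apply: le_lebesgue => x [[[Ex _] _] px]; by split.
  rewrite (lebesgueD mU UsubG) lU.
  by rewrite addeAC subee// add0e; apply: le_lebesgue; exact: setSD.
(* the tripled balls cover A up to a set of measure h *)
have h2 : (lam A <= (3 ^+ n * S + h)%:E)%E.
  apply: le_trans (_ : _ <= lam (\big[setU/set0]_(p <- D) ball p.1 (3 * p.2)) + h%:E)%E _.
    apply: (@le_trans _ _ (lam (\big[setU/set0]_(p <- D) ball p.1 (3 * p.2) `|`
       (A `\` \big[setU/set0]_(x <- s) ball x (r x))))); last first.
      by apply: le_trans (lebesgueU2 _ _) _; rewrite leeD2l.
    apply: le_lebesgue => x Ax.
    have [|] := pselect ((\big[setU/set0]_(x <- s) ball x (r x)) x); last by right.
    rewrite -bigcup_seq => -[y /= ys xy]; left.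
    have [|q qD] := cD (y, r y); first by apply/mapP; exists y.
    by move=> /(_ _ xy) xq; rewrite -bigcup_seq; exists q.
  rewrite EFinD leeD2r// /S mulr_sumr -sumEFin.
  apply: (@le_trans _ _ (\sum_(p <- D) lam (ball p.1 (3 * p.2)))%E).
    elim: (D) => [|p D' IH]; first by rewrite !big_nil lebesgue0.
    by rewrite !big_cons (le_trans (lebesgueU2 _ _))// leeD2l.
  rewrite big_seq [in leRHS]big_seq; apply: lee_sum => p /DP[p0 _ _].
  by rewrite lebesgue_ball ?mulr_gt0// lee_fin mulrCA exprMn.
move: h1 h2 lG; rewrite -(fineK Afin) -(fineK Gfin) -EFinB -!EFinD !lee_fin.
move: (fine (lam A)) (fine (lam G)) => a g h1 h2 h3.
have tS : S <= h / t by rewrite ler_pdivlMr//; lra.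
have : 3 ^+ n * S <= 3 ^+ n * (h / t) by rewrite ler_wpM2l// exprn_ge0.
have -> : e = 3 ^+ n * (h / t) + h.
  rewrite -[in LHS](divfK (lt0r_neq0 c0) e) -/h /c; ring.
by move=> /=; lra.
Qed.

End vitali.

Section density_points.
Context {R : realType} {n : nat}.
Local Notation V := 'rV[R]_n.
Local Notation lam := (@lebesgue_rV R n).
Local Notation cara := (caratheodory_type lam).
Implicit Types (E F : set V) (a x y : V) (r t : R).

Let mball x r : 0 < r -> measurable (ball x r : set cara).
Proof. by move=> r0; apply: open_caratheodory; exact: ball_open. Qed.

Lemma ball_lebesgue_fin x r E : 0 < r -> E `<=` ball x r -> lam E \is a fin_num.
Proof. by move=> r0 Er; apply: (lebesgue_fin Er); rewrite lebesgue_ball// ltry. Qed.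

(** The two balls have volumes (2 r)^n and t^n (2 r)^n. *)
Lemma lebesgue_avoid E x y r t : 0 < r -> 0 < t -> ball y (t * r) `<=` ball x r ->
  E `&` ball y (t * r) = set0 ->
  (lam (E `&` ball x r) <= ((1 - t ^+ n) * (2 * r) ^+ n)%:E)%E.
Proof.
move=> r0 t0 yx Ey.
have tr0 : 0 < t * r by rewrite mulr_gt0.
apply: (@le_trans _ _ (lam (ball x r `\` ball y (t * r)))).
  apply: le_lebesgue => z [Ez xz]; split => // yz.
  by move/seteqP : Ey => [/(_ z) + _]; apply.
have := lebesgueD (mball y tr0) yx.
have yfin := ball_lebesgue_fin r0 (@subDsetl _ (ball x r) (ball y (t * r))).
rewrite !lebesgue_ball// -(fineK yfin) -EFinD => -[h]; rewrite lee_fin.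
have -> : (1 - t ^+ n) * (2 * r) ^+ n = (2 * r) ^+ n - (2 * (t * r)) ^+ n.
  by rewrite mulrBl mul1r -exprMn mulrCA.
by rewrite h; lra.
Qed.

(** Next to each point of E a ball of comparable radius avoids E, so that no point of E
    satisfies the conclusion of the density theorem. *)
Lemma lebesgue_porous E t : 0 < t ->
  (forall x, E x -> exists2 d : R, 0 < d & forall r, 0 < r < d ->
    exists y, ball y (t * r) `<=` ball x r /\ E `&` ball y (t * r) = set0) ->
  lam E = 0%E.
Proof.
move=> t0 por; apply: (lebesgue_null_sub _ (lebesgue_rV_density E (exprn_gt0 n t0))).
move=> x Ex; split => // d d0; have [d' d'0 xd] := por x Ex.
pose r := Num.min d d' / 2.
have m0 : 0 < Num.min d d' by rewrite lt_min d0.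
have r0 : 0 < r by rewrite divr_gt0.
have rm : r < Num.min d d' by rewrite /r; lra.
move: (rm); rewrite lt_min => /andP[rd rd'].
exists r; rewrite r0 rd; split => //.
have [|y [yx Ey]] := xd r; first by rewrite r0.
exact: lebesgue_avoid yx Ey.
Qed.

(** Clears the quotient of the definition: the complement has proportion o(1). *)
Lemma density_oneP E a : density_one E a <->
  exists F : set (borel V), [/\ measurable F, F `<=` E &
   forall e : R, 0 < e -> \forall r \near 0^'+,
     (lam (ball a r `\` F) <= (e * (2 * r) ^+ n)%:E)%E].
Proof.
have aux F r : measurable (F : set (borel V)) -> 0 < r ->
  exists u : R, [/\ lam (ball a r `\` F) = u%:E, 0 <= u &
   fine (lam (F `&` ball a r)) / fine (lam (ball a r)) = 1 - u / (2 * r) ^+ n].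
  move=> mF r0; exists (fine (lam (ball a r `\` F))).
  have Dfin := ball_lebesgue_fin r0 (@subDsetl _ (ball a r) F).
  have Ifin := ball_lebesgue_fin r0 (@subIsetl _ (ball a r) F).
  split; [by rewrite fineK|by rewrite fine_ge0 ?lebesgue_ge0|].
  have := lebesgueID (ball a r) (borel_caratheodory mF).
  rewrite setIC in Ifin *; rewrite lebesgue_ball//.
  rewrite -(fineK Dfin) -(fineK Ifin) -EFinD => -[h] /=.
  have p0 : (2 * r) ^+ n != 0 by rewrite expf_neq0// mulf_neq0// gt_eqF.
  apply: (mulIf p0); rewrite mulrBl !divfK// mul1r.
  by rewrite setIC in h *; rewrite h; lra.
split=> -[F [mF FE H]]; exists F; split => //.
- move=> e e0; move/cvgrPdist_le : H => /(_ e e0) H.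
  near=> r; have r0 : 0 < r by near: r; exact: nbhs_right_gt.
  have [u [-> u0 h]] := aux F r mF r0.
  have : `|1 - fine (lam (F `&` ball a r)) / fine (lam (ball a r))| <= e.
    by near: r.
  have p0 : 0 < (2 * r) ^+ n by rewrite exprn_gt0// mulr_gt0.
  rewrite h opprB addrC subrK ger0_norm; last by rewrite divr_ge0// ltW.
  by rewrite ler_pdivrMr// lee_fin.
- apply/cvgrPdist_le => e e0; have := H e e0 => {}H.
  near=> r; have r0 : 0 < r by near: r; exact: nbhs_right_gt.
  have [u [hu u0 ->]] := aux F r mF r0.
  have p0 : 0 < (2 * r) ^+ n by rewrite exprn_gt0// mulr_gt0.
  rewrite opprB addrC subrK ger0_norm; last by rewrite divr_ge0// ltW.
  by rewrite ler_pdivrMr// -lee_fin -hu; near: r.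
Unshelve. all: by end_near. Qed.

(** The density theorem for the thresholds 1 / (k + 1). *)
Lemma density_one_ae (F : set (borel V)) : measurable F ->
  lam [set a | F a /\ ~ density_one F a] = 0%E.
Proof.
move=> mF.
pose Z k := [set x | F x /\ forall d : R, 0 < d -> exists r : R, 0 < r < d /\
    (lam (F `&` ball x r) <= ((1 - k.+1%:R^-1) * (2 * r) ^+ n)%:E)%E].
apply: (@lebesgue_null_sub _ _ _ (\bigcup_k Z k)); last first.
  by apply: lebesgue_null_bigcup => k; apply: lebesgue_rV_density; rewrite invr_gt0.
move=> a [Fa nd]; apply: contrapT => nZ; apply: nd; apply/density_oneP.
exists F; split => // e e0; have [k ke] := exists_invS_lt e0.
have : ~ Z k a by move=> Zk; apply: nZ; exists k.
move=> /not_andP[//|/existsNP[d /not_implyP[d0 /forallNP dr]]].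
near=> r; have r0 : 0 < r by near: r; exact: nbhs_right_gt.
have rd : r < d by near: r; exact: nbhs_right_lt.
have := dr r; rewrite r0 rd => /not_andP[//|/negP]; rewrite -ltNge.
have := lebesgueID (ball a r) (borel_caratheodory mF).
have Dfin := ball_lebesgue_fin r0 (@subDsetl _ (ball a r) F).
have Ifin := ball_lebesgue_fin r0 (@subIsetl _ (ball a r) F).
rewrite [F `&` _]setIC lebesgue_ball// -(fineK Dfin) -(fineK Ifin) -EFinD.
rewrite lte_fin lee_fin; move: (k.+1%:R^-1) ke => q qe [h1] h2.
have : q * (2 * r) ^+ n <= e * (2 * r) ^+ n.
  by rewrite ler_wpM2r ?exprn_ge0 ?mulr_ge0// ltW.
by lra.
Unshelve. all: by end_near. Qed.

Lemma density_one_sub E E' a : E `<=` E' -> density_one E a -> density_one E' a.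
Proof. by move=> EE' [F [mF FE H]]; exists F; split => //; exact: subset_trans EE'. Qed.

Lemma density_oneI E E' a : density_one E a -> density_one E' a ->
  density_one (E `&` E') a.
Proof.
move=> /density_oneP[F [mF FE HF]] /density_oneP[F' [mF' FE' HF']].
apply/density_oneP; exists (F `&` F'); split; first exact: measurableI.
  exact: setISS.
move=> e e0; have e20 : 0 < e / 2 by rewrite divr_gt0.
have := HF _ e20; have := HF' _ e20; apply: filterS2 => r h' h.
rewrite setDIr; apply: le_trans (lebesgueU2 _ _) _.
by rewrite [e in leRHS]splitr mulrDl EFinD leeD.
Qed.

(** A ball of radius t r that avoids E takes the fraction t^n of the ball of radius r. *)
Lemma density_one_ball E a t : 0 < t -> density_one E a ->
  \forall r \near 0^'+, forall y, ball y (t * r) `<=` ball a r ->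
    E `&` ball y (t * r) !=set0.
Proof.
move=> t0 /density_oneP[F [mF FE HF]].
have tn0 : 0 < t ^+ n by rewrite exprn_gt0.
have e0 : 0 < t ^+ n / 2 by rewrite divr_gt0.
have {HF} HF := HF _ e0.
near=> r => y yr; apply/set0P/eqP => Ey.
have r0 : 0 < r by near: r; exact: nbhs_right_gt.
have : (lam (ball y (t * r)) <= (t ^+ n / 2 * (2 * r) ^+ n)%:E)%E.
  apply: (@le_trans _ _ (lam (ball a r `\` F))); last by near: r.
  apply: le_lebesgue => z yz; split; first exact: yr.
  move=> Fz; move/seteqP : Ey => [/(_ z) + _]; apply; split => //; exact: FE.
rewrite lebesgue_ball ?mulr_gt0// lee_fin mulrCA exprMn ler_pM2r.
  lra.
by rewrite exprn_gt0// mulr_gt0.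
Unshelve. all: by end_near. Qed.

End density_points.

(** * Lipschitz images *)

Section lipschitz_image.
Context {R : realType} {n : nat}.
Local Notation V := 'rV[R]_n.
Local Notation lam := (@lebesgue_rV R n).
Implicit Types (E : set V) (a b x y : V) (phi : V -> V) (L : R).

Lemma lebesgue_bigsetU (I : choiceType) (s : seq I) (F : I -> set V) :
  (lam (\bigcup_(i in [set` s]) F i) <= \sum_(i <- s) lam (F i))%E.
Proof.
rewrite bigcup_seq; elim: s => [|i s IH]; first by rewrite !big_nil lebesgue0.
by rewrite !big_cons (le_trans (lebesgueU2 _ _))// leeD2l.
Qed.

(** The image lies in a cube of side 4 L s. *)
Lemma lipschitz_cell phi L E x0 s : 0 < L -> 0 < s ->
  (forall x y, E x -> E y -> `|phi x - phi y| <= L * `|x - y|) ->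
  E x0 -> (forall x, E x -> `|x - x0| <= s) ->
  (lam (phi @` E) <= ((4 * L * s) ^+ n)%:E)%E.
Proof.
move=> L0 s0 lip Ex0 Es.
have r0 : 0 < 2 * L * s by rewrite !mulr_gt0.
apply: (@le_trans _ _ (lam (ball (phi x0) (2 * L * s)))).
  apply: le_lebesgue => _ [x Ex <-]; rewrite -ball_normE/=.
  rewrite (le_lt_trans (lip _ _ Ex0 Ex))// distrC.
  apply: (@le_lt_trans _ _ (L * s)); first by rewrite ler_pM2l// Es.
  by have := mulr_gt0 L0 s0; lra.
by rewrite lebesgue_ball// lee_fin; have -> : 2 * (2 * L * s) = 4 * L * s by ring.
Qed.

(** The box is cut into almost cubic cells, to which the estimate for cubes applies. The
    number of cells times their volume is at most 2^n times the volume of the box,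
    since a side is rounded up to an integer multiple of the side of the cells. *)
Lemma lipschitz_box phi L E a b : 0 < L ->
  (forall x y, E x -> E y -> `|phi x - phi y| <= L * `|x - y|) ->
  E `<=` box a b ->
  (lam (phi @` E) <= ((8 * L) ^+ n * box_volume a b)%:E)%E.
Proof.
move=> L0 lip Eab.
have [[x0 Ex0]|E0] := pselect (E !=set0); last first.
  rewrite (_ : phi @` E = set0); last first.
    by apply/seteqP; split => // y [x Ex _]; apply: E0; exists x.
  by rewrite lebesgue0 lee_fin mulr_ge0 ?box_volume_ge0// exprn_ge0// mulr_ge0// ltW.
pose l i := b 0 i - a 0 i.
have l0 i : 0 < l i.
  have := Eab _ Ex0 i; rewrite in_itv/= subr_gt0 => /andP[h1 h2].
  exact: lt_le_trans h2.
(* the side of the cells is at most every side of the box *)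
pose s := \big[Num.min/1]_i l i.
have s0 : 0 < s by apply/bigmin_gtP; split => // i _; exact: l0.
have sl i : s <= l i by exact: bigmin_le.
pose K i := (Num.truncn (l i / s)).+1.
pose M := \max_i K i.
pose fam := family (fun i => [pred j : 'I_M.+1 | (j < K i)%N]).
pose cell (f : {ffun 'I_n -> 'I_M.+1}) := [set x | E x /\
  forall i, (f i)%:R * s <= x 0 i - a 0 i < (f i).+1%:R * s].
have cov : phi @` E `<=` \bigcup_(f in [set` enum fam]) (phi @` cell f).
  move=> _ [x Ex <-].
  have xi i : 0 < x 0 i - a 0 i <= l i.
    have := Eab _ Ex i; rewrite in_itv/= /l subr_gt0 => /andP[-> h].
    by rewrite lerD2r.
  have tK i : (Num.truncn ((x 0 i - a 0 i) / s)%R < K i)%N.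
    rewrite ltnS; apply: Num.Theory.le_truncn.
    by rewrite ler_pM2r ?invr_gt0//; have /andP[] := xi i.
  have tM i : (Num.truncn ((x 0 i - a 0 i) / s)%R < M.+1)%N.
    by rewrite ltnS (leq_trans (ltnW (tK i)))// leq_bigmax.
  exists [ffun i => Ordinal (tM i)].
    by rewrite /= mem_enum; apply/familyP => i; rewrite ffunE inE tK.
  exists x => //; split => // i; rewrite ffunE/=.
  rewrite -ler_pdivlMr// -ltr_pdivrMr//.
  apply: truncn_itv; rewrite divr_ge0// ?ltW//.
  by have /andP[] := xi i.
apply: le_trans (le_lebesgue cov) _; apply: le_trans (lebesgue_bigsetU _ _) _.
apply: (@le_trans _ _ (\sum_(f <- enum fam) ((4 * L * s) ^+ n)%:E)%E).
  apply: lee_sum => f _.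
  have [[y yf]|c0] := pselect (cell f !=set0); last first.
    rewrite (_ : phi @` _ = set0); last first.
      by apply/seteqP; split => // z [x cx _]; apply: c0; exists x.
    by rewrite lebesgue0 lee_fin exprn_ge0// !mulr_ge0// ltW.
  apply: (@lipschitz_cell phi L _ y s) => //.
    by move=> u v [Eu _] [Ev _]; exact: lip.
  move=> x [_ xf]; rewrite -[X in _ <= X]/(s) /Num.Def.normr/= mx_normrE.
  apply: bigmax_le => [|[i j] _]; first exact: ltW.
  rewrite !mxE ord1/=; have := xf j; have [_ /(_ j)] := yf.
  rewrite -!natr1 !mulrDl mul1r => /andP[? ?] /andP[? ?].
  by rewrite ler_distl; apply/andP; split; lra.
rewrite sumEFin lee_fin big_enum /=.
have -> : \sum_(f in fam) (4 * L * s) ^+ n = \prod_(i < n) \sum_(j < M.+1 | (j < K i)%N) (4 * L * s).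
  rewrite (bigA_distr_big_dep (fun i (j : 'I_M.+1) => (j < K i)%N)).
  by apply: eq_bigr => f _; rewrite prodr_const card_ord.
rewrite /box_volume -[n in (8 * L) ^+ n]card_ord -prodr_const -big_split/=.
apply: ler_prod => i _; apply/andP; split.
  by rewrite sumr_ge0// => j _; rewrite !mulr_ge0// ltW.
rewrite -(big_ord_widen_cond _ xpredT (fun=> 4 * L * s)); last first.
  by rewrite ltnW// ltnS leq_bigmax.
rewrite sumr_const card_ord max_r; last exact: ltW (l0 i).
have Ks : (K i)%:R * s <= 2 * l i.
  rewrite /K -natr1 mulrDl mul1r.
  have := truncn_itv (ltW (divr_gt0 (l0 i) s0)); rewrite ler_pdivlMr//.
  by move=> /andP[h _]; have := sl i; lra.
by rewrite -mulr_natl; have := ler_wpM2l (ltW L0) Ks; rewrite -/(l i); lra.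
Qed.

Lemma lipschitz_image phi L E : 0 < L -> (lam E < +oo)%E ->
  (forall x y, E x -> E y -> `|phi x - phi y| <= L * `|x - y|) ->
  (lam (phi @` E) <= ((8 * L) ^+ n)%:E * lam E)%E.
Proof.
move=> L0 Efin lip.
have c0 : 0 < (8 * L) ^+ n by rewrite exprn_gt0// mulr_gt0.
apply/lee_addgt0Pr => e e0.
have [|D [a [b [Eab hab]]]] := @lebesgue_adherent _ _ E (e / (8 * L) ^+ n) Efin.
  by rewrite divr_gt0.
apply: (@le_trans _ _ (\sum_(0 <= k <oo | D k)
    ((8 * L) ^+ n)%:E * (box_volume (a k) (b k))%:E)%E); last first.
  rewrite nneseriesZl; last by move=> k _; rewrite lee_fin box_volume_ge0.
  have -> : e%:E = (((8 * L) ^+ n)%:E * (e / (8 * L) ^+ n)%:E)%E.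
    by rewrite -EFinM mulrC divfK// gt_eqF.
  have ec0 : 0 <= e / (8 * L) ^+ n by rewrite divr_ge0// ltW.
  rewrite -ge0_muleDr ?lebesgue_ge0 ?lee_fin//.
  by apply: lee_wpmul2l => //; rewrite lee_fin ltW.
pose G k := if D k then phi @` (E `&` box (a k) (b k)) else set0.
apply: (@le_trans _ _ (lam (\bigcup_k G k))).
  apply: le_lebesgue => _ [x /[dup] Ex /Eab[k Dk xk] <-].
  by exists k => //; rewrite /G (Dk : D k); exists x.
apply: le_trans (lebesgue_sigma_subadditive _) _.
rewrite [leRHS]eseries_mkcond; apply: lee_nneseries => k _.
  by move=> _; exact: lebesgue_ge0.
rewrite /G; case: ifP => _; last by rewrite lebesgue0.
rewrite -EFinM; apply: lipschitz_box => //.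
by move=> x y [Ex _] [Ey _]; exact: lip.
Qed.

End lipschitz_image.

(** * Differentiability of semi-convex functions *)

Section semiconvex.
Context {R : realType} {n : nat}.
Local Notation V := 'rV[R]_n.
Local Notation lam := (@lebesgue_rV R n).
Implicit Types (U E : set V) (f : V -> R) (x y z v : V) (u : 'cV[R]_n) (w : R -> R).

Definition linform u v : R := (v *m u) 0 0.

Definition has_gradient f x u := forall e : R, 0 < e -> exists2 d : R, 0 < d &
  forall v, `|v| < d -> `|f (x + v) - f x - linform u v| <= e * `|v|.

(** The inequality of semi-concavity at x, for - f and the modulus w. *)
Definition subgradient w U f x u := forall z, U z ->
  f x + linform u (z - x) - `|z - x| * w `|z - x| <= f z.

(** Jensen's inequality with an error governed by the modulus w. A function that has
    subgradients everywhere satisfies it. Unlike the existence of subgradients, it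
    passes to suprema that are not attained. *)
Definition jensen w U f := forall (k : nat) (c : 'I_k -> R) (z : 'I_k -> V) x,
  U x -> (forall i, U (z i)) -> (forall i, 0 <= c i) -> \sum_i c i = 1 ->
  \sum_i c i *: z i = x ->
  f x <= \sum_i c i * f (z i) + \sum_i c i * (`|z i - x| * w `|z i - x|).

Lemma linformE u v : linform u v = \sum_i v 0 i * u i 0.
Proof. by rewrite /linform mxE. Qed.

Lemma linformD u v v' : linform u (v + v') = linform u v + linform u v'.
Proof. by rewrite /linform mulmxDl mxE. Qed.

Lemma linformZ u t v : linform u (t *: v) = t * linform u v.
Proof. by rewrite /linform -scalemxAl mxE. Qed.

Lemma linformN u v : linform u (- v) = - linform u v.
Proof. by rewrite /linform mulNmx mxE. Qed.

Lemma linform_delta u i : linform u (delta_mx 0 i) = u i 0.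
Proof. by rewrite /linform -rowE mxE. Qed.

Lemma coord_le_norm v i : `|v 0 i| <= `|v|.
Proof.
rewrite [leRHS]/Num.Def.normr/= mx_normrE.
exact: (le_bigmax _ (fun ij : 'I_1 * 'I_n => `|v ij.1 ij.2|) (0, i)).
Qed.

Lemma norm_le_coord v (r : R) : 0 <= r -> (forall i, `|v 0 i| <= r) -> `|v| <= r.
Proof.
move=> r0 vr; rewrite [leLHS]/Num.Def.normr/= mx_normrE.
by apply: bigmax_le => // -[i j] _; rewrite ord1; exact: vr.
Qed.

Lemma norm_delta i : `|delta_mx 0 i : V| <= 1.
Proof.
apply: norm_le_coord => // j; rewrite mxE eqxx/=.
by case: (j == i); rewrite ?normr1 ?normr0.
Qed.

Lemma linform_le u v : `|linform u v| <= (\sum_i `|u i 0|) * `|v|.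
Proof.
rewrite linformE (le_trans (ler_norm_sum _ _ _))// mulr_suml.
apply: ler_sum => i _; rewrite normrM mulrC ler_wpM2l//; exact: coord_le_norm.
Qed.

Lemma modulus_small w (e : R) : modulus w -> 0 < e ->
  exists2 d : R, 0 < d & forall t : R, 0 <= t < d -> w t <= e.
Proof.
move=> [cw mw w0 w00] e0.
have /continuous_within_itvcyP[_] := cw.
rewrite w00 => /cvgrPdist_le/(_ e e0)[d /= d0 dw]; exists d => // t /andP[t0 td].
move: t0; rewrite le_eqVlt => /orP[/eqP <-|t0]; first by rewrite w00 ltW.
have := dw t; rewrite /= sub0r normrN gtr0_norm// => /(_ td t0).
by rewrite sub0r normrN ger0_norm ?w0// ltW.
Qed.

Lemma modulus_le w s t : modulus w -> 0 <= s -> s <= t -> w s <= w t.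
Proof.
move=> [_ mw _ _] s0 st; apply: mw => //; rewrite in_itv/= ?s0// andbT.
exact: le_trans st.
Qed.

(** Jensen's inequality for two points. *)
Lemma jensen2 w U f x y (c h : R) : modulus w -> jensen w U f ->
  U x -> U y -> U (x + c *: (y - x)) -> 0 <= c <= 1 -> w `|y - x| <= h ->
  f (x + c *: (y - x)) <= (1 - c) * f x + c * f y + 2 * c * `|y - x| * h.
Proof.
move=> mw J Ux Uy Uz /andP[c0 c1] wh.
have [_ _ w0 _] := mw.
have := J 2 (fun i => if i == 0 then 1 - c else c)
  (fun i => if i == 0 then x else y) (x + c *: (y - x)) Uz.
rewrite !big_ord_recl !big_ord0/= !addr0.
have -> : x - (x + c *: (y - x)) = - c *: (y - x).
  by rewrite opprD addrA subrr add0r scaleNr.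
have -> : y - (x + c *: (y - x)) = (1 - c) *: (y - x).
  by rewrite opprD addrA scalerBl scale1r.
rewrite !normrZ normrN (ger0_norm c0) ger0_norm ?subr_ge0// => H.
apply: le_trans (H _ _ _ _) _ => //.
- by move=> i; case: ifP.
- by move=> i; case: ifP; rewrite ?subr_ge0.
- by rewrite subrK.
- by apply/rowP => j; rewrite !mxE; ring.
set N := `|y - x|.
have N0 : 0 <= N by exact: normr_ge0.
have h0 : 0 <= h by apply: le_trans wh; exact: w0.
have h1 : w (c * N) <= h.
  by apply: le_trans wh; apply: modulus_le; rewrite ?mulr_ge0// ler_piMl.
have h2 : w ((1 - c) * N) <= h.
  apply: le_trans wh; apply: modulus_le => //; rewrite ?mulr_ge0 ?subr_ge0//.
  by rewrite ler_piMl// gerBl.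
rewrite lerD2l.
have cN0 : 0 <= c * N by rewrite mulr_ge0.
have kk (A : R) : 0 <= A -> A <= h -> (1 - c) * A <= h.
  by move=> A0 Ah; have := mulr_ge0 c0 A0; lra.
have k1 := ler_wpM2l cN0 (kk _ (w0 _ cN0) h1).
have c1N0 : 0 <= (1 - c) * N by rewrite mulr_ge0// subr_ge0.
have k2 := ler_wpM2l cN0 (kk _ (w0 _ c1N0) h2).
by lra.
Qed.

Lemma open_ballP U x : open U -> U x ->
  exists2 d : R, 0 < d & forall v, `|v| < d -> U (x + v).
Proof.
move=> oU Ux; have /nbhs_ballP[d /= d0 xd] := open_nbhs_nbhs (conj oU Ux).
exists d => // v vd; apply: xd; rewrite -ball_normE/= opprD addrA subrr sub0r.
by rewrite normrN.
Qed.

(** Along the half-line from x in the direction s * e_i, the function grows faster, by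
    the margin e, than the linear function of slope p in the direction e_i would.
    A semi-convex function with a subgradient fails to be differentiable only so. *)
Definition steep f x (s : R) (i : 'I_n) (p e : R) := forall t : R, 0 < t < e ->
  f x + t * (s * p + e) <= f (x + (t * s) *: delta_mx 0 i).

Lemma norm_scale_delta (t s : R) i : 0 <= t -> `|s| = 1 ->
  `|(t * s) *: delta_mx 0 i : V| <= t.
Proof.
by move=> t0 s1; rewrite normrZ normrM s1 mulr1 ger0_norm// ler_piMr// norm_delta.
Qed.

(** By [jensen2] a small difference quotient at one time T bounds the difference
    quotients at all earlier times, up to a small error. *)
Lemma not_steep w U f x (s : R) i (p e : R) : modulus w -> open U ->
  jensen w U f -> U x -> `|s| = 1 ->
  (forall m, ~ steep f x s i p m.+1%:R^-1) -> 0 < e ->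
  exists2 d : R, 0 < d & forall t : R, 0 <= t < d ->
    f (x + (t * s) *: delta_mx 0 i) <= f x + t * (s * p + e).
Proof.
move=> mw oU J Ux s1 ns e0.
have [d1 d10 xU] := open_ballP oU Ux.
have e40 : 0 < e / 4 by rewrite divr_gt0.
have [d2 d20 wd2] := modulus_small mw e40.
pose d := Num.min (e / 2) (Num.min d1 d2).
have d0 : 0 < d by rewrite !lt_min d10 d20 divr_gt0.
have [m md] := exists_invS_lt d0.
have /existsNP[T /not_implyP[/andP[T0 Tm] /negP]] := ns m.
rewrite -ltNge => fT.
have : T < d by exact: lt_trans md.
rewrite !lt_min => /and3P[Te Td1 Td2].
exists T => // t /andP[t0 tT].
have tsU (r : R) : 0 <= r <= T -> U (x + (r * s) *: delta_mx 0 i).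
  move=> /andP[r0 rT]; apply: xU; apply: le_lt_trans (norm_scale_delta _ r0 s1) _.
  exact: le_lt_trans Td1.
have eqz : x + (t * s) *: delta_mx 0 i =
    x + (t / T) *: (x + (T * s) *: delta_mx 0 i - x).
  rewrite addrAC subrr add0r scalerA; congr (_ + _ *: _).
  by rewrite mulrA divfK// gt_eqF.
have nT : `|x + (T * s) *: delta_mx 0 i - x| <= T.
  by rewrite addrAC subrr add0r; apply: norm_scale_delta => //; exact: ltW.
have := @jensen2 w U f x (x + (T * s) *: delta_mx 0 i) (t / T) (e / 4) mw J Ux.
rewrite -eqz => /(_ _ _ _ _)/le_trans; apply.
- by apply: tsU; rewrite lexx ltW.
- by apply: tsU; rewrite t0 ltW.
- by rewrite divr_ge0 ?(ltW T0)// ler_pdivrMr// mul1r ltW.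
- by apply: wd2; rewrite normr_ge0 (le_lt_trans nT).
have c0 : 0 <= t / T by rewrite divr_ge0 ?(ltW T0).
have k1 := ler_wpM2l c0 (ltW fT).
have k2 : t / T * `|x + (T * s) *: delta_mx 0 i - x| <= t.
  by apply: le_trans (ler_wpM2l c0 nT) _; rewrite divfK// gt_eqF.
have k3 : (t / T) * (T * (s * p + m.+1%:R^-1)) = t * (s * p + m.+1%:R^-1).
  by rewrite mulrA divfK// gt_eqF.
have k4 : t * m.+1%:R^-1 <= t * (e / 2).
  rewrite ler_wpM2l// ltW// (lt_le_trans md)//.
  by rewrite /d ge_min lexx.
rewrite mulrDr k3 in k1.
have k5 := ler_wpM2r (ltW e40) k2.
move: k1 k4 k5; move: (m.+1%:R^-1) (t / T) (f _) (`|_|) => q c F N k1 k4 k5.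
lra.
Qed.

(** The subgradient is the lower bound. For the upper bound, x + v is the mean of the n
    points x + n v_i e_i, which lie on the half-lines where f is not steep, and
    Jensen's inequality applies. *)
Lemma gradient_of_not_steep w U f x u : modulus w -> open U ->
  jensen w U f -> U x -> subgradient w U f x u ->
  (forall i (b : bool) m, ~ steep f x ((-1) ^+ b) i (u i 0) m.+1%:R^-1) ->
  has_gradient f x u.
Proof.
move=> mw oU J Ux sub ns e e0.
have [n0|npos] := posnP n.
  exists 1 => // v _.
  have -> : v = 0 by apply/rowP => i; exfalso; case: i => i; rewrite n0.
  by rewrite addr0 subrr linformE big1 ?subrr ?normr0 ?mulr0// => i _; rewrite mxE mul0r.
have n_gt0 : 0 < n%:R :> R by rewrite ltr0n.
pose h : R := e / (2 * n%:R + 1).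
have c0 : 0 < 2 * n%:R + 1 :> R by rewrite ltr_wpDl// mulr_ge0.
have h0 : 0 < h by rewrite divr_gt0.
have [d1 d10 xU] := open_ballP oU Ux.
have [d2 d20 wd2] := modulus_small mw h0.
have [D DP] : {D : 'I_n * bool -> R & forall ib, 0 < D ib /\ forall t : R, 0 <= t < D ib ->
    f (x + (t * (-1) ^+ ib.2) *: delta_mx 0 ib.1) <=
    f x + t * ((-1) ^+ ib.2 * u ib.1 0 + h)}.
  apply: (@choice _ _ (fun (ib : 'I_n * bool) (d : R) => 0 < d /\ forall t : R, 0 <= t < d ->
    f (x + (t * (-1) ^+ ib.2) *: delta_mx 0 ib.1) <=
    f x + t * ((-1) ^+ ib.2 * u ib.1 0 + h))) => -[i b].
  have [|d d0 dP] := not_steep mw oU J Ux _ (ns i b) h0; last by exists d.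
  by rewrite normrX normrN1 expr1n.
pose d := Num.min (Num.min d1 d2) (\big[Num.min/1]_ib D ib).
have d0 : 0 < d.
  rewrite !lt_min d10 d20/=; apply/bigmin_gtP; split => // ib _; exact: (DP ib).1.
exists (d / (n%:R + 1)); first by rewrite divr_gt0// ltr_wpDl.
move=> v; rewrite ltr_pdivlMr ?ltr_wpDl// => vd.
have vd' : `|v| * n%:R + `|v| < d by rewrite -[X in _ + X]mulr1 -mulrDr.
have N0 := normr_ge0 v.
have Nn0 : 0 <= `|v| * n%:R by rewrite mulr_ge0.
have vlt : `|v| < d by lra.
have nvlt : `|v| * n%:R < d by lra.
move: (vlt) (nvlt) (vd'); rewrite !lt_min.
move=> /andP[/andP[v1 v2] _] /andP[/andP[nv1 nv2] nvD] /andP[/andP[dv1 dv2] _].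
have lower : f x + linform u v - `|v| * w `|v| <= f (x + v).
  by have := sub (x + v) (xU _ v1); rewrite [x + v - x]addrAC subrr add0r.
have wv : `|v| * w `|v| <= `|v| * h by rewrite ler_wpM2l// wd2// N0.
pose z i : V := x + (n%:R * v 0 i) *: delta_mx 0 i.
have znorm i : `|n%:R * v 0 i| <= `|v| * n%:R.
  by rewrite normrM normr_nat mulrC ler_wpM2r ?ler0n// coord_le_norm.
have zle i : f (z i) <= f x + n%:R * v 0 i * u i 0 + `|v| * n%:R * h.
  pose b := (v 0 i < 0).
  have abs : n%:R * v 0 i = `|n%:R * v 0 i| * (-1) ^+ b.
    by rewrite normrM normr_nat -mulrA [`|_| * _]mulrC -numEsign.
  have := (DP (i, b)).2 `|n%:R * v 0 i|; rewrite -abs => /(_ _)/le_trans; apply.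
    rewrite normr_ge0 (le_lt_trans (znorm i))// (lt_le_trans nvD)//.
    exact: bigmin_le.
  rewrite /= mulrDr mulrA -abs addrA lerD2l.
  by rewrite ler_wpM2r// ?znorm// ltW.
have sumz : \sum_(i < n) n%:R^-1 *: z i = x + v.
  have zi i : n%:R^-1 *: z i = n%:R^-1 *: x + v 0 i *: delta_mx 0 i.
    by rewrite scalerDr scalerA mulrA mulVf ?gt_eqF// mul1r.
  under eq_bigr do rewrite zi.
  rewrite big_split/= sumr_const card_ord -scaler_nat scalerA divff ?gt_eqF// scale1r.
  by rewrite -row_sum_delta.
have zx i : `|z i - (x + v)| <= `|v| * n%:R + `|v|.
  rewrite /z opprD addrACA subrr add0r (le_trans (ler_normB _ _))//.
  by rewrite lerD2r normrZ (le_trans _ (znorm i))// ler_piMr// norm_delta.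
have sum1 : \sum_(i < n) n%:R^-1 = 1 :> R.
  by rewrite sumr_const card_ord -[LHS]mulr_natr mulVf// gt_eqF.
have H : f (x + v) <= \sum_(i < n) n%:R^-1 * f (z i) +
    \sum_(i < n) n%:R^-1 * (`|z i - (x + v)| * w `|z i - (x + v)|).
  apply: (J n (fun=> n%:R^-1) z (x + v) (xU _ v1)) => // j.
  apply: xU; rewrite normrZ (le_lt_trans _ nv1)// (le_trans _ (znorm j))//.
  by rewrite ler_piMr// norm_delta.
have [_ _ w0 _] := mw.
have s1 : \sum_(i < n) n%:R^-1 * f (z i) <= f x + linform u v + `|v| * n%:R * h.
  apply: (@le_trans _ _ (\sum_(i < n) (n%:R^-1 * (f x + `|v| * n%:R * h) +
     v 0 i * u i 0))).
    apply: ler_sum => i _.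
    have ni0 : 0 <= n%:R^-1 :> R by rewrite invr_ge0.
    apply: le_trans (ler_wpM2l ni0 (zle i)) _.
    rewrite addrAC mulrDr lerD2l mulrA mulrA mulVf ?gt_eqF// mul1r.
    by [].
  by rewrite big_split/= -mulr_suml sum1 mul1r -linformE addrAC.
have s2 : \sum_(i < n) n%:R^-1 * (`|z i - (x + v)| * w `|z i - (x + v)|) <=
    (`|v| * n%:R + `|v|) * h.
  apply: (@le_trans _ _ (\sum_(i < n) n%:R^-1 * ((`|v| * n%:R + `|v|) * h))).
    apply: ler_sum => i _; rewrite ler_wpM2l ?invr_ge0//.
    rewrite ler_pM ?normr_ge0 ?w0//.
    by rewrite wd2// normr_ge0 (le_lt_trans (zx i)).
  by rewrite -mulr_suml sum1 mul1r.
have he : h * (2 * n%:R + 1) = e by rewrite divfK// gt_eqF.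
rewrite ler_norml; apply/andP; split.
  have : `|v| * h <= e * `|v|.
    by rewrite -he; have := mulr_ge0 Nn0 (ltW h0); lra.
  lra.
rewrite -he; lra.
Qed.

End semiconvex.

Section semiconvex_ae.
Context {R : realType} {n : nat}.
Local Notation V := 'rV[R]_n.
Local Notation lam := (@lebesgue_rV R n).
Implicit Types (U E : set V) (f : V -> R) (x y z v : V) (u : 'cV[R]_n) (w : R -> R).

(** The point z lies between x and a point at distance |z - x| + r from x, where f is at
    most K; [jensen2] compares the three values. *)
Lemma upper_lipschitz w U f x z (r K m : R) : modulus w -> jensen w U f ->
  (forall y, U y -> f y <= K) -> 0 < r -> 2 * r <= 1 ->
  (forall v, `|v| < 2 * r -> U (x + v)) -> - m <= f x -> `|z - x| < r ->
  f z <= f x + ((K + m) / r + 2 * w 1) * `|z - x|.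
Proof.
move=> mw J fK r0 r1 xU fx zr.
have [_ _ w0 _] := mw.
have Ux : U x by rewrite -[x]addr0; apply: xU; rewrite normr0 mulr_gt0.
have [zx|] := eqVneq (z - x) 0.
  have -> : z = x by apply/eqP; rewrite -subr_eq0 zx.
  by rewrite subrr normr0 mulr0 addr0.
rewrite -normr_gt0; move: zr; set N := `|z - x| => zr N0.
have Nr0 : 0 < N + r by rewrite addr_gt0.
pose u : V := x + ((N + r) / N) *: (z - x).
have ux : `|u - x| = N + r.
  rewrite /u addrAC subrr add0r normrZ -/N ger0_norm ?divfK ?gt_eqF//.
  by rewrite divr_ge0// ltW.
have eqz : z = x + (N / (N + r)) *: (u - x).
  rewrite /u [x + _ - x]addrAC subrr add0r scalerA.
  rewrite mulrA divfK ?gt_eqF// divff ?gt_eqF// scale1r.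
  by rewrite addrC subrK.
have Uu : U u.
  rewrite /u; apply: xU; rewrite normrZ -/N ger0_norm ?divfK ?gt_eqF//.
    by rewrite mulrDl !mul1r ltrD2r.
  by rewrite divr_ge0// ltW.
have Uz : U z by rewrite -[z](subrK x) addrC; apply: xU; rewrite -/N; lra.
have c0 : 0 <= N / (N + r) by rewrite divr_ge0 ?ltW.
have c1 : N / (N + r) <= 1 by rewrite ler_pdivrMr// mul1r lerDl ltW.
have := @jensen2 _ _ w U f x u (N / (N + r)) (w `|u - x|) mw J Ux Uu.
rewrite -eqz c0 c1 ux => /(_ Uz isT (lexx _))/le_trans; apply.
have fuK := fK u Uu.
have Km : 0 <= K + m by have := fK x Ux; lra.
have k1 : N / (N + r) * (f u - f x) <= N / r * (K + m).
  apply: (@le_trans _ _ (N / (N + r) * (K + m))).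
    by rewrite ler_wpM2l//; lra.
  by rewrite ler_wpM2r// ler_wpM2l ?(ltW N0)// lef_pV2 ?posrE//; lra.
have k2 : 2 * (N / (N + r)) * (N + r) * w (N + r) <= 2 * N * w 1.
  have -> : 2 * (N / (N + r)) * (N + r) = 2 * N by rewrite -mulrA divfK// gt_eqF.
  rewrite ler_wpM2l ?mulr_ge0 ?(ltW N0)//.
  by apply: modulus_le => //; lra.
have k3 : N / r * (K + m) = (K + m) / r * N by ring.
lra.
Qed.

(** Let y = x + (r / 2) s e_i. If E had a point x' very close to y, then f y would be
    at most about f x' ([upper_lipschitz]), and the subgradient at x' would give
    f x' <= f x + (r / 2) s g_i(x') up to small errors; as the slopes g_i at x and x'
    are almost equal, this contradicts the steepness at x. So a small ball around y
    avoids E. The bounds m and the approximate slope q make all constants uniform. *)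
Lemma steep_porous w U f E (g : V -> 'cV[R]_n) (i : 'I_n) (b : bool) (m : nat)
    (q K : R) : modulus w -> jensen w U f -> (forall y, U y -> f y <= K) ->
  (forall x, E x -> [/\ subgradient w U f x (g x),
     steep f x ((-1) ^+ b) i (g x i 0) m.+1%:R^-1,
     - m%:R <= f x & \sum_j `|g x j 0| <= m%:R /\
     (forall v, `|v| < m.+1%:R^-1 -> U (x + v)) /\
     `|g x i 0 - q| <= m.+1%:R^-1 / 8]) ->
  lam E = 0%E.
Proof.
move=> mw J fK EP; set e : R := m.+1%:R^-1 in EP.
have e0 : 0 < e by rewrite invr_gt0.
have e1 : e <= 1 by rewrite invf_le1// ler1n.
have [_ _ w0 _] := mw.
have [[x0 Ex0]|E0] := pselect (E !=set0); last first.
  have -> : E = set0 by apply/eqP/negPn/negP => /set0P.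
  exact: lebesgue0.
have EU x : E x -> U x.
  by move=> /EP[_ _ _ [_ [xU _]]]; rewrite -[x]addr0; apply: xU; rewrite normr0.
have e40 : 0 < e / 4 by rewrite divr_gt0.
pose L := (K + m%:R) / (e / 4) + 2 * w 1.
have L0 : 0 <= L.
  rewrite addr_ge0 ?mulr_ge0 ?w0 ?invr_ge0 ?(ltW e40)//.
  by have [_ _ ? _] := EP x0 Ex0; have := fK x0 (EU _ Ex0); lra.
have Lm0 : 0 < L + m%:R + 1 by rewrite ltr_pwDr// addr_ge0.
(* the errors caused by the distance t * r between y and x' stay below r * e / 8 *)
pose t := Num.min (1 / 2) (e / 8 / (L + m%:R + 1)).
have t0 : 0 < t by rewrite lt_min !divr_gt0.
have t2 : t <= 1 / 2 by rewrite ge_min lexx.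
have tL : (L + m%:R) * t <= e / 8.
  have : t <= e / 8 / (L + m%:R + 1) by rewrite ge_min lexx orbT.
  by rewrite ler_pdivlMr// => h; lra.
have e80 : 0 < e / 8 by rewrite divr_gt0.
have [d2 d20 wd2] := modulus_small mw e80.
apply: (@lebesgue_porous _ _ E t t0) => x Ex.
exists (Num.min (e / 4) d2); first by rewrite lt_min d20 divr_gt0.
move=> r /andP[r0]; rewrite lt_min => /andP[re rd2].
pose s : R := (-1) ^+ b.
have s1 : `|s| = 1 by rewrite normrX normrN1 expr1n.
pose y : V := x + (r / 2 * s) *: delta_mx 0 i.
have yx : `|y - x| <= r / 2.
  by rewrite /y addrAC subrr add0r; apply: norm_scale_delta => //; rewrite divr_ge0// ltW.
have tr2 : t * r <= r / 2 by have := ler_wpM2r (ltW r0) t2; lra.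
exists y; split.
  move=> z; rewrite -!ball_normE/= => yz.
  have -> : x - z = (y - z) - (y - x) by rewrite opprB [RHS]addrC addrA subrK.
  by have := ler_normB (y - z) (y - x); lra.
apply/seteqP; split => // x' [Ex']; rewrite -ball_normE/= => yx'.
have [sub st _ [_ [_ gq]]] := EP x Ex.
have [sub' _ fx' [g'm [xU' gq']]] := EP x' Ex'.
have H1 : f x + r / 2 * (s * g x i 0 + e) <= f y.
  by apply: st; apply/andP; split; lra.
have H2 := sub' x (EU x Ex).
have H3 : f y <= f x' + L * `|y - x'|.
  apply: (@upper_lipschitz w U f x' y (e / 4) K m%:R) => //; last by lra.
  - by lra.
  - by move=> v vd; apply: xU'; lra.
have dx : x - x' = - ((r / 2 * s) *: delta_mx 0 i) + (y - x').
  by rewrite addrA [- _ + y]addrC /y addrK.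
have lf : linform (g x') (x - x') = - (r / 2 * s * g x' i 0) + linform (g x') (y - x').
  by rewrite dx (linformD _ (- _)) (linformN _ (_ *: _)) linformZ linform_delta.
have lb : - (m%:R * (t * r)) <= linform (g x') (y - x').
  have := linform_le (g x') (y - x'); rewrite ler_norml => /andP[h _].
  apply: le_trans h; rewrite lerN2 ler_pM ?sumr_ge0 ?normr_ge0//.
  exact: ltW.
have Ly : L * `|y - x'| <= L * (t * r) by rewrite ler_wpM2l// ltW.
have xx' : `|x - x'| <= r.
  have -> : x - x' = (y - x') - (y - x) by rewrite opprB [RHS]addrC addrA subrK.
  by have := ler_normB (y - x') (y - x); lra.
have wx : `|x - x'| * w `|x - x'| <= r * (e / 8).
  rewrite ler_pM ?normr_ge0 ?w0// wd2// normr_ge0/=.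
  exact: le_lt_trans rd2.
have sg : r / 2 * (- (e / 4)) <= r / 2 * (s * (g x i 0 - g x' i 0)).
  rewrite ler_wpM2l ?divr_ge0 ?(ltW r0)//.
  have : `|s * (g x i 0 - g x' i 0)| <= e / 4.
    rewrite normrM s1 mul1r.
    have -> : g x i 0 - g x' i 0 = (g x i 0 - q) - (g x' i 0 - q) by ring.
    by have := ler_normB (g x i 0 - q) (g x' i 0 - q); lra.
  by rewrite ler_norml => /andP[].
have tLr := ler_wpM2r (ltW r0) tL.
have re0 := mulr_gt0 r0 e0.
rewrite lf in H2; lra.
Qed.

(** A point of E where f is not differentiable is steep in some coordinate direction.
    The direction, the sign, an integer m for all the bounds and a rational
    approximation of the slope sort these points into countably many porous sets. *)
Theorem semiconvex_gradient_ae w U f E (K : R) : modulus w -> open U ->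
  jensen w U f -> (forall y, U y -> f y <= K) -> E `<=` U ->
  (forall x, E x -> exists u, subgradient w U f x u) ->
  lam [set x | E x /\ ~ exists u, has_gradient f x u] = 0%E.
Proof.
move=> mw oU J fK EU sub.
have [g gP] : {g : V -> 'cV[R]_n & forall x, E x -> subgradient w U f x (g x)}.
  apply: (@choice _ _ (fun x u => E x -> subgradient w U f x u)) => x.
  by have [/sub[u]|] := pselect (E x); [exists u|exists 0].
pose Z (p : 'I_n * bool * nat * rat) := [set x | E x /\
  [/\ subgradient w U f x (g x),
     steep f x ((-1) ^+ p.1.1.2) p.1.1.1 (g x p.1.1.1 0) p.1.2.+1%:R^-1,
     - p.1.2%:R <= f x & \sum_j `|g x j 0| <= p.1.2%:R /\
     (forall v, `|v| < p.1.2.+1%:R^-1 -> U (x + v)) /\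
     `|g x p.1.1.1 0 - ratr p.2| <= p.1.2.+1%:R^-1 / 8]].
apply: (@lebesgue_null_sub _ _ _ (\bigcup_p Z p)); last first.
  apply: lebesgue_null_bigcup => -[[[i b] m] q].
  by apply: (@steep_porous w U f _ g i b m (ratr q) K) => // x [].
move=> x [Ex ng]; have Ux := EU x Ex.
have : ~ forall i (b : bool) m, ~ steep f x ((-1) ^+ b) i (g x i 0) m.+1%:R^-1.
  move=> ns; apply: ng; exists (g x).
  exact: gradient_of_not_steep (gP x Ex) ns.
move=> /existsNP[i /existsNP[b /existsNP[m0 /contrapT st]]].
have [d d0 xU] := open_ballP oU Ux.
have [m1 m1d] := exists_invS_lt d0.
pose S := \sum_j `|g x j 0|.
pose m := (m0 + m1 + (Num.truncn `|f x|).+1 + (Num.truncn S).+1)%N.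
have inv_le k : (k <= m)%N -> m.+1%:R^-1 <= k.+1%:R^-1 :> R.
  by move=> km; rewrite lef_pV2 ?posrE// ler_nat.
have [|q qP] := @rat_in_itvoo R (g x i 0 - m.+1%:R^-1 / 8) (g x i 0 + m.+1%:R^-1 / 8).
  by rewrite ltrD2l gt0_cp// divr_gt0.
exists (i, b, m, q) => //; split => //; split => /=; first exact: gP.
- move=> t /andP[t0 tm].
  have mm0 : m.+1%:R^-1 <= m0.+1%:R^-1 :> R by apply: inv_le; rewrite /m -!addnA leq_addr.
  have := st t; rewrite t0 (lt_le_trans tm mm0) => /(_ isT); apply: le_trans.
  by rewrite lerD2l ler_wpM2l ?(ltW t0)// lerD2l.
- have : `|f x| <= m%:R.
    apply: (le_trans (ltW (truncnS_gt _))); rewrite ler_nat /m.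
    by rewrite -addnA addnCA leq_addr.
  by rewrite ler_norml => /andP[].
split; last split.
- apply: (le_trans (ltW (truncnS_gt _))); rewrite ler_nat /m.
  by rewrite leq_addl.
- move=> v vm; apply: xU; apply: lt_trans vm _; apply: le_lt_trans m1d.
  by apply: inv_le; rewrite /m addnAC -!addnA addnCA leq_addr.
- move: qP; rewrite in_itv/=; move: (_ / 8) (ratr q) => A B /andP[? ?].
  by rewrite ler_distl; apply/andP; split; lra.
Qed.

End semiconvex_ae.

(** * Functions that touch, and suprema *)

Section supremum.
Context {R : realType} {n : nat}.
Local Notation V := 'rV[R]_n.
Implicit Types (U E : set V) (f h : V -> R) (x y z v : V) (u : 'cV[R]_n) (w : R -> R).

Lemma linformBl u u' v : linform (u - u') v = linform u v - linform u' v.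
Proof. by rewrite /linform mulmxBr mxE [X in _ + X]mxE. Qed.

Lemma has_gradientN f x u : has_gradient f x u ->
  has_gradient (fun z => - f z) x (- u).
Proof.
move=> fu e /(fu e)[d d0 dP]; exists d => // v /dP.
have -> : - f (x + v) - - f x - linform (- u) v =
    - (f (x + v) - f x - linform u v) by rewrite /linform mulmxN [X in _ - X = _]mxE; ring.
by rewrite normrN.
Qed.

Lemma linform_small u :
  (forall e : R, 0 < e -> exists2 d : R, 0 < d &
    forall v, `|v| < d -> linform u v <= e * `|v|) -> u = 0.
Proof.
move=> H; apply/colP => i; rewrite mxE.
have key (s : R) : `|s| = 1 -> s * u i 0 <= 0.
  move=> s1; apply/ler_addgt0Pr => e e0; rewrite add0r.
  have [r r0 rP] := H e e0.
  have r20 : 0 < r / 2 by rewrite divr_gt0.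
  have nr : `|(r / 2 * s) *: delta_mx 0 i : V| <= r / 2.
    by apply: norm_scale_delta => //; exact: ltW.
  have := rP ((r / 2 * s) *: delta_mx 0 i) _.
  rewrite (le_lt_trans nr) => [/(_ isT)|]; last by lra.
  rewrite linformZ linform_delta => h1.
  have h2 := ler_wpM2l (ltW e0) nr.
  have : r / 2 * (s * u i 0) <= r / 2 * e by lra.
  by rewrite ler_pM2l.
have k1 := key 1 (normr1 _); have k2 := key (-1) (normrN1 _).
by apply/eqP; rewrite eq_le; apply/andP; split; lra.
Qed.

(** Near x, h lies between its affine minorant of slope u' and f, whose slope is u. The
    values agree at x, so u' = u. *)
Lemma has_gradient_touch w U f h x u u' : modulus w -> open U -> U x ->
  has_gradient f x u -> subgradient w U h x u' ->
  (forall z, U z -> h z <= f z) -> h x = f x -> has_gradient h x u.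
Proof.
move=> mw oU Ux fu hu' hf hx.
have [d1 d10 xU] := open_ballP oU Ux.
have low (e : R) : 0 < e -> exists2 d : R, 0 < d & forall v, `|v| < d ->
    [/\ U (x + v), linform u' v - e * `|v| <= h (x + v) - h x &
      h (x + v) - h x <= linform u v + e * `|v|].
  move=> e0; have [d2 d20 wd2] := modulus_small mw e0.
  have [d3 d30 fd3] := fu e e0.
  exists (Num.min d1 (Num.min d2 d3)); first by rewrite !lt_min d10 d20.
  move=> v; rewrite !lt_min => /and3P[v1 v2 v3]; split; first exact: xU.
    have := hu' (x + v) (xU v v1); rewrite [x + v - x]addrAC subrr add0r.
    have : `|v| * w `|v| <= `|v| * e by rewrite ler_wpM2l// wd2// normr_ge0.
    by lra.
  have := fd3 v v3; rewrite ler_norml => /andP[_].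
  have := hf (x + v) (xU v v1); lra.
have uu' : u' - u = 0.
  apply: linform_small => e e0.
  have e20 : 0 < e / 2 by rewrite divr_gt0.
  have [d d0 dP] := low _ e20; exists d => // v /dP[_ h1 h2].
  by rewrite linformBl; lra.
have {uu'} uu' : u' = u by apply/eqP; rewrite -subr_eq0 uu'.
move=> e e0; have [d d0 dP] := low _ e0; exists d => // v /dP[_].
by rewrite uu' => h1 h2; rewrite ler_norml; apply/andP; split; lra.
Qed.

Context {I : Type}.
Implicit Types (D : set I) (H : I -> V -> R).

Definition sup_fun D H x : R := sup [set H i x | i in D].

Section sup_fun.
Variables (w : R -> R) (U : set V) (D : set I) (H : I -> V -> R) (K : R).
Hypothesis mw : modulus w.
Hypothesis oU : open U.
Hypothesis D0 : D !=set0.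
Hypothesis HK : forall i x, D i -> H i x <= K.
Hypothesis Hsub : forall i x, D i -> U x -> exists u, subgradient w U (H i) x u.

Let f := sup_fun D H.

Lemma sup_fun_ub i x : D i -> H i x <= f x.
Proof.
move=> Di; apply: sup_upper_bound; last by exists i.
split; first by exists (H i x), i.
by exists K => _ [j Dj <-]; exact: HK.
Qed.

Lemma sup_fun_le x (M : R) : (forall i, D i -> H i x <= M) -> f x <= M.
Proof.
move=> HM; apply: ge_sup; last by move=> _ [i Di <-]; exact: HM.
by have [i Di] := D0; exists (H i x), i.
Qed.

(** At the point x each H i is above an affine function up to the modulus, and affine
    functions satisfy Jensen's equality; the supremum over i is taken last. *)
Lemma sup_fun_jensen : jensen w U f.
Proof.
move=> k c z x Ux Uz c0 c1 cz; apply: sup_fun_le => i Di.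
have [u hu] := Hsub Di Ux.
have : \sum_j c j * (H i x + linform u (z j - x) - `|z j - x| * w `|z j - x|) <=
       \sum_j c j * f (z j).
  apply: ler_sum => j _; apply: ler_wpM2l => //.
  by apply: le_trans (hu _ (Uz j)) _; exact: sup_fun_ub.
under eq_bigr do rewrite mulrBr mulrDr.
rewrite big_split/= big_split/= -mulr_suml c1 mul1r sumrN.
have -> : \sum_j c j * linform u (z j - x) = 0.
  under eq_bigr do rewrite -linformZ scalerBr.
  transitivity (linform u (\sum_j (c j *: z j - c j *: x))).
    elim/big_ind2 : _ => [|? ? ? ? -> ->|//]; last by rewrite linformD.
    by rewrite linformE big1// => j _; rewrite mxE mul0r.
  rewrite sumrB cz -scaler_suml c1 scale1r subrr linformE big1// => j _.
  by rewrite mxE mul0r.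
by lra.
Qed.

Lemma sup_fun_subgradient i x u : D i -> H i x = f x ->
  subgradient w U (H i) x u -> subgradient w U f x u.
Proof.
move=> Di Hx hu z Uz; rewrite -Hx.
by apply: le_trans (hu z Uz) _; exact: sup_fun_ub.
Qed.

(** A member of the family that exceeds a at x exceeds it near x, by its subgradient. *)
Lemma sup_fun_open_gt (a : R) : open [set x | U x /\ a < f x].
Proof.
rewrite openE => x [Ux afx].
have [i Di aH] : exists2 i, D i & a < H i x.
  apply: contrapT => nH; move: afx; rewrite ltNge => /negP; apply.
  apply: sup_fun_le => i Di; rewrite leNgt; apply/negP => aH.
  by apply: nH; exists i.
have [u hu] := Hsub Di Ux.
have [d1 d10 xU] := open_ballP oU Ux.
pose e := (H i x - a) / 2; have e0 : 0 < e by rewrite divr_gt0// subr_gt0.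
have [d2 d20 wd2] := modulus_small mw e0.
pose S := \sum_j `|u j 0|.
have S0 : 0 <= S by apply: sumr_ge0.
apply/nbhs_ballP; exists (Num.min (Num.min d1 d2) (Num.min 1 (e / (S + 1)))) => /=.
  by rewrite !lt_min d10 d20 ltr01/= divr_gt0// ltr_wpDl.
move=> z; rewrite -ball_normE/= distrC !lt_min => /andP[/andP[z1 z2] /andP[z3 z4]].
have Uz : U z by rewrite -[z](subrK x) addrC; exact: xU.
split => //; apply: lt_le_trans (sup_fun_ub z Di).
apply: lt_le_trans (hu z Uz).
have l1 := linform_le u (z - x).
have l2 : S * `|z - x| < e.
  move: z4; rewrite ltr_pdivlMr ?ltr_wpDl// => z4.
  by have := normr_ge0 (z - x); lra.
have l3 : `|z - x| * w `|z - x| <= 1 * e.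
  have [_ _ w0 _] := mw.
  by apply: ler_pM; rewrite ?normr_ge0 ?w0 ?(ltW z3)// wd2// normr_ge0.
move: l1; rewrite -/S ler_norml => /andP[l1 _].
have : H i x - a = 2 * e by rewrite /e; lra.
by lra.
Qed.

End sup_fun.
End supremum.

(** * Gradients and maps of class C^1 *)

Section differential.
Context {R : realType}.

Lemma is_diff_nearP (V W : normedModType R) (f : V -> W) (df : {linear V -> W}) x :
  continuous df ->
  is_diff x f df <-> forall e : R, 0 < e ->
    \forall v \near (0 : V), `|f (v + x) - f x - df v| <= e * `|v|.
Proof.
move=> cdf; split=> [[dfx dfE] e e0|H].
  have [_] := (diff_locallyP x f).1 dfx; rewrite dfE => /eqaddoP/(_ e e0).
  by apply: filterS => v; rewrite /= opprD addrA.
have E : f \o shift x = cst (f x) + df +o_ (0 : V) id.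
  by apply/eqaddoP => e e0; apply: filterS (H e e0) => v; rewrite /= opprD addrA.
have dE := diff_unique cdf E.
by split => //; apply/diff_locallyP; rewrite dE.
Qed.

Context {n : nat}.
Local Notation V := 'rV[R]_n.
Implicit Types (f : V -> R) (x v : V) (u : 'cV[R]_n).

Lemma linform_is_linear u : linear (linform u : V -> R^o).
Proof. by move=> a v v'; rewrite linformD linformZ. Qed.

HB.instance Definition _ u :=
  GRing.isLinear.Build R V R^o _ (linform u : V -> R^o) (linform_is_linear u).

Lemma linform_continuous u : continuous (linform u : V -> R^o).
Proof.
move=> x; apply/(@cvgrPdist_le _ _ _ (nbhs x) (nbhs_filter x)) => e e0.
pose S : R := \sum_i `|u i 0|; have S0 : 0 <= S by exact: sumr_ge0.
have d0 : 0 < e / (S + 1) by rewrite divr_gt0// ltr_wpDl.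
apply/nbhs_ballP; exists (e / (S + 1)) => // z; rewrite -ball_normE/=.
have -> : linform u x - linform u z = linform u (x - z).
  by rewrite linformD linformN.
move=> h; apply: le_trans (linform_le _ _) _; rewrite -/S.
by move: h; rewrite ltr_pdivlMr ?ltr_wpDl// => h; have := normr_ge0 (x - z); lra.
Qed.

Lemma has_gradientP f x u :
  has_gradient f x u <-> is_diff x f (fun v => (v *m u) 0 0).
Proof.
rewrite -[fun v => _]/(linform u).
apply: iff_trans (iff_sym (is_diff_nearP (f : V -> R^o) x (@linform_continuous u))).
split=> H e e0.
  have [d d0 dP] := H e e0; apply/nbhs_ballP; exists d => // v.
  by rewrite -ball_normE/= sub0r normrN [v + x]addrC; exact: dP.
have /nbhs_ballP[d d0 dP] := H e e0; exists d => // v vd.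
by rewrite [x + v]addrC; apply: dP; rewrite -ball_normE/= sub0r normrN.
Qed.

Lemma has_gradient_near f f' x u : f x = f' x ->
  (\forall z \near x, f z = f' z) -> has_gradient f x u -> has_gradient f' x u.
Proof.
move=> fx /nbhs_ballP[d1 /= d10 ff'] fu e e0; have [d d0 dP] := fu e e0.
exists (Num.min d d1); first by rewrite lt_min d0.
move=> v; rewrite lt_min => /andP[vd vd1]; rewrite -fx -ff'; first exact: dP.
by rewrite -ball_normE/= opprD addrA subrr sub0r normrN.
Qed.

Lemma has_gradient_unique f x u u' :
  has_gradient f x u -> has_gradient f x u' -> u = u'.
Proof.
move=> fu fu'; apply/eqP; rewrite -subr_eq0; apply/eqP; apply: linform_small => e e0.
have e20 : 0 < e / 2 by rewrite divr_gt0.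
have [d d0 dP] := fu _ e20; have [d' d'0 dP'] := fu' _ e20.
exists (Num.min d d'); first by rewrite lt_min d0.
move=> v; rewrite lt_min => /andP[/dP + /dP']; rewrite !ler_norml.
by move=> /andP[? ?] /andP[? ?]; rewrite linformBl; lra.
Qed.

(** Expresses the gradient by countably many operations that preserve measurability. *)
Lemma has_gradient_coord f x u i : has_gradient f x u ->
  (fun k => k.+1%:R * (f (x + k.+1%:R^-1 *: delta_mx 0 i) - f x)) @ \oo --> u i 0.
Proof.
move=> fu; apply/cvgrPdist_le => e e0; have [d d0 dP] := fu e e0.
near=> k; have kd : k.+1%:R^-1 < d by near: k; exact: near_infty_natSinv_lt (PosNum d0).
have k0 : 0 < k.+1%:R^-1 :> R by rewrite invr_gt0.
have nk : `|k.+1%:R^-1 *: delta_mx 0 i : V| <= k.+1%:R^-1.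
  by rewrite normrZ ger0_norm ?(ltW k0)// ler_piMr ?(ltW k0)// norm_delta.
have := dP _ (le_lt_trans nk kd); rewrite linformZ linform_delta => h.
have K0 : 0 < k.+1%:R :> R by [].
rewrite -(ler_pM2l k0) -[X in X * `|_| <= _]gtr0_norm// -normrM mulrBr mulrA.
rewrite mulVf ?gt_eqF// mul1r distrC (le_trans h)// mulrC.
by rewrite ler_wpM2r// ltW.
Unshelve. all: by end_near. Qed.

End differential.

Lemma has_gradient_comp (R : realType) (m n : nat) (f : 'rV[R]_m -> R)
    (tau : 'rV[R]_n -> 'rV[R]_m) x (u : 'cV[R]_m) :
  differentiable tau x -> has_gradient f (tau x) u ->
  has_gradient (f \o tau) x (jacobian tau x *m u).
Proof.
move=> dtau /has_gradientP fu; apply/has_gradientP.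
have dtau' := differentiableP dtau.
rewrite (_ : (fun v => _) = (fun v : 'rV[R]_m => (v *m u) 0 0 : R^o) \o 'd tau x).
  exact: is_diff_comp.
by apply/funext => v /=; rewrite mulmxA /jacobian mul_rV_lin1.
Qed.

Section C1.
Context {R : realType} {m : nat}.
Local Notation V := 'rV[R]_m.

(** Mean value theorem for g - D t along the i-th coordinate line. *)
Lemma mean_value_coord (g : V -> R) (y : V) (i : 'I_m) (s D e : R) :
  (forall t, `|t| <= `|s| -> derivable g (y + t *: delta_mx 0 i) (delta_mx 0 i) /\
     `|'D_(delta_mx 0 i) g (y + t *: delta_mx 0 i) - D| <= e) ->
  `|g (y + s *: delta_mx 0 i) - g y - s * D| <= e * `|s|.
Proof.
move=> H; pose h (t : R) := g (y + t *: delta_mx 0 i).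
pose dh (t : R) := 'D_(delta_mx 0 i) g (y + t *: delta_mx 0 i).
have hd t : `|t| <= `|s| -> is_derive t (1 : R) h (dh t).
  move=> /H[dg _].
  have quot : (fun k : R => k^-1 *: ((h \o shift t) (k *: 1) - h t)) =
      (fun k : R => k^-1 *: ((g \o shift (y + t *: delta_mx 0 i)) (k *: delta_mx 0 i) -
        g (y + t *: delta_mx 0 i))).
    apply/funext => k; rewrite /h /=; congr (_ *: (g _ - _)).
    by rewrite scaler1 scalerDl addrCA.
  split; first by rewrite /derivable quot.
  by rewrite /derive quot.
have mvt a b : a <= b -> (forall t, a <= t <= b -> `|t| <= `|s|) ->
    exists2 c, `|c| <= `|s| & h b - h a = dh c * (b - a).
  move=> ab abs; have [||c cab hE] := @MVT_segment R h dh a b ab.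
  - by move=> x; rewrite in_itv/= => /andP[? ?]; apply: hd; apply: abs; rewrite !ltW.
  - apply: derivable_within_continuous => x; rewrite in_itv/= => xab.
    by have [] := hd x (abs _ xab).
  - by exists c => //; apply: abs; move: cab; rewrite in_itv.
have [c cs hE] : exists2 c, `|c| <= `|s| & h s - h 0 = dh c * s.
  have [s0|s0] := leP 0 s.
    have [|c cs hE] := mvt 0 s s0; last by exists c => //; rewrite hE subr0.
    by move=> t /andP[t0 ts]; rewrite !ger0_norm.
  have [|c cs hE] := mvt s 0 (ltW s0); last by exists c => //; move: hE; rewrite sub0r; lra.
  by move=> t /andP[t0 ts]; rewrite !ler0_norm ?lerN2// ltW.
have -> : g (y + s *: delta_mx 0 i) - g y - s * D = (dh c - D) * s.
  move: hE; rewrite /h scale0r addr0 mulrBl => ->; ring.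
by rewrite normrM ler_wpM2r//; have [_] := H c cs.
Qed.

(** One goes from x to y by changing the coordinates one at a time; each step is an
    instance of [mean_value_coord]. *)
Lemma strict_differential (U : set V) (g : V -> R) (a : V) (e : R) : open U -> U a ->
  (forall (i : 'I_m) x, U x -> derivable g x (delta_mx 0 i)) ->
  (forall i : 'I_m, {for a, continuous ('D_(delta_mx 0 i) g)}) -> 0 < e ->
  exists2 d : R, 0 < d & forall x y, ball a d x -> ball a d y ->
    `|g y - g x - linform (\col_i 'D_(delta_mx 0 i) g a) (y - x)| <= e * `|y - x|.
Proof.
move=> oU Ua dg cg e0.
have e'0 : 0 < e / (m%:R + 1) by rewrite divr_gt0// ltr_wpDl.
set e' := e / _ in e'0.
have : \forall x \near a, U x /\ forall i : 'I_m,
    `|'D_(delta_mx 0 i) g x - 'D_(delta_mx 0 i) g a| <= e'.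
  apply: filterI; first exact: open_nbhs_nbhs.
  apply: (@filter_forall _ _ (fun (i : 'I_m) (x : V) =>
    `|'D_(delta_mx 0 i) g x - 'D_(delta_mx 0 i) g a| <= e') (nbhs a) _) => i; have /cvgrPdist_le/(_ e' e'0) := cg i.
  by apply: filterS => x; rewrite distrC.
move=> /nbhs_ballP[d3 /= d30 dP]; pose d := d3 / 3.
have d0 : 0 < d by rewrite divr_gt0.
exists d => // x y ax ay.
have yx : `|y - x| < 2 * d.
  move: ax ay; rewrite -!ball_normE/= => ax ay.
  have -> : y - x = (a - x) - (a - y) by rewrite opprB [RHS]addrC addrA subrK.
  by have := ler_normB (a - x) (a - y); lra.
pose z k : V := \row_i (if (i < k)%N then y 0 i else x 0 i).
have zd k : ball a d (z k).
  by apply/mem_ballP => // i; rewrite mxE; case: ifP => _; [move: ay|move: ax];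
    move=> /(mem_ballP _ _ d0).
have key k : (k <= m)%N ->
    `|g (z k) - g x - \sum_(i < m | (i < k)%N) (y - x) 0 i * 'D_(delta_mx 0 i) g a| <=
    k%:R * (e' * `|y - x|).
  elim: k => [|k IH] km.
    rewrite big_pred0// subr0 (_ : z 0%N = x) ?subrr ?normr0 ?mul0r//.
    by apply/rowP => i; rewrite mxE.
  pose i := Ordinal km.
  rewrite (bigD1 i) ?ltnS//=.
  rewrite (eq_bigl (fun j : 'I_m => (j < k)%N)); last first.
    move=> j; rewrite ltnS (ltn_neqAle j k) andbC; congr (_ && _).
  have zS : z k.+1 = z k + (y - x) 0 i *: delta_mx 0 i.
    apply/rowP => j; rewrite !mxE ltnS (leq_eqVlt j k) eqxx/=.
    have [->|ji] := eqVneq j i.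
      by rewrite eqxx/= ltnn mulr1 addrC subrK.
    have -> : (j == k :> nat) = false by apply/negbTE; apply: contra ji => /eqP h; apply/eqP/val_inj.
    by rewrite mulr0 addr0.
  have step := @mean_value_coord g (z k) i ((y - x) 0 i) ('D_(delta_mx 0 i) g a) e'.
  have {step} step : `|g (z k.+1) - g (z k) - (y - x) 0 i * 'D_(delta_mx 0 i) g a| <=
      e' * `|y - x|.
    rewrite zS; apply: le_trans (_ : e' * `|(y - x) 0 i| <= _); last first.
      by rewrite ler_wpM2l ?(ltW e'0)// coord_le_norm.
    apply: step => t ti.
    have [Ut Dt] : U (z k + t *: delta_mx 0 i) /\ forall j : 'I_m,
        `|'D_(delta_mx 0 j) g (z k + t *: delta_mx 0 i) - 'D_(delta_mx 0 j) g a| <= e'.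
      apply: dP; move: (zd k); rewrite -!ball_normE/= => zk.
      have nt : `|t *: delta_mx 0 i : V| <= `|y - x|.
        rewrite normrZ (le_trans _ (coord_le_norm (y - x) i))//.
        by rewrite (le_trans _ ti)// ler_piMr// norm_delta.
      rewrite opprD addrA; have := ler_normB (a - z k) (t *: delta_mx 0 i).
      by rewrite /d in yx zk; lra.
    by split; [exact: dg|exact: Dt].
  have := IH (ltnW km); rewrite -(natr1 k) mulrDl mul1r => IHk.
  rewrite (_ : _ - _ = (g (z k.+1) - g (z k) - (y - x) 0 i * 'D_(delta_mx 0 i) g a) +
    (g (z k) - g x - \sum_(i < m | (i < k)%N) (y - x) 0 i * 'D_(delta_mx 0 i) g a)).
    by rewrite (le_trans (ler_normD _ _))// addrC lerD.
  by ring.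
have := key m (leqnn m).
have -> : z m = y by apply/rowP => i; rewrite mxE ltn_ord.
rewrite (eq_bigl xpredT) => [|i]; last exact: ltn_ord.
rewrite linformE; under [in X in _ -> X]eq_bigr do rewrite mxE.
move=> /le_trans; apply; rewrite mulrA ler_wpM2r//.
have : e' * (m%:R + 1) = e by rewrite divfK// gt_eqF// ltr_wpDl.
lra.
Qed.

End C1.

Section C1_map.
Context {R : realType} {m n : nat}.
Implicit Types (f : 'rV[R]_m -> 'rV[R]_n) (U : set 'rV[R]_m) (a : 'rV[R]_m).

Lemma mulmx_norm_le (J : 'M[R]_(m, n)) (v : 'rV[R]_m) :
  `|v *m J| <= (\sum_j \sum_i `|J i j|) * `|v|.
Proof.
have S0 : 0 <= \sum_j \sum_i `|J i j| by do 2 apply: sumr_ge0 => ? _.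
apply: norm_le_coord; first by rewrite mulr_ge0.
move=> j; have -> : (v *m J) 0 j = linform (col j J) v.
  by rewrite linformE mxE; apply: eq_bigr => i _; rewrite mxE.
apply: le_trans (linform_le _ _) _; rewrite ler_wpM2r//.
rewrite (bigD1 j)//=; under eq_bigr do rewrite mxE.
by rewrite lerDl; do 2 apply: sumr_ge0 => ? _.
Qed.

Lemma mulmxr_continuous (J : 'M[R]_(m, n)) : continuous (mulmxr J : 'rV_m -> 'rV_n).
Proof.
move=> x; apply/(@cvgrPdist_le _ _ _ (nbhs x) (nbhs_filter x)) => e e0.
set S : R := \sum_j \sum_i `|J i j|.
have S0 : 0 <= S by do 2 apply: sumr_ge0 => ? _.
apply/nbhs_ballP; exists (e / (S + 1)); first by rewrite /= divr_gt0// ltr_wpDl.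
move=> z; rewrite -ball_normE/= ltr_pdivlMr ?ltr_wpDl// => h.
rewrite -mulmxBl (le_trans (mulmx_norm_le _ _))// -/S.
by have := normr_ge0 (x - z); lra.
Qed.

Lemma C1_strict f U a (e : R) : open U -> U a -> class_C 1 U f -> 0 < e ->
  exists2 d : R, 0 < d & forall x y, ball a d x -> ball a d y ->
    `|f y - f x - (y - x) *m (\matrix_(i, j) 'D_(delta_mx 0 i) f a 0 j)| <=
      e * `|y - x|.
Proof.
move=> oU Ua [_ Cf] e0.
pose g j (x : 'rV[R]_m) : R := f x 0 j.
have gder j (i : 'I_m) x : U x -> derivable (g j) x (delta_mx 0 i) /\
    'D_(delta_mx 0 i) (g j) x = 'D_(delta_mx 0 i) f x 0 j.
  move=> Ux; have [/(_ x Ux) df _] := Cf i; split.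
    by move/derivable_mxP : df; apply.
  by rewrite (derive_mx df) mxE.
have gcont j (i : 'I_m) : {for a, continuous ('D_(delta_mx 0 i) (g j))}.
  have [_ [/(_ a Ua) cD _]] := Cf i.
  suff : 'D_(delta_mx 0 i) (g j) x @[x --> a] --> 'D_(delta_mx 0 i) f a 0 j.
    by rewrite -(gder j i a Ua).2.
  have : (fun x => 'D_(delta_mx 0 i) f x 0 j) @ a --> 'D_(delta_mx 0 i) f a 0 j.
    exact: (continuous_comp cD (@coord_continuous R 1 n 0 j _)).
  apply: cvg_trans; apply: (@near_eq_cvg _ _ (nbhs a) (nbhs_filter a)).
  by apply: filterS (open_nbhs_nbhs (conj oU Ua)) => x Ux; rewrite (gder j i x Ux).2.
have [d dP] : {d : 'I_n -> R & forall j, 0 < d j /\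
    forall x y, ball a (d j) x -> ball a (d j) y ->
    `|g j y - g j x - linform (\col_i 'D_(delta_mx 0 i) (g j) a) (y - x)| <=
      e * `|y - x|}.
  apply: (@choice _ _ (fun (j : 'I_n) (d : R) => 0 < d /\
    forall x y, ball a d x -> ball a d y ->
    `|g j y - g j x - linform (\col_i 'D_(delta_mx 0 i) (g j) a) (y - x)| <=
      e * `|y - x|)) => j.
  have [|d d0 dP] := @strict_differential _ _ U (g j) a e oU Ua _ (gcont j) e0.
    by move=> i x /(gder j i)[].
  by exists d.
exists (\big[Num.min/1]_j d j).
  by apply/bigmin_gtP; split => // j _; exact: (dP j).1.
move=> x y ax ay; apply: norm_le_coord; first by rewrite mulr_ge0 ?(ltW e0).
move=> j; have dj : \big[Num.min/1]_j d j <= d j by exact: bigmin_le.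
have := (dP j).2 x y (le_ball dj ax) (le_ball dj ay); congr (`|_| <= _).
rewrite !mxE linformE; congr (_ - _).
by apply: eq_bigr => i _; rewrite !mxE (gder j i a Ua).2.
Unshelve. all: by end_near. Qed.

Lemma C1_differentiable f U a : open U -> U a -> class_C 1 U f ->
  differentiable f a.
Proof.
move=> oU Ua Cf.
pose J : 'M[R]_(m, n) := \matrix_(i, j) 'D_(delta_mx 0 i) f a 0 j.
suff [] : is_diff a f (mulmxr J : 'rV_m -> 'rV_n) by [].
apply/(is_diff_nearP f a (@mulmxr_continuous J)) => e e0.
have [d d0 dP] := C1_strict oU Ua Cf e0.
apply/nbhs_ballP; exists d => // v; rewrite -ball_normE/= sub0r normrN => vd.
have := dP a (v + a); rewrite addrK; apply; first exact: ballxx.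
by rewrite -ball_normE/= opprD addrCA subrr addr0 normrN.
Qed.

Lemma C1_lipschitz f U a : open U -> U a -> class_C 1 U f ->
  exists L d : R, [/\ 0 < L, 0 < d & forall x y, ball a d x -> ball a d y ->
    `|f x - f y| <= L * `|x - y|].
Proof.
move=> oU Ua Cf; have [d d0 dP] := C1_strict oU Ua Cf ltr01.
set J := \matrix_(i, j) _ in dP.
have S0 : 0 <= \sum_j \sum_i `|J i j| by do 2 apply: sumr_ge0 => ? _.
exists (\sum_j \sum_i `|J i j| + 1), d; split => //; first by rewrite ltr_wpDl.
move=> x y ax ay; have h := dP y x ay ax.
have -> : f x - f y = (f x - f y - (x - y) *m J) + (x - y) *m J by rewrite subrK.
rewrite (le_trans (ler_normD _ _))// mulrDl addrC lerD ?mulmx_norm_le//.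
Qed.

End C1_map.

(** * Density points and approximate differentials on a manifold *)

Section density_image.
Context {R : realType} {n : nat}.
Local Notation V := 'rV[R]_n.
Local Notation lam := (@lebesgue_rV R n).

(** The points of a ball around b that psi sends outside F are
    images by phi of points outside F of a comparable ball around a, and a Lipschitz
    map multiplies their measure by a bounded factor at most. *)
Lemma density_one_image (phi psi : V -> V) (U : set V) (F : set V) (a b : V) :
  open U -> U b -> psi b = a -> (forall z, U z -> phi (psi z) = z) ->
  (forall z, U z -> {for z, continuous psi}) ->
  (exists L d : R, [/\ 0 < L, 0 < d & forall x y, ball a d x -> ball a d y ->
    `|phi x - phi y| <= L * `|x - y|]) ->
  (exists L d : R, [/\ 0 < L, 0 < d & forall x y, ball b d x -> ball b d y ->
    `|psi x - psi y| <= L * `|x - y|]) ->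
  density_one F a -> density_one (U `&` psi @^-1` F) b.
Proof.
move=> oU Ub ba phiK cpsi [L [d [L0 d0 phiL]]] [L' [d' [L'0 d'0 psiL]]].
move=> /density_oneP[F1 [mF1 F1F HF1]]; apply/density_oneP.
exists (U `&` psi @^-1` F1); split.
- have := @continuous_borel V V U psi oU cpsi (open_borel oU) F1 mF1.
  by [].
- by move=> z [Uz Fz]; split => //; exact: F1F.
move=> e e0.
pose c := (8 * L) ^+ n * L' ^+ n.
have c0 : 0 < c by rewrite mulr_gt0// exprn_gt0// mulr_gt0.
have ec0 : 0 < e / c by rewrite divr_gt0.
have /nbhs_ballP[dU /= dU0 bU] := open_nbhs_nbhs (conj oU Ub).
have [d1 /= d10 HF] := HF1 (e / c) ec0.
near=> r.
have r0 : 0 < r by near: r; exact: nbhs_right_gt.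
have rU : r < dU by near: r; exact: nbhs_right_lt.
have rd' : r < d' by near: r; exact: nbhs_right_lt.
have Lr0 : 0 < L' * r by rewrite mulr_gt0.
have Lrd : L' * r < d.
  by rewrite mulrC -ltr_pdivlMr//; near: r; apply: nbhs_right_lt; rewrite divr_gt0.
have Lrd1 : L' * r < d1.
  by rewrite mulrC -ltr_pdivlMr//; near: r; apply: nbhs_right_lt; rewrite divr_gt0.
have psi_ball z : ball b r z -> ball a (L' * r) (psi z).
  move=> bz; rewrite -ball_normE/= -ba.
  have := psiL b z (ballxx b d'0) (le_ball (ltW rd') bz).
  move: bz; rewrite -ball_normE/= => bz /le_lt_trans; apply.
  by rewrite ltr_pM2l.
have sub : ball b r `\` (U `&` psi @^-1` F1) `<=` phi @` (ball a (L' * r) `\` F1).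
  move=> z [bz nz]; have Uz : U z by apply: bU; apply: le_ball bz; exact: ltW.
  exists (psi z); last exact: phiK.
  by split; [exact: psi_ball|move=> Fz; apply: nz].
apply: le_trans (le_lebesgue sub) _.
apply: le_trans (lipschitz_image L0 _ _) _.
- have := ball_lebesgue_fin Lr0 (@subDsetl _ (ball a (L' * r)) F1).
  by rewrite ge0_fin_numE ?lebesgue_ge0.
- move=> x y [ax _] [ay _]; apply: phiL; apply: le_ball (ltW Lrd) _ _ => //.
have H : (lam (ball a (L' * r) `\` F1) <= (e / c * (2 * (L' * r)) ^+ n)%:E)%E.
  apply: HF => //=; by rewrite sub0r normrN gtr0_norm.
apply: le_trans (lee_wpmul2l _ H) _.
  by rewrite lee_fin exprn_ge0// mulr_ge0// ltW.
rewrite -EFinM lee_fin le_eqVlt; apply/orP; left; apply/eqP.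
have -> : (2 * (L' * r)) ^+ n = L' ^+ n * (2 * r) ^+ n by rewrite mulrCA exprMn.
rewrite -[in RHS](divfK (lt0r_neq0 c0) e) /c; ring.
Unshelve. all: by end_near. Qed.

End density_image.

Section approximate_gradient.
Context {R : realType} {n : nat}.
Local Notation V := 'rV[R]_n.

(** If the i-th coordinate of u were not 0, then k would have a zero close to each of the
    two points a + (r / 2) e_i and a - (r / 2) e_i, where the values of its
    linearization differ by about r |u_i|. *)
Lemma has_gradient_density (k : V -> R) (a : V) (u : 'cV[R]_n) :
  has_gradient k a u -> density_one [set z | k z = 0] a -> u = 0.
Proof.
move=> ku dk; apply/colP => i; rewrite mxE; apply: contrapT => /eqP ui.
pose c : R := `|u i 0|; have c0 : 0 < c by rewrite normr_gt0.
pose s : R := Num.sg (u i 0).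
have s1 : `|s| = 1 by rewrite normr_sg ui.
have sc : s * u i 0 = c by rewrite /c normrEsg.
pose L : R := \sum_j `|u j 0|; have L0 : 0 <= L by exact: sumr_ge0.
have e0 : 0 < c / 8 by rewrite divr_gt0.
have [d d0 dP] := ku _ e0.
pose t := Num.min (1 / 2) (c / 8 / (L + 1)).
have L10 : 0 < L + 1 by rewrite ltr_wpDl.
have t0 : 0 < t by rewrite lt_min !divr_gt0.
have t2 : t <= 1 / 2 by rewrite ge_min lexx.
have tL : t * L <= c / 8.
  have : t <= c / 8 / (L + 1) by rewrite ge_min lexx orbT.
  by rewrite ler_pdivlMr// mulrDr; lra.
have H := density_one_ball t0 dk.
have : \forall r \near (0:R)^'+, False; last by move=> /filter_ex[].
near=> r.
have r0 : 0 < r by near: r; exact: nbhs_right_gt.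
have rd : r < d by near: r; exact: nbhs_right_lt.
have Hr : forall y, ball y (t * r) `<=` ball a r ->
    [set z | k z = 0] `&` ball y (t * r) !=set0 by near: r.
have point (b : R) : `|b| = 1 -> exists z, [/\ k z = 0, `|z - a| < r &
    `|linform u (z - a) - r / 2 * (b * u i 0)| <= L * (t * r)].
  move=> b1; pose y : V := a + (r / 2 * b) *: delta_mx 0 i.
  have ya : `|y - a| <= r / 2.
    by rewrite /y addrAC subrr add0r; apply: norm_scale_delta => //; rewrite divr_ge0// ltW.
  have tr2 : t * r <= r / 2 by have := ler_wpM2r (ltW r0) t2; lra.
  have yr z : ball y (t * r) z -> `|z - a| < r.
    rewrite -ball_normE/= => yz.
    have -> : z - a = (y - a) - (y - z) by rewrite opprB [RHS]addrC addrA subrK.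
    by have := ler_normB (y - a) (y - z); lra.
  have [z [kz yz]] : [set z | k z = 0] `&` ball y (t * r) !=set0.
    by apply: Hr => z /yr h; rewrite -ball_normE/= distrC.
  exists z; split => //; first exact: yr.
  have -> : linform u (z - a) = linform u (z - y) + r / 2 * (b * u i 0).
    rewrite mulrA -linform_delta -linformZ -linformD; congr (linform u _).
    by rewrite /y opprD addrA subrK.
  rewrite addrK (le_trans (linform_le _ _))// ler_wpM2l//.
  by move: yz; rewrite -ball_normE/= distrC => /ltW.
have [z [kz za lz]] := point s s1.
have [|z' [kz' za' lz']] := point (- s); first by rewrite normrN.
have := dP (z - a) (lt_trans za rd); have := dP (z' - a) (lt_trans za' rd).
rewrite ![a + (_ - a)]addrC !subrK kz kz'.
have h1 := ler_wpM2l (ltW e0) (ltW za).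
have h2 := ler_wpM2l (ltW e0) (ltW za').
have h3 := ler_wpM2r (ltW r0) tL.
have rc := mulr_gt0 r0 c0.
move: lz lz'; rewrite mulNr sc !ler_norml.
by move=> /andP[? ?] /andP[? ?] /andP[? ?] /andP[? ?]; lra.
Unshelve. all: by end_near. Qed.

End approximate_gradient.

Section charts.
Context {R : realType} {n : nat} {M : ptopologicalType}.
Variable S : smooth_structure R n M.
Implicit Types (th : chart R n M) (x y : M) (f : M -> R) (p : cotangent S).
Local Notation V := 'rV[R]_n.
Local Notation codom := Defs.codom.
Local Notation coord := Defs.coord.

Definition overlap th1 th2 : set V := th1 @` (dom th1 `&` dom th2).

Lemma cinv_codom th z : codom th z -> dom th (cinv th z) /\ th (cinv th z) = z.
Proof. by move=> [x dx <-]; rewrite cmapK. Qed.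

Lemma cinv_continuous th z : codom th z -> {for z, continuous (cinv th)}.
Proof. by move=> [x dx <-]; exact: continuous_cinv. Qed.

Lemma open_codom th : open (codom th).
Proof. exact: open_image. Qed.

Lemma overlapP th1 th2 z :
  overlap th1 th2 z <-> codom th1 z /\ dom th2 (cinv th1 z).
Proof.
split=> [[x [d1 d2] <-]|[[x d1 <-]]]; first by rewrite cmapK//; split => //; exists x.
by rewrite cmapK// => d2; exists x.
Qed.

Lemma overlap_open th1 th2 : open (overlap th1 th2).
Proof.
rewrite openE => z /overlapP[cz dz].
have h1 := open_nbhs_nbhs (conj (@open_codom th1) cz).
have h2 := cinv_continuous cz (open_nbhs_nbhs (conj (@open_dom _ _ _ th2) dz)).
by apply: filterS2 h1 h2 => y ? ?; apply/overlapP.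
Qed.

Lemma overlap_dom th1 th2 x : dom th1 x -> dom th2 x -> overlap th1 th2 (th1 x).
Proof. by move=> d1 d2; exists x. Qed.

Lemma transitionE th1 th2 x : dom th1 x -> transition th1 th2 (th1 x) = th2 x.
Proof. by move=> dx; rewrite /transition /= cmapK. Qed.

Lemma transition_C1 th1 th2 : atlas S th1 -> atlas S th2 ->
  class_C 1 (overlap th1 th2) (transition th1 th2).
Proof. by move=> a1 a2; have [/(_ 1%N)] := atlas_compatible a1 a2. Qed.

(** Chain rule. *)
Lemma has_gradient_chart f x th1 th2 u : atlas S th1 -> atlas S th2 ->
  dom th1 x -> dom th2 x -> has_gradient (f \o cinv th2) (th2 x) u ->
  has_gradient (f \o cinv th1) (th1 x)
    (jacobian (transition th1 th2) (th1 x) *m u).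
Proof.
move=> a1 a2 d1 d2; rewrite -(transitionE th2 d1) => fu.
have dtau : differentiable (transition th1 th2) (th1 x).
  exact: (C1_differentiable (overlap_open (th2 := th2)) (overlap_dom d1 d2)
    (transition_C1 a1 a2)).
have := has_gradient_comp dtau fu; apply: has_gradient_near.
  by rewrite /= transitionE// !cmapK.
apply: filterS (open_nbhs_nbhs (conj (@overlap_open th1 th2) (overlap_dom d1 d2))).
by move=> z /overlapP[cz dz] /=; rewrite /transition /= cmapK.
Qed.

Lemma cotangent_eq p p' : base p = base p' -> coord p = coord p' -> p = p'.
Proof.
case: p p' => [x c h1 h2] [x' c' h1' h2'] /= xx' cc'; subst x' c'.
by congr Cotangent; exact: Prop_irrelevance.
Qed.

Lemma is_differentialP f p : is_differential f p <->
  forall th, atlas S th -> dom th (base p) ->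
    has_gradient (f \o cinv th) (th (base p)) (coord p th).
Proof. by split=> H th ath dth; apply/has_gradientP; exact: H. Qed.

(** The chain rule forces the coordinates in the other charts, and uniqueness of the
    gradient makes them compatible with each other. *)
Lemma is_differential_exists f x th0 u : atlas S th0 -> dom th0 x ->
  has_gradient (f \o cinv th0) (th0 x) u ->
  exists p, [/\ base p = x, is_differential f p & coord p th0 = u].
Proof.
move=> a0 d0 fu.
pose co th : 'cV[R]_n := if `[< atlas S th /\ dom th x >] then
  jacobian (transition th th0) (th x) *m u else 0.
have coP th : atlas S th -> dom th x -> has_gradient (f \o cinv th) (th x) (co th).
  move=> ath dth; rewrite /co asboolT//; exact: has_gradient_chart.
have h1 th1 th2 : atlas S th1 -> atlas S th2 -> dom th1 x -> dom th2 x ->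
    co th1 = jacobian (transition th1 th2) (th1 x) *m co th2.
  move=> a1 a2 d1 d2; apply: has_gradient_unique (coP th1 a1 d1) _.
  by apply: has_gradient_chart => //; exact: coP.
have h2 th : ~ (atlas S th /\ dom th x) -> co th = 0.
  by move=> nth_; rewrite /co asboolF.
exists (@Cotangent _ _ _ S x co h1 h2); split => //=.
  by apply/is_differentialP => th /=; exact: coP.
exact: has_gradient_unique (coP th0 a0 d0) fu.
Qed.

(** Transition maps are locally bi-Lipschitz. *)
Lemma density_one_chart (H : set M) x th1 th2 : atlas S th1 -> atlas S th2 ->
  dom th1 x -> dom th2 x -> density_one (th1 @` (dom th1 `&` H)) (th1 x) ->
  density_one (th2 @` (dom th2 `&` H)) (th2 x).
Proof.
move=> a1 a2 d1 d2 dH.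
have C12 := transition_C1 a1 a2; have C21 := transition_C1 a2 a1.
have inv z : overlap th2 th1 z -> transition th1 th2 (transition th2 th1 z) = z.
  by move=> [y [e2 e1] <-]; rewrite !transitionE.
have D := density_one_image (@overlap_open th2 th1) (overlap_dom d2 d1)
  (transitionE th1 d2) inv C21.1
  (C1_lipschitz (@overlap_open th1 th2) (overlap_dom d1 d2) C12)
  (C1_lipschitz (@overlap_open th2 th1) (overlap_dom d2 d1) C21) dH.
apply: density_one_sub D => z [[y [e2 e1] <-]] /=.
rewrite transitionE// => -[y' [e1' Hy'] yy']; exists y => //; split => //.
by rewrite -(cmapK e1) -yy' cmapK.
Qed.

(** Two functions that are candidates for the approximation agree on a set of density
    one, so that the gradient of their difference is 0. *)
Lemma is_approx_differential_unique (phi : M -> \bar R) p p' : base p = base p' ->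
  is_approx_differential phi p -> is_approx_differential phi p' -> p = p'.
Proof.
move=> bp [h hp dh] [h' hp' dh']; apply: cotangent_eq => //.
apply/funext => th.
have [[ath dth]|nth_] := pselect (atlas S th /\ dom th (base p)); last first.
  by rewrite !coord_out// -bp.
have gh := (is_differentialP h p).1 hp th ath dth.
have gh' : has_gradient (h' \o cinv th) (th (base p)) (coord p' th).
  by rewrite bp; apply: (is_differentialP h' p').1 => //; rewrite -bp.
have D := dh th ath dth.
have D' : density_one (th @` (dom th `&` [set x | phi x = (h' x)%:E])) (th (base p)).
  by rewrite bp; apply: dh' => //; rewrite -bp.
apply/eqP; rewrite -subr_eq0; apply/eqP.
apply: (@has_gradient_density _ _ (fun z => h (cinv th z) - h' (cinv th z)) (th (base p))).
  move=> e e0; have e20 : 0 < e / 2 by rewrite divr_gt0.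
  have [d d0 dP] := gh _ e20; have [d' d'0 dP'] := gh' _ e20.
  exists (Num.min d d'); first by rewrite lt_min d0.
  move=> v; rewrite lt_min => /andP[/dP + /dP']; rewrite linformBl /= !ler_norml.
  by move=> /andP[? ?] /andP[? ?]; apply/andP; split; lra.
apply: density_one_sub (density_oneI D D') => z [[y [dy /= hy] yz] [y' [dy' /= hy'] yz']].
have yy' : y' = y by rewrite -(cmapK dy) yz -yz' cmapK.
rewrite -yz /= cmapK//; apply/eqP; rewrite subr_eq0; apply/eqP.
by rewrite yy' in hy'; apply: EFin_inj; rewrite -hy -hy'.
Qed.

End charts.

(** * Calibrated pairs and plans of least cost *)

Section truncation.
Context {R : realType}.
Implicit Types (x y : \bar R) (m : nat).

(** The potentials of a calibrated pair may be infinite and not integrable; their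
    truncations at height m have integrals that depend only on the marginals. *)
Definition etrunc m x : \bar R := maxe (- m%:R)%:E (mine m%:R%:E x).
Definition trunc m x : R := fine (etrunc m x).

Lemma etruncE m x : (trunc m x)%:E = etrunc m x.
Proof.
rewrite /trunc fineK// /etrunc; case: x => [r||].
- by rewrite /mine; case: ifP => _; rewrite /maxe; case: ifP.
- by rewrite /mine ltry /maxe; case: ifP.
- by rewrite /mine ltNge leNye/= /maxe ltNge leNye.
Qed.

Lemma truncr m (r : R) : trunc m r%:E = Num.max (- m%:R) (Num.min m%:R r).
Proof. by rewrite /trunc /etrunc -EFin_min -EFin_max. Qed.

Lemma truncpinfty m : trunc m +oo%E = m%:R.
Proof.
rewrite /trunc /etrunc /mine ltry /maxe lte_fin; case: ifP => //= /negbT.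
by rewrite -leNgt => h; have : 0 <= m%:R :> R by []; lra.
Qed.

Lemma truncninfty m : trunc m -oo%E = - m%:R.
Proof. by rewrite /trunc /etrunc min_r ?leNye// max_l ?leNye. Qed.

Lemma trunc_bound m x : `|trunc m x| <= m%:R.
Proof.
have m0 : 0 <= m%:R :> R by [].
case: x => [r||]; last 2 first.
- by rewrite truncpinfty ger0_norm.
- by rewrite truncninfty normrN ger0_norm.
rewrite truncr ler_norml; apply/andP; split; first by rewrite le_max lexx.
by rewrite ge_max ge_min lexx; apply/andP; split; lra.
Qed.

(** Truncation is non-decreasing and does not increase distances; c >= 0 covers the case
    y < x. *)
Lemma truncB_le m x y (c : R) : x != -oo%E -> y != +oo%E -> 0 <= c ->
  (y - x <= c%:E)%E -> trunc m y - trunc m x <= c.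
Proof.
have m0 : 0 <= m%:R :> R by [].
case: x y => [r||] [s||] // _ _ c0; rewrite ?truncninfty ?truncpinfty.
- rewrite -EFinB lee_fin !truncr => sr.
  by rewrite /Num.max /Num.min; case: (ltP m%:R s) => ?; case: (ltP m%:R r) => ?;
    do ! case: ltP => ?; lra.
- by move=> _; have := trunc_bound m r%:E; rewrite ler_norml => /andP[? ?]; lra.
- by move=> _; have := trunc_bound m s%:E; rewrite ler_norml => /andP[? ?]; lra.
- by move=> _; lra.
Qed.

Lemma truncB_ge0 m (r s : R) : r <= s -> 0 <= trunc m s%:E - trunc m r%:E.
Proof.
move=> rs; rewrite subr_ge0 !truncr.
by rewrite /Num.max /Num.min; case: (ltP m%:R s) => ?; case: (ltP m%:R r) => ?;
    do ! case: ltP => ?; lra.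
Qed.

Lemma trunc_id m (r : R) : `|r| <= m%:R -> trunc m r%:E = r.
Proof.
rewrite ler_norml truncr => /andP[h1 h2].
by rewrite (min_idPr _)// (max_idPr _).
Qed.

Lemma trunc_cvg (r : R) : trunc m r%:E @[m --> \oo] --> r.
Proof.
apply: cvg_near_cst; near=> m; apply: trunc_id.
by near: m; exact: nbhs_infty_ger.
Unshelve. all: by end_near. Qed.

Lemma measurable_trunc m d (X : measurableType d) (f : X -> \bar R) :
  measurable_fun setT f -> measurable_fun setT (fun w : X => trunc m (f w)).
Proof.
move=> mf; apply/measurable_EFinP.
rewrite (_ : EFin \o _ = fun w => maxe (- m%:R)%:E (mine m%:R%:E (f w))).
  by apply: measurable_maxe => //; exact: measurable_mine.
by apply/funext => w; rewrite /= etruncE.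
Qed.

End truncation.

Lemma limn_einf_le (R : realType) (u v : (\bar R)^nat) :
  (forall m, u m <= v m)%E -> (limn_einf u <= limn_einf v)%E.
Proof.
move=> uv; rewrite !limn_einf_lim; apply: lee_lim; try exact: is_cvg_einfs.
apply: nearW => m; apply: le_ereal_inf_tmp => _ [k /= mk <-].
by apply: le_trans (uv k); apply: ereal_inf_lbound; exists k.
Qed.

Section calibration.
Context {R : realType} {d1 d2 d3 : measure_display}.
Context {X : measurableType d1} {Y : measurableType d2} {Z : measurableType d3}.
Variables (mu : probability X R) (nu : probability Y R) (p1 : Z -> X) (p2 : Z -> Y).
Hypotheses (mp1 : measurable_fun setT p1) (mp2 : measurable_fun setT p2).

Definition coupling (g : probability Z R) :=
  (forall A, measurable A -> g (p1 @^-1` A) = mu A) /\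
  (forall B, measurable B -> g (p2 @^-1` B) = nu B).

Lemma integrable_trunc m d (W : measurableType d) (P : probability W R)
    (f : W -> \bar R) : measurable_fun setT f ->
  P.-integrable setT (EFin \o (fun w => trunc m (f w))).
Proof.
move=> mf; apply: measurable_bounded_integrable => //.
- by rewrite (le_lt_trans (probability_le1 _ _))// ltry.
- exact: measurable_trunc.
- exists m%:R; split => // x mx w _ /=.
  exact: le_trans (trunc_bound _ _) (ltW mx).
Qed.

Lemma integral_marginal d (W : measurableType d) (P : probability W R) (p : Z -> W)
    (g : probability Z R) (f : W -> R) : measurable_fun setT p ->
  (forall A, measurable A -> g (p @^-1` A) = P A) ->
  measurable_fun setT f -> (exists m : R, forall w, `|f w| <= m) ->
  (\int[g]_z (f (p z))%:E = \int[P]_w (f w)%:E)%E.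
Proof.
move=> mp gP mf [m fm].
have mfp : measurable_fun setT (f \o p) by exact: measurableT_comp.
rewrite -(@eq_measure_integral _ _ _ _ P (pushforward g p) (EFin \o f)).
  rewrite integral_pushforward//.
    exact/measurable_EFinP.
  rewrite preimage_setT.
  apply: measurable_bounded_integrable => //.
    by rewrite (le_lt_trans (probability_le1 _ _))// ltry.
  exists m; split => [|x mx w _ /=]; first exact: num_real.
  exact: le_trans (fm _) (ltW mx).
by move=> A mA _; exact: gP.
Qed.
(** Let s_m = trunc m psi - trunc m phi, so that s_m <= c. Its integral is the same for g
    and g', since both have the marginals mu and nu. For g it tends to the cost of g by
    dominated convergence, as 0 <= s_m <= c holds g-almost everywhere. Then Fatou's
    lemma for c - s_m >= 0 and g' bounds the integral of c - (psi - phi) against g'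
    by the cost of g' minus the cost of g, which is at most 0. This difference is
    meaningful where both potentials are finite, which holds g'-almost everywhere
    because it holds g-almost everywhere and only involves the marginals. *)
Lemma calibrated_coupling (g g' : probability Z R) (c : Z -> R)
    (phi : X -> \bar R) (psi : Y -> \bar R) :
  coupling g -> coupling g' -> measurable_fun setT c -> (forall z, 0 <= c z) ->
  measurable_fun setT phi -> measurable_fun setT psi ->
  (forall x, phi x != -oo%E) -> (forall y, psi y != +oo%E) ->
  (forall z, (psi (p2 z) - phi (p1 z) <= (c z)%:E)%E) ->
  {ae g, forall z, (psi (p2 z) - phi (p1 z) = (c z)%:E)%E} ->
  (\int[g]_z (c z)%:E < +oo)%E ->
  (\int[g']_z (c z)%:E <= \int[g]_z (c z)%:E)%E ->
  {ae g', forall z, (psi (p2 z) - phi (p1 z) = (c z)%:E)%E}.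
Proof.
move=> [g1 g2] [g1' g2'] mc c0 mphi mpsi phiN psiN sub ae_eq cfin cle.
have mcE : measurable_fun setT (EFin \o c) by exact/measurable_EFinP.
have integrable_c (h : probability Z R) : (\int[h]_z (c z)%:E < +oo)%E ->
    h.-integrable setT (EFin \o c).
  move=> hfin; apply/integrableP; split => //.
  by under eq_integral => z _ do rewrite /= ger0_norm//.
have gc := integrable_c g cfin.
have gc' := integrable_c g' (le_lt_trans cle cfin).
pose s m z := trunc m (psi (p2 z)) - trunc m (phi (p1 z)).
have mphi1 : measurable_fun setT (phi \o p1) by exact: measurableT_comp.
have mpsi2 : measurable_fun setT (psi \o p2) by exact: measurableT_comp.
have ms m : measurable_fun setT (s m).
  apply: measurable_funB; first exact: (measurable_trunc m mpsi2).
  exact: (measurable_trunc m mphi1).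
have is_ (h : probability Z R) m : h.-integrable setT (EFin \o s m).
  rewrite (_ : EFin \o s m = fun z => ((trunc m (psi (p2 z)))%:E - (trunc m (phi (p1 z)))%:E)%E)//.
  by apply: integrableB => //; [exact: (integrable_trunc m h mpsi2)|
    exact: (integrable_trunc m h mphi1)].
have int_s (h : probability Z R) m : coupling h ->
    (\int[h]_z (s m z)%:E = \int[nu]_y (trunc m (psi y))%:E - \int[mu]_x (trunc m (phi x))%:E)%E.
  move=> [h1 h2]; under eq_integral do rewrite EFinB.
  rewrite integralB_EFin//.
  - congr (_ - _)%E.
      apply: (integral_marginal mp2 h2 (measurable_trunc m mpsi)).
      by exists m%:R => y; exact: trunc_bound.
    apply: (integral_marginal mp1 h1 (measurable_trunc m mphi)).
    by exists m%:R => x; exact: trunc_bound.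
  - exact: (integrable_trunc m h mpsi2).
  - exact: (integrable_trunc m h mphi1).
have sc m z : s m z <= c z by apply: truncB_le.
have fin_case z r : (psi (p2 z) - phi (p1 z) = r%:E)%E ->
    exists a b, [/\ psi (p2 z) = b%:E, phi (p1 z) = a%:E & r = b - a].
  move: (phiN (p1 z)) (psiN (p2 z)).
  case: (phi (p1 z)) => [a||] //; case: (psi (p2 z)) => [b||] // _ _ [<-].
  by exists a, b.
(* the truncated integrals converge to the optimal cost *)
have lim_s : (\int[g']_z (s m z)%:E @[m --> \oo] --> \int[g]_z (c z)%:E)%E.
  under eq_fun do rewrite int_s// -(int_s g)//.
  have [] // := @dominated_convergence _ _ _ g setT measurableT
    (fun m => EFin \o s m) (EFin \o c) (EFin \o c).
  - by move=> m; apply/measurable_EFinP.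
  - apply: filterS ae_eq => z /fin_case[a [b [bE aE cE]]] _.
    apply/fine_cvgP; split; first by near=> m.
    rewrite /= cE /s bE aE /comp /=.
    by apply: cvgB; exact: trunc_cvg.
  - apply: filterS ae_eq => z /fin_case[a [b [bE aE cE]]] m _ /=.
    rewrite lee_fin ger0_norm ?sc// /s bE aE; apply: truncB_ge0.
    by have := c0 z; rewrite cE subr_ge0.
pose F := [set z | phi (p1 z) \is a fin_num /\ psi (p2 z) \is a fin_num].
have mF1 : measurable (phi @^-1` [set y | y \is a fin_num]).
  by rewrite -[X in measurable X]setTI; exact: emeasurable_fin_num.
have mF2 : measurable (psi @^-1` [set y | y \is a fin_num]).
  by rewrite -[X in measurable X]setTI; exact: emeasurable_fin_num.
have mF : measurable F.
  rewrite (_ : F = p1 @^-1` (phi @^-1` [set y | y \is a fin_num]) `&`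
    p2 @^-1` (psi @^-1` [set y | y \is a fin_num]))//.
  by apply: measurableI; rewrite -[X in measurable X]setTI; [exact: mp1|exact: mp2].
have F0 : g' (~` F) = 0%E.
  have FC : ~` F = p1 @^-1` (~` (phi @^-1` [set y | y \is a fin_num])) `|`
      p2 @^-1` (~` (psi @^-1` [set y | y \is a fin_num])).
    by rewrite -!preimage_setC -setCI.
  apply/eqP; rewrite -measure_le0 FC; apply: le_trans (measureU2 _ _ _) _.
  - by rewrite -[X in measurable X]setTI; apply: mp1 => //; exact: measurableC.
  - by rewrite -[X in measurable X]setTI; apply: mp2 => //; exact: measurableC.
  have null d (W : measurableType d) (P : probability W R) p (B : set W) :
      (forall A, measurable A -> g (p @^-1` A) = P A) ->
      (forall A, measurable A -> g' (p @^-1` A) = P A) -> measurable_fun setT p ->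
      measurable B -> p @^-1` B `<=` ~` [set z | (psi (p2 z) - phi (p1 z) = (c z)%:E)%E] ->
      g' (p @^-1` B) = 0%E.
    move=> gP gP' mp mB sB; rewrite gP'// -gP//; apply: measure_negligible.
      by rewrite -[X in measurable X]setTI; exact: mp.
    exact: negligibleS sB ae_eq.
  have n1 : g' (p1 @^-1` (~` phi @^-1` [set y | y \is a fin_num])) = 0%E.
    apply: (null _ _ _ _ _ g1 g1') => //; first exact: measurableC.
    by move=> z /= h /fin_case[a [b [_ aE _]]]; apply: h; rewrite aE.
  have n2 : g' (p2 @^-1` (~` psi @^-1` [set y | y \is a fin_num])) = 0%E.
    apply: (null _ _ _ _ _ g2 g2') => //; first exact: measurableC.
    by move=> z /= h /fin_case[a [b [bE _ _]]]; apply: h; rewrite bE.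
  by rewrite -[leRHS]adde0; apply: leeD; [rewrite -n1|rewrite -n2].
have E0 m z : (0 <= (c z - s m z)%:E)%E by rewrite lee_fin subr_ge0.
have mE m : measurable_fun setT (fun z => (c z - s m z)%:E).
  by apply/measurable_EFinP; exact: measurable_funB.
pose E z := ((c z)%:E - (psi (p2 z) - phi (p1 z)))%E.
have EF : (\int[g']_(z in F) E z <= 0)%E.
  rewrite (eq_integral (fun z => limn_einf (fun m => (c z - s m z)%:E))); last first.
    move=> z; rewrite inE /F/= => -[phif psif].
    have lim_ : ((c z - s m z)%:E @[m --> \oo] --> E z)%E.
      rewrite /E -(fineK phif) -(fineK psif) -!EFinB.
      apply/fine_cvgP; split; first by near=> m.
      rewrite /comp /=; apply: cvgB; first exact: cvg_cst.
      rewrite /s -(fineK phif) -(fineK psif).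
      by apply: cvgB; exact: trunc_cvg.
    by rewrite (cvg_limn_einf_sup lim_).1.
  apply: le_trans (fatou _ _ _ _) _ => //.
    by move=> m; apply: measurable_funTS; exact: mE.
  have cfin' : (\int[g']_z (c z)%:E)%E \is a fin_num by exact: integrable_fin_num gc'.
  have lim2 : (\int[g']_z (c z)%:E - \int[g']_z (s m z)%:E @[m --> \oo] -->
      \int[g']_z (c z)%:E - \int[g]_z (c z)%:E)%E.
    apply: cvgeB lim_s; last exact: cvg_cst.
    exact: fin_num_adde_defr.
  apply: (@le_trans _ _ (limn_einf (fun m => \int[g']_z (c z)%:E - \int[g']_z (s m z)%:E)%E)).
    apply: limn_einf_le => m.
    rewrite -integralB_EFin//; last exact: is_.
    under [leRHS]eq_integral do rewrite -EFinB.
    apply: ge0_subset_integral => //; exact: mE.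
  rewrite (cvg_limn_einf_sup lim2).1.
  by rewrite sube_le0.
have mE' : measurable_fun F E.
  apply: measurable_funTS; apply: emeasurable_funB => //; exact: emeasurable_funB.
have E_ge0 z : F z -> (0 <= E z)%E.
  move=> [Fp Fs]; rewrite /E -(fineK Fp) -(fineK Fs) -!EFinB lee_fin subr_ge0.
  by rewrite -lee_fin EFinB !fineK.
have [+ _] := ae_eq_integral_abs g' mF mE'.
case.
  have -> : (\int[g']_(z in F) `|E z| = \int[g']_(z in F) E z)%E.
    by apply: eq_integral => z; rewrite inE => Fz; rewrite gee0_abs// E_ge0.
  by apply/eqP; rewrite eq_le EF integral_ge0.
move=> B [mB B0 sB]; exists (B `|` ~` F); split.
- by apply: measurableU => //; exact: measurableC.
- apply/eqP; rewrite -measure_le0; apply: le_trans (measureU2 _ _ _) _ => //.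
    exact: measurableC.
  by rewrite -[leRHS]adde0; apply: leeD; [rewrite -B0|rewrite -F0].
- move=> z nz; have [Fz|] := pselect (F z); last by right.
  left; apply: sB => /= h; apply: nz; have := h Fz; rewrite /E.
  case: Fz => Fp Fs; rewrite -(fineK Fp) -(fineK Fs) -!EFinB /= => -[] /eqP.
  by rewrite subr_eq0 => /eqP ->; rewrite EFinB !fineK.
Unshelve. all: by end_near. Qed.

End calibration.

(** * Borel probabilities on Polish spaces *)

Section regularity.

Lemma regular_closed_nbhs (T : topologicalType) (x : T) (A : set T) :
  {for x, @regular_space T} -> nbhs x A ->
  exists B, [/\ nbhs x B, closed B & B `<=` A].
Proof.
move=> rx /rx[B nB BA]; exists (closure B); split => //; last exact: closed_closure.
exact: filterS (@subset_closure _ B) nB.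
Qed.

Lemma regular_prod (T U : topologicalType) :
  @regular_space T -> @regular_space U -> @regular_space (T * U)%type.
Proof.
move=> rT rU [x y] A [[B C] /= [nB nC] BCA].
have [B' [nB' cB' B'B]] := regular_closed_nbhs (rT x) nB.
have [C' [nC' cC' C'C]] := regular_closed_nbhs (rU y) nC.
exists (B' `*` C'); first by exists (B', C').
apply: (@subset_trans _ (B' `*` C')); last first.
  by move=> [a b] [/= ? ?]; apply: BCA; split => /=; [exact: B'B|exact: C'C].
have /closure_id <- // : closed (B' `*` C').
rewrite (_ : _ `*` _ = fst @^-1` B' `&` snd @^-1` C'); last by apply/seteqP; split.
by apply: closedI; apply: preimage_closed => // z _; [exact: cvg_fst|exact: cvg_snd].
Qed.

(** Each point of A has a closed neighbourhood inside A; by [lindelof] countably many of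
    them cover A. *)
Lemma open_Fsigma (T : topologicalType) (A : set T) :
  @second_countable T -> @regular_space T -> open A ->
  exists F : nat -> set T, (forall k, closed (F k)) /\ A = \bigcup_k F k.
Proof.
move=> scT rT oA.
have nF x : exists F, A x -> [/\ nbhs x F, closed F & F `<=` A].
  have [Ax|nAx] := pselect (A x); last by exists set0.
  have [F hF] := regular_closed_nbhs (rT x) (open_nbhs_nbhs (conj oA Ax)).
  by exists F.
have [F hF] := choice nF.
have [D [cD DA AD]] := @lindelof T A F scT (fun x Ax => let: And3 nx _ _ := hF x Ax in nx).
have /countable_injP[e einj] := cD.
have nG k : exists G, [/\ closed G, G `<=` A & forall y, D y -> e y = k -> F y `<=` G].
  have [[y [Dy ek]]|no] := pselect (exists y, D y /\ e y = k).
    have [_ cF FA] := hF _ (DA _ Dy); exists (F y); split => // y' Dy' ek'.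
    by rewrite (einj y y') ?inE// ek ek'.
  by exists set0; split => // [|y Dy ek]; [exact: closed0|case: no; exists y].
have [G hG] := choice nG.
exists G; split; first by move=> k; case: (hG k).
apply/seteqP; split => x.
  by move=> /AD[y Dy Fx]; exists (e y) => //; have [_ _ h] := hG (e y); exact: (h y).
by move=> [k _ Gx]; have [_ GA _] := hG k; exact: GA.
Qed.

End regularity.

Section closed_regular.
Context {R : realType} {T : ptopologicalType}.
Variable P : probability (borel T) R.
Hypothesis Fsigma : forall A : set T, open A ->
  exists F : nat -> set T, (forall k, closed (F k)) /\ A = \bigcup_k F k.

Lemma probability_setD_cvg (O : set (borel T)) (C : nat -> set (borel T)) (e : \bar R) :
  measurable O -> (forall k, measurable (C k)) ->
  (P (O `\` \bigcup_k C k) < e)%E ->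
  exists k, (P (O `\` \bigcup_(i < k) C i) < e)%E.
Proof.
move=> mO mC Pe.
have mF k : measurable (O `\` \bigcup_(i < k) C i).
  by apply: measurableD => //; exact: bigcup_measurable.
have E : \bigcap_k (O `\` \bigcup_(i < k) C i) = O `\` \bigcup_k C k.
  apply/seteqP; split => x.
    move=> h; split; first by case: (h 0%N I).
    by move=> [k _ Cx]; case: (h k.+1 I) => _; apply; exists k => //=.
  by move=> [Ox h] k _; split => // -[i _ Cx]; apply: h; exists i.
have cv : P (O `\` \bigcup_(i < k) C i) @[k --> \oo] --> P (O `\` \bigcup_k C k).
  rewrite -E; apply: nonincreasing_cvg_mu => //.
  - by rewrite (le_lt_trans (probability_le1 _ _))// ltry.
  - by rewrite E; apply: measurableD => //; exact: bigcup_measurable.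
  - move=> i j ij; apply/subsetPset => x [Ox h]; split => // -[k /= ki Cx].
    by apply: h; exists k => //=; exact: leq_trans ij.
have [k _ /(_ k (leqnn k))] : \forall k \near \oo, (P (O `\` \bigcup_(i < k) C i) < e)%E.
  by apply: (cv [set x | (x < e)%E]); apply: open_nbhs_nbhs; split => //; exact: open_ereal_lt_ereal.
by exists k.
Qed.

(** The sets that can be squeezed between a closed and an open set of almost the same
    measure form a sigma-algebra; it contains the open sets, which are F-sigma. *)
Lemma borel_approximation (B : set (borel T)) : measurable B ->
  forall e : R, 0 < e -> exists C O : set T,
    [/\ closed C, open O, C `<=` B, B `<=` O & (P (O `\` C) < e%:E)%E].
Proof.
move: B; apply: smallest_sub; last first.
  move=> A oA e e0; have [F [cF AF]] := Fsigma oA.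
  have := @probability_setD_cvg A F e%:E (open_borel oA) (fun k => closed_borel (cF k)).
  rewrite -AF setDv measure0 lte_fin => /(_ e0)[k hk].
  exists (\bigcup_(i < k) F i), A; split => //.
    by rewrite bigcup_mkord; apply: closed_bigsetU.
  by rewrite AF => x [i _ Fx]; exists i.
split.
- by move=> e e0; exists set0, set0; split; rewrite ?setD0 ?measure0 ?lte_fin//; [exact: closed0|exact: open0].
- move=> A hA e /hA[C [U [cC oO CA AO PCO]]].
  exists (~` U), (~` C); split; first exact: open_closedC.
  + exact: closed_openC.
  + by move=> x nUx; split => // /AO.
  + by move=> x [_ nAx] /CA.
  + by rewrite setDE setCK setIC -setDE.
- move=> A hA e e0.
  have {}hA k : exists CO : set T * set T, [/\ closed CO.1, open CO.2, CO.1 `<=` A k,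
      A k `<=` CO.2 & (P (CO.2 `\` CO.1) < (e / 2 / (2 ^ k.+1)%:R)%:E)%E].
    have ek : 0 < e / 2 / (2 ^ k.+1)%:R by rewrite !divr_gt0// ltr0n expn_gt0.
    by have [C [U h]] := hA k _ ek; exists (C, U).
  have [CO hCO] := choice hA.
  have cC k : closed (CO k).1 by case: (hCO k).
  have oO k : open (CO k).2 by case: (hCO k).
  have oU : open (\bigcup_k (CO k).2) by exact: bigcup_open.
  have [k hk] : exists k, (P (\bigcup_k (CO k).2 `\` \bigcup_(i < k) (CO i).1) < e%:E)%E.
    apply: (@probability_setD_cvg (\bigcup_k (CO k).2) (fun k => (CO k).1)).
    - exact: open_borel.
    - by move=> k; exact: closed_borel.
    apply: (@le_lt_trans _ _ (e / 2)%:E); last by rewrite lte_fin; lra.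
    pose D k : set (borel T) := (CO k).2 `\` (CO k).1.
    apply: (@le_trans _ _ (\sum_(k <oo) P (D k))%E).
      apply: measure_sigma_subadditive.
      + by move=> k; apply: measurableD; [exact: open_borel|exact: closed_borel].
      + apply: measurableD; first exact: open_borel.
        by apply: bigcup_measurable => k _; exact: closed_borel.
      + by move=> x [[k _ Ox] nC]; exists k => //; split => // Cx; apply: nC; exists k.
    apply: le_trans (epsilon_trick0 xpredT _); last by rewrite divr_ge0// ltW.
    by apply: lee_nneseries => // k _; case: (hCO k) => _ _ _ _ /ltW.
  exists (\bigcup_(i < k) (CO i).1), (\bigcup_k (CO k).2); split => //.
  + by rewrite bigcup_mkord; apply: closed_bigsetU.
  + by move=> x [i _ Cx]; exists i => //; case: (hCO i) => _ _ h _ _; exact: h.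
  + by move=> x [i _ Ax]; exists i => //; case: (hCO i) => _ _ _ h _; exact: h.
Qed.

Lemma closed_regular (B : set (borel T)) (e : R) : measurable B -> 0 < e ->
  exists C : set T, [/\ closed C, C `<=` B & (P (B `\` C) < e%:E)%E].
Proof.
move=> mB e0; have [C [U [cC oU CB BU PCU]]] := borel_approximation mB e0.
exists C; split => //; apply: le_lt_trans PCU; apply: le_measure.
- by rewrite inE; apply: measurableD => //; exact: closed_borel.
- by rewrite inE; apply: measurableD; [exact: open_borel|exact: closed_borel].
- by move=> x [/BU ? ?].
Qed.

End closed_regular.

Lemma countable_enum (T : pointedType) (D : set T) : countable D ->
  exists u : nat -> T, D `<=` range u.
Proof.
move=> /countable_injP[e einj].
exists (fun k => xget point [set y | D y /\ e y = k]) => y Dy.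
exists (e y) => //; case: xgetP => [z _ [Dz ezy]|/(_ y)[]//].
by apply: einj; rewrite ?inE.
Qed.

Lemma ultra_bigcup (T : Type) (F : set_system T) (A : nat -> set T) k :
  UltraFilter F -> F (\bigcup_(i < k) A i) -> exists i, F (A i).
Proof.
move=> FU; elim: k => [|k IH] FA.
  have [x [i]] : \bigcup_(i < 0) A i !=set0 by exact: filter_ex FA.
  by [].
have [FAk|FnAk] := in_ultra_setVsetC (A k) FU; first by exists k.
apply: IH; apply: filterS2 FA FnAk => x [i /= ik Aix] nAkx; exists i => //=.
by move: ik; rewrite ltnS leq_eqVlt => /orP[/eqP ik|//]; rewrite -ik in nAkx.
Qed.

Section polish.
Context {R : realType} {N : ptopologicalType}.
Hypothesis polishN : polish_space R N.

Lemma polish_regular : @regular_space N.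
Proof.
have [_ [d [d0 dC dD nb _]]] := polishN => a A /nb[e e0 eA].
have e2 : 0 < e / 2 by rewrite divr_gt0.
exists [set y | d a y < e / 2]; first by apply/nb; exists (e / 2).
move=> y /(_ [set z | d y z < e / 2])[|z [/= az yz]]; first by apply/nb; exists (e / 2).
by apply: eA; rewrite /= (le_lt_trans (dD _ z _))// (dC z) (splitr e) ltrD.
Qed.

(** The balls of radii 1 / (k + 1) around the points of a dense countable set. *)
Lemma polish_second_countable : @second_countable N.
Proof.
have [[D cD dense_D] [d [d0 dC dD nb _]]] := polishN.
have ball_nbhs x (e : R) : 0 < e -> nbhs x [set y | d x y < e].
  by move=> e0; apply/nb; exists e.
exists ((fun p : N * nat => interior [set y | d p.1 y < p.2.+1%:R^-1 :> R]) @` (D `*` setT)).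
  by apply: countable_image; exact: countableX.
split; first by move=> _ [p _ <-]; exact: open_interior.
move=> x A /nb[e e0 eA].
have [k ke] : exists k, k.+1%:R^-1 < e / 2 by apply: exists_invS_lt; rewrite divr_gt0.
have k0 : 0 < k.+1%:R^-1 :> R by [].
have k2 : 0 < k.+1%:R^-1 / 2 :> R by rewrite divr_gt0.
have [y [xy Dy]] : interior [set y | d x y < k.+1%:R^-1 / 2] `&` D !=set0.
  by apply: dense_D; [exists x; exact: ball_nbhs|exact: open_interior].
have {}xy : d x y < k.+1%:R^-1 / 2 by exact: (interior_subset xy).
exists (interior [set z | d y z < k.+1%:R^-1]); first split.
- by exists (y, k).
- apply: filterS (ball_nbhs x _ k2) => z /= xz.
  by rewrite (le_lt_trans (dD _ x _))// (dC y) [ltRHS]splitr ltrD.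
- move=> z /interior_subset /= yz; apply: eA; rewrite /= (le_lt_trans (dD _ y _))//.
  rewrite (splitr e) ltrD//; last exact: lt_trans ke.
  by move: ke k0 xy; move: (k.+1%:R^-1) (d x y) => q r; lra.
Qed.

(** Ulam's theorem. For each k finitely many closed balls of radius 1 / (k + 1) carry all
    the mass but e / 2^(k+2), and K is the intersection over k of their unions. An
    ultrafilter on K contains one of these balls for each k. Points chosen in the
    intersections of the first k + 1 of them form a Cauchy sequence, whose limit is
    also that of the ultrafilter. *)
Lemma polish_tight (P : probability (borel N) R) (e : R) : 0 < e ->
  exists K : set N, [/\ compact K, closed K & (P (~` K) < e%:E)%E].
Proof.
move=> e0; have [[D cD dense_D] [d [d0 dC dD nb cplt]]] := polishN.
have [u Du] := countable_enum cD.
pose cb k i := [set z | d (u i) z <= k.+1%:R^-1].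
have cb_closed k i : closed (cb k i).
  move=> z clz; rewrite /cb/=; apply/ler_addgt0Pr => r r0.
  have [y [/= uy zy]] : cb k i `&` [set y | d z y < r] !=set0.
    by apply: clz; apply/nb; exists r.
  by rewrite (le_trans (dD _ y _))// lerD// dC ltW.
have cbT k : \bigcup_i cb k i = setT.
  apply/seteqP; split => // z _.
  have [y [zy /Du[i _ iy]]] : interior [set y | d z y < k.+1%:R^-1] `&` D !=set0.
    apply: dense_D; last exact: open_interior.
    by exists z; apply/nb; exists k.+1%:R^-1.
  by exists i => //; rewrite /cb/= iy dC ltW//; exact: (interior_subset zy).
have nP k : exists m, (P (setT `\` \bigcup_(i < m) cb k i) < (e / 2 / (2 ^ k.+1)%:R)%:E)%E.
  apply: (@probability_setD_cvg R N P setT (cb k)).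
  - exact: measurableT.
  - by move=> i; exact: closed_borel.
  - by rewrite cbT setDv measure0 lte_fin !divr_gt0// ltr0n expn_gt0.
have [m hm] := choice nP.
pose L k := \bigcup_(i < m k) cb k i.
have cL k : closed (L k) by rewrite /L bigcup_mkord; exact: closed_bigsetU.
have cK : closed (\bigcap_k L k) by exact: closed_bigI.
exists (\bigcap_k L k); split => //; last first.
  apply: (@le_lt_trans _ _ (e / 2)%:E); last by rewrite lte_fin; lra.
  apply: (@le_trans _ _ (\sum_(k <oo) P (setT `\` L k))%E).
    apply: measure_sigma_subadditive.
    - by move=> k; rewrite setTD; apply: measurableC; exact: closed_borel.
    - by apply: measurableC; exact: closed_borel.
    - by rewrite setC_bigcap => z [k _ nL]; exists k.
  apply: le_trans (epsilon_trick0 xpredT _); last by rewrite divr_ge0// ltW.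
  by apply: lee_nneseries => // k _; rewrite ltW// hm.
rewrite compact_ultra => F FU FK.
have nI k : exists i, F (cb k i).
  by apply: (@ultra_bigcup _ F (cb k) (m k)); apply: filterS FK => z; exact.
have [I FI] := choice nI.
have nv k : exists v, forall j, (j <= k)%N -> cb j (I j) v.
  apply: (@filter_ex _ F) => //; elim: k => [|k IH].
    by apply: filterS (FI 0%N) => z z0 j; rewrite leqn0 => /eqP ->.
  apply: filterS2 IH (FI k.+1) => z IH zk j; rewrite leq_eqVlt => /orP[/eqP -> //|].
  by rewrite ltnS => /IH.
have [v hv] := choice nv.
have d_cb k x y : cb k (I k) x -> cb k (I k) y -> d x y <= k.+1%:R^-1 + k.+1%:R^-1.
  by move=> h1 h2; rewrite (le_trans (dD _ (u (I k)) _))// lerD// dC.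
have [l vl] : exists l : N, v @ \oo --> l.
  apply: cplt => r r0; have [k kr] := exists_invS_lt (divr_gt0 r0 (ltr0n _ 2)).
  exists k => i j ki kj; apply: (le_lt_trans (d_cb k _ _ (hv i k ki) (hv j k kj))).
  by rewrite (splitr r) ltrD.
have Fl : F --> l.
  move=> A /nb[r r0 rA]; have r4 : 0 < r / 4 by rewrite divr_gt0.
  have [k kr] := exists_invS_lt r4.
  have [j kj lj] : exists2 j, (k <= j)%N & d l (v j) < r / 4.
    have [j0 _ hj0] : \forall j \near \oo, d l (v j) < r / 4.
      by apply: (vl [set y | d l y < r / 4]); apply/nb; exists (r / 4).
    by exists (maxn k j0); [exact: leq_maxl|apply: hj0; exact: leq_maxr].
  apply: filterS (FI k) => z zk; apply: rA; rewrite /= (le_lt_trans (dD _ (v j) _))//.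
  have := d_cb k _ _ (hv j k kj) zk; move: kr lj.
  by move: (k.+1%:R^-1) (d l (v j)) (d (v j) z) => q s t; lra.
exists l; split => //; apply: cK => A /Fl FA.
by apply: (@filter_ex _ F); exact: filterI.
Qed.

End polish.

(** * Maps whose graph carries a plan *)

(** A point adherent to the projection defines a filter on K, generated by the sections of
    C over its neighbourhoods; a cluster point of this filter lies over it. *)
Lemma closed_projection (M N : topologicalType) (C : set (M * N)) (K : set N) :
  closed C -> compact K -> closed [set x | exists2 y, K y & C (x, y)].
Proof.
move=> cC cK x clx.
pose F := [set B : set N | exists2 U, nbhs x U & forall x' y, U x' -> K y -> C (x', y) -> B y].
have FF : ProperFilter F.
  split.
    move=> [U nU h]; have [x' [[y Ky Cxy] Ux']] := clx _ nU.
    exact: h Ux' Ky Cxy.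
  split.
  - by exists setT; first exact: filterT.
  - move=> A B [U nU hU] [V nV hV]; exists (U `&` V); first exact: filterI.
    by move=> x' y [Ux Vx] Ky Cy; split; [exact: hU Ux Ky Cy|exact: hV Vx Ky Cy].
  - by move=> A B AB [U nU hU]; exists U => // x' y Ux Ky Cy; apply: AB; exact: hU Ux Ky Cy.
have FK : F K by exists setT; first exact: filterT.
have [y [Ky cly]] := cK F FF FK.
exists y => //; apply: cC => W [[U V] /= [nU nV] UVW].
have [y' [[x' [[Ux' Ky'] Cxy']] Vy']] := cly [set y | exists x', (U x' /\ K y) /\ C (x', y)] V
  (ex_intro2 _ _ U nU (fun x' y Ux Ky Cy => ex_intro _ x' (conj (conj Ux Ky) Cy))) nV.
by exists (x', y'); split => //; apply: UVW.
Qed.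

(** Closed balls of a chart are compact neighbourhoods, and Hausdorff spaces are regular
    at the points that have a compact neighbourhood. *)
Lemma chart_regular (R : realType) (n : nat) (M : ptopologicalType) (th : chart R n M) x :
  hausdorff_space M -> dom th x -> {for x, @regular_space M}.
Proof.
move=> hM dx; have cz : Defs.codom th (th x) by exists x.
have /nbhs_ballP[e /= e0 ball_codom] := open_nbhs_nbhs (conj (@open_codom R n M th) cz).
have e2 : 0 < e / 2 by rewrite divr_gt0.
pose K : set 'rV[R]_n := closed_ball_ Num.norm (th x) (e / 2).
have K_codom : K `<=` Defs.codom th.
  move=> z; rewrite /K /closed_ball_/= => h; apply: ball_codom.
  by rewrite -ball_normE /= (le_lt_trans h)// ltr_pdivrMr//; lra.
have cK : compact K.
  apply: bounded_closed_compact; last by rewrite /K -closed_ballE//; exact: closed_ball_closed.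
  exists (`|th x| + e / 2); split; first exact: num_real.
  move=> r hr z; rewrite /K /closed_ball_/= => h.
  rewrite (le_trans _ (ltW hr))// -[z](subrKC (th x)) (le_trans (ler_normD _ _))// lerD2l.
  by rewrite distrC.
apply: (@compact_regular _ _ (cinv th @` K)) => //.
  apply: continuous_compact => //; apply: continuous_in_subspaceT => z.
  by rewrite inE => /K_codom; exact: cinv_continuous.
have nd := open_nbhs_nbhs (conj (open_dom th) dx).
have nb : nbhs x (th @^-1` ball (th x) (e / 2)).
  by apply: (continuous_cmap dx); exact: nbhsx_ballx.
apply: filterS2 nd nb => y dy /=; rewrite -ball_normE /= => h.
by exists (th y); [exact: ltW|exact: cmapK].
Qed.

Section graph.
Context {R : realType} {M N : ptopologicalType}.
Variables (mu : probability (borel M) R) (nu : probability (borel N) R).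
Hypotheses (scM : @second_countable M) (rM : @regular_space M).
Hypothesis polishN : polish_space R N.

Lemma measurable_fst_borel :
  measurable_fun setT (fst : borel (M * N)%type -> borel M).
Proof. by apply: (@continuous_borel (M * N)%type M setT fst) => //; [exact: openT|move=> z _; exact: cvg_fst]. Qed.

Lemma measurable_snd_borel :
  measurable_fun setT (snd : borel (M * N)%type -> borel N).
Proof. by apply: (@continuous_borel (M * N)%type N setT snd) => //; [exact: openT|move=> z _; exact: cvg_snd]. Qed.

(** Up to null sets G is a countable union of closed sets C_k, each considered over a
    compact subset K_k of N. By [closed_projection] the points that T sends to a closed
    set B form on A the countable union of the closed sets P k B; outside A the map is
    constant. *)
Lemma graph_map (g : probability (borel (M * N)%type) R) (G : set (borel (M * N)%type)) :
  is_plan mu nu g -> measurable G -> g G = 1%E ->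
  (forall x y y', G (x, y) -> G (x, y') -> y = y') ->
  exists (T : borel M -> borel N) (A : set (borel M)),
    [/\ measurable_fun setT T, measurable A, mu A = 1%E & forall x, A x -> G (x, T x)].
Proof.
move=> [g1 g2] mG gG funG.
have FsMN : forall A : set (M * N)%type, open A ->
    exists F : nat -> set (M * N)%type, (forall k, closed (F k)) /\ A = \bigcup_k F k.
  move=> A; apply: open_Fsigma; last exact: regular_prod (polish_regular polishN).
  exact: second_countable_prod scM (polish_second_countable polishN).
have pos k : 0 < k.+1%:R^-1 :> R by [].
have nC k : exists C : set (M * N)%type,
    [/\ closed C, C `<=` G & (g (G `\` C) < (k.+1%:R^-1)%:E)%E].
  exact: closed_regular.
have [C hC] := choice nC.
have nK k := polish_tight polishN nu (pos k).
have [K hK] := choice nK.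
have cC k : closed (C k) by case: (hC k).
have cK k : closed (K k) by case: (hK k).
pose P k (B : set N) := [set x | exists2 y, K k y & (C k `&` snd @^-1` B) (x, y)].
have cP k B : closed B -> closed (P k B).
  move=> cB; apply: closed_projection; last by case: (hK k).
  by apply: closedI => //; apply: preimage_closed => // z _; exact: cvg_snd.
pose A := \bigcup_k P k setT.
have mP k (B : set N) : closed B -> measurable (P k B : set (borel M)).
  by move=> cB; apply: closed_borel; exact: cP.
have mA : measurable (A : set (borel M)).
  by apply: bigcup_measurable => k _; apply: mP; exact: closedT.
pose T x := xget point [set y | exists k, K k y /\ C k (x, y)].
have TE x k y : K k y -> C k (x, y) -> T x = y.
  move=> Ky Cy; rewrite /T; case: xgetP => [z _ [j [_ Cz]]|/(_ y)[]]; last by exists k.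
  by apply: (funG x); [case: (hC j) => _ h _; exact: h|case: (hC k) => _ h _; exact: h].
have TA x : A x -> G (x, T x).
  move=> [k _ [y Ky [Cy _]]]; rewrite (TE _ _ _ Ky Cy).
  by case: (hC k) => _ h _; exact: h.
have TP (B : set N) : A `&` T @^-1` B = \bigcup_k P k B.
  apply/seteqP; split => x.
    move=> [[k _ [y Ky [Cy _]]] /=]; rewrite (TE _ _ _ Ky Cy) => By.
    by exists k => //; exists y.
  move=> [k _ [y Ky [Cy By]]]; split; first by exists k => //; exists y.
  by rewrite /= (TE _ _ _ Ky Cy).
exists T, A; split => //.
- apply: measurable_fun_borel => U oU; rewrite setTI.
  have mCA : measurable (~` A `&` T @^-1` U : set (borel M)).
    have [pU|npU] := pselect (U point).
      rewrite (_ : _ `&` _ = ~` A); first exact: measurableC.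
      apply/seteqP; split => x; first by case.
      move=> nAx; split => //=; rewrite /T; case: xgetP => [z _ [k [Kz Cz]]|//].
      by case: nAx; exists k => //; exists z.
    rewrite (_ : _ `&` _ = set0)//; apply/seteqP; split => // x [nAx] /=.
    rewrite /T; case: xgetP => [z _ [k [Kz Cz]]|//].
    by case: nAx; exists k => //; exists z.
  rewrite (_ : _ @^-1` _ = (A `\` (A `&` T @^-1` (~` U))) `|` (~` A `&` T @^-1` U)).
    apply: measurableU => //; apply: measurableD => //; rewrite TP.
    apply: bigcup_measurable => k _; apply: mP; exact: open_closedC.
  apply/seteqP; split => x /=; last by case=> [[Ax h]|[]//]; apply: contrapT => nU; apply: h.
  move=> Ux; have [Ax|nAx] := pselect (A x); last by right.
  by left; split => // -[_]; apply.
- apply/eqP; rewrite eq_le probability_le1//= -g1//.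
  apply/lee_addgt0Pr => e e0; have [k ke] := exists_invS_lt (divr_gt0 e0 (ltr0n _ 2)).
  have mf : measurable (fst @^-1` A : set (borel (M * N)%type)).
    by rewrite -[X in measurable X]setTI; exact: measurable_fst_borel.
  have mS : measurable (snd @^-1` (~` K k) : set (borel (M * N)%type)).
    rewrite -[X in measurable X]setTI; apply: measurable_snd_borel => //.
    by apply: measurableC; exact: closed_borel.
  have mD : measurable (G `\` C k : set (borel (M * N)%type)).
    by apply: measurableD => //; exact: closed_borel.
  rewrite -gG; apply: (@le_trans _ _ (g (fst @^-1` A `|` (G `\` C k `|` snd @^-1` (~` K k))))).
    apply: le_measure; rewrite ?inE//; first by do 2 apply: measurableU => //.
    move=> [x y] Gxy; have [Cxy|] := pselect (C k (x, y)); last by right; left.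
    have [Ky|] := pselect (K k y); last by right; right.
    by left; exists k => //; exists y.
  apply: le_trans (measureU2 _ _ _) _ => //; first exact: measurableU.
  rewrite leeD2l//; apply: le_trans (measureU2 _ _ _) _ => //.
  rewrite (splitr e) EFinD; apply: leeD.
    by case: (hC k) => _ _ /ltW/le_trans; apply; rewrite lee_fin ltW.
  apply: (@le_trans _ _ (nu (~` K k))).
    by rewrite -(g2 _ (measurableC (closed_borel (cK k)))).
  by case: (hK k) => _ _ /ltW/le_trans; apply; rewrite lee_fin ltW.
Qed.

End graph.

(** * Optimal plans and optimal maps *)

Section probability_facts.
Context {R : realType} {d : measure_display} {X : measurableType d}.
Variable P : probability X R.

Lemma ae_of_full (A : set X) (Q : X -> Prop) : measurable A -> P A = 1%E ->
  (forall x, A x -> Q x) -> {ae P, forall x, Q x}.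
Proof.
move=> mA PA AQ; exists (~` A); split; first exact: measurableC.
- by have := probability_setC P mA; rewrite PA subee.
- by move=> x /= nQ Ax; exact/nQ/AQ.
Qed.

Lemma full_of_ae (A : set X) : measurable A -> {ae P, forall x, A x} -> P A = 1%E.
Proof.
move=> mA [B [mB B0 AB]].
have /eqP : P (~` A) = 0%E.
  by apply: (@subset_measure0 _ _ _ P _ B) => //; exact: measurableC.
rewrite (_ : P (~` A) = (1 - P A)%E); last exact: probability_setC.
have : P A \is a fin_num by exact: fin_num_measure.
by case: (P A) => // r _; rewrite -EFinB eqe subr_eq0 => /eqP <-.
Qed.

Lemma full_setI (A B : set X) : measurable A -> measurable B ->
  P A = 1%E -> P B = 1%E -> P (A `&` B) = 1%E.
Proof.
move=> mA mB PA PB; apply: full_of_ae; first exact: measurableI.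
have hA := ae_of_full mA PA (fun x Ax => Ax).
have hB := ae_of_full mB PB (fun x Bx => Bx).
by apply: filterS2 hA hB => x.
Qed.

Lemma measure_full_eq (A B C : set X) : measurable A -> measurable B -> measurable C ->
  P A = 1%E -> B `&` A = C `&` A -> P B = P C.
Proof.
move=> mA mB mC PA BC.
have PI (D : set X) : measurable D -> P D = P (D `&` A).
  move=> mD; rewrite -[in LHS](setUIDK D A).
  rewrite measureU//; [|exact: measurableI|exact: measurableD|].
    rewrite -[RHS]adde0; congr (_ + _)%E.
    apply: (@subset_measure0 _ _ _ P _ (~` A)) => //; [exact: measurableD|exact: measurableC|].
    by have := probability_setC P mA; rewrite PA subee.
  by rewrite setDE setIACA setICr setI0.
by rewrite PI// BC -PI.
Qed.

Lemma integrable_bounded_below (f : X -> R) (b : R) : measurable_fun setT f ->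
  (forall x, b <= f x) -> (\int[P]_x (f x)%:E < +oo)%E ->
  P.-integrable setT (EFin \o f).
Proof.
move=> mf bf fin.
have mfE : measurable_fun setT (EFin \o f) by exact/measurable_EFinP.
have neg_fin : (\int[P]_x (EFin \o f)^\- x < +oo)%E.
  apply: (@le_lt_trans _ _ (\int[P]_x (Num.max 0 (- b))%:E)%E).
    apply: ge0_le_integral => //.
    - exact: measurable_funeneg.
    - by move=> x _; rewrite funenegE /= -EFin_max lee_fin ge_max !le_max lexx lerN2 bf orbT.
  rewrite integral_cst// lte_mul_pinfty ?lee_fin ?le_max ?lexx//.
  by rewrite (le_lt_trans (probability_le1 _ _))// ltry.
apply/integrableP; split => //.
rewrite (_ : \int[P]_x `|(EFin \o f) x| = \int[P]_x ((EFin \o f)^\+ x + (EFin \o f)^\- x))%E; last first.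
  by apply: eq_integral => x _; rewrite -[LHS]/((abse \o (EFin \o f)) x) fune_abse.
rewrite ge0_integralD//; [|exact: measurable_funepos|exact: measurable_funeneg].
apply: lte_add_pinfty => //; rewrite integralE in fin.
move: fin; have := neg_fin; have : (0 <= \int[P]_x (EFin \o f)^\- x)%E by exact: integral_ge0.
case: (\int[P]_x (EFin \o f)^\- x)%E => // r _ _.
by case: (\int[P]_x (EFin \o f)^\+ x)%E => //= *; rewrite ?ltry.
Qed.

End probability_facts.

(** The integral is the difference of the integrals of the positive and negative parts,
    to each of which the change of variables applies. *)
Lemma integral_pushforward_measurable d1 d2 (X : measurableType d1)
    (Y : measurableType d2) (R : realType) (p : X -> Y) (m : measure X R)
    (m' : measure Y R) (f : Y -> \bar R) :
  measurable_fun setT p -> (forall A, measurable A -> m (p @^-1` A) = m' A) ->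
  measurable_fun setT f -> (\int[m]_x f (p x) = \int[m']_y f y)%E.
Proof.
move=> mp mm' mf.
rewrite -(@eq_measure_integral _ _ _ _ m' (pushforward m p) f); last first.
  by move=> A mA _; exact: mm'.
rewrite [LHS]integralE [RHS]integralE; congr (_ - _)%E.
- rewrite (@ge0_integral_pushforward _ _ X Y R p mp m setT (f^\+)%E)//.
    by rewrite preimage_setT; apply: eq_integral => x _; rewrite /= !funeposE.
  exact: measurable_funepos.
- rewrite (@ge0_integral_pushforward _ _ X Y R p mp m setT (f^\-)%E)//.
    by rewrite preimage_setT; apply: eq_integral => x _; rewrite /= !funenegE.
  exact: measurable_funeneg.
Qed.

Lemma ae_imply (R : realType) d (X : measurableType d) (P : probability X R)
    (A B : X -> Prop) :
  (forall x, A x -> B x) -> {ae P, forall x, A x} -> {ae P, forall x, B x}.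
Proof. by move=> AB; apply: negligibleS => x /= nB /AB. Qed.

Section optimal_transport.
Context {R : realType} {M N : ptopologicalType}.
Variables (mu : probability (borel M) R) (nu : probability (borel N) R).
Variable c : M * N -> R.
Hypotheses (scM : @second_countable M) (scN : @second_countable N).
Hypothesis c_lsc : lower_semicontinuous (fun z => (c z)%:E).

Lemma measurable_cost : measurable_fun setT (c : borel (M * N)%type -> R).
Proof.
apply: (measurability _ (RGenOInfty.measurableE R)) => _ [_ [a ->] <-].
apply: measurableI => //; rewrite preimage_itvoy; apply: open_borel.
have /lower_semicontinuousP/(_ a) := c_lsc.
rewrite (_ : [set x | (a%:E < (c x)%:E)%E] = [set x | a < c x])//.
Qed.

Lemma measurable_graph (T : borel M -> borel N) : measurable_fun setT T ->
  measurable_fun setT ((fun x => (x, T x)) : borel M -> borel (M * N)%type).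
Proof.
move=> mT; apply: (@measurable_pair_borel _ (borel M) M N setT id T) => //.
Qed.

(** The image of mu by x |-> (x, T x). *)
Lemma graph_plan (T : borel M -> borel N) : is_transport_map mu nu T ->
  exists g : probability (borel (M * N)%type) R,
    [/\ is_plan mu nu g, plan_cost c g = map_cost mu c T &
        forall B : set (borel (M * N)%type), measurable B -> g B = mu [set x | B (x, T x)]].
Proof.
move=> [mT Tnu]; have mG := measurable_graph mT.
pose G : {mfun borel M >-> borel (M * N)%type} := mfun_Sub (mem_set mG).
have GE x : G x = (x, T x) by [].
exists (distribution mu G); split.
- by split => [A mA|B mB]; rewrite /distribution/pushforward; [|rewrite -Tnu].
- rewrite /plan_cost /map_cost; apply/esym.
  apply: (integral_pushforward_measurable mG) => //.
  by apply/measurable_EFinP; exact: measurable_cost.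
- by [].
Qed.

Variable b : R.
Hypothesis c_ge : forall z, b <= c z.
Hypothesis cost_finite : ereal_inf [set plan_cost c g | g in is_plan mu nu] \is a fin_num.
Variables (phi : M -> \bar R) (psi : N -> \bar R).
Hypothesis sub : c_subsolution c phi psi.
Hypothesis mphi : measurable_fun setT (phi : borel M -> \bar R).
Hypothesis mpsi : measurable_fun setT (psi : borel N -> \bar R).

Definition contact : set (borel (M * N)%type) :=
  [set z | (psi z.2 - phi z.1 = (c z)%:E)%E].

Lemma measurable_contact : measurable contact.
Proof.
have m1 : measurable_fun setT (fun z : borel (M * N)%type => phi z.1).
  by apply: (measurableT_comp mphi); exact: measurable_fst_borel.
have m2 : measurable_fun setT (fun z : borel (M * N)%type => psi z.2).
  by apply: (measurableT_comp mpsi); exact: measurable_snd_borel.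
rewrite (_ : contact = setT `&` [set z | (psi z.2 - phi z.1 = (c z)%:E)%E]); last by rewrite setTI.
apply: emeasurable_fun_eq => //; first exact: emeasurable_funB.
by apply/measurable_EFinP; exact: measurable_cost.
Qed.

Variable g : probability (borel (M * N)%type) R.
Hypothesis g_opt : is_optimal_plan mu nu c g.
Hypothesis g_contact : {ae g, forall z, contact z}.

Lemma optimal_cost_finite : (plan_cost c g < +oo)%E.
Proof.
apply: le_lt_trans (ltry (fine (ereal_inf [set plan_cost c g | g in is_plan mu nu]))).
rewrite fineK//; apply: le_ereal_inf_tmp => _ [g' g'P <-].
by case: g_opt => _; exact.
Qed.

(** [calibrated_coupling], after subtraction of the lower bound b from c and psi. *)
Lemma contact_of_cost (g' : probability (borel (M * N)%type) R) : is_plan mu nu g' ->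
  (plan_cost c g' <= plan_cost c g)%E -> g' contact = 1%E.
Proof.
move=> g'P le; apply: full_of_ae; first exact: measurable_contact.
have gfin := optimal_cost_finite; have mc := measurable_cost.
have int (h : probability (borel (M * N)%type) R) : (plan_cost c h < +oo)%E ->
    (\int[h]_z (c z - b)%:E = plan_cost c h - b%:E)%E.
  move=> hfin; rewrite /plan_cost; have ic := integrable_bounded_below mc c_ge hfin.
  under eq_integral => z _ do rewrite EFinB.
  rewrite (@integralB_EFin _ _ _ h setT c (cst b))//; last exact: finite_measure_integrable_cst.
  congr (_ - _)%E; rewrite -[LHS]/(\int[h]_x (cst b%:E x))%E integral_cst// -[RHS]mule1.
  by congr (_ * _)%E; exact: probability_setT.
have g'fin := le_lt_trans le gfin.
have [subx suby subxy] := sub.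
pose psib y := (psi y - b%:E)%E.
have shift z : (psib z.2 - phi z.1 = (psi z.2 - phi z.1) - b%:E)%E by rewrite /psib addeAC.
have shiftE (x : \bar R) (r : R) : (x - b%:E = (r - b)%:E)%E <-> x = r%:E.
  split=> [|->//]; case: x => [x||] //; rewrite -EFinB => -[] /eqP.
  by rewrite -subr_eq0 opprB addrA subrK subr_eq0 => /eqP ->.
have := @calibrated_coupling R _ _ _ (borel M) (borel N) (borel (M * N)%type) mu nu fst snd
  measurable_fst_borel measurable_snd_borel g g' (fun z => c z - b) phi psib g_opt.1 g'P.
have -> : (\int[g]_z (c z - b)%:E = plan_cost c g - b%:E)%E by exact: int.
have -> : (\int[g']_z (c z - b)%:E = plan_cost c g' - b%:E)%E by exact: int.
move=> H; have {H} : {ae g', forall z, (psib z.2 - phi z.1 = (c z - b)%:E)%E}.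
  apply: H => //.
  - exact: measurable_funB.
  - by move=> z; rewrite subr_ge0.
  - exact: emeasurable_funB.
  - by move=> y; have := suby y; rewrite /psib; case: (psi y).
  - by move=> [x y]; rewrite shift EFinB leeD2r.
  - by apply: ae_imply g_contact => z; rewrite shift => /shiftE.
  - by move: gfin; case: (plan_cost c g) => // r _; rewrite ltry.
  - exact: leeD2r.
by apply: ae_imply => z; rewrite shift => /shiftE.
Qed.

Hypotheses (rM : @regular_space M) (polishN : polish_space R N).
Variable G0 : set (borel M).
Hypotheses (mG0 : measurable G0) (muG0 : mu G0 = 1%E).
Hypothesis fun_contact : forall x y y', G0 x -> contact (x, y) -> contact (x, y') -> y = y'.

(** Over the points of G0 the contact set has full g-measure and is contained in a graph,
    which is that of the map T of [graph_map]. As z.2 = T z.1 for g-almost every z, the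
    map T inherits the marginal nu and the cost from g. *)
Lemma contact_map : exists2 T, is_transport_map mu nu T & map_cost mu c T = plan_cost c g.
Proof.
have [[g1 g2] gmin] := g_opt.
have mcontact := measurable_contact.
have mfst0 : measurable (fst @^-1` G0 : set (borel (M * N)%type)).
  by rewrite -[X in measurable X]setTI; exact: measurable_fst_borel.
pose G : set (borel (M * N)%type) := contact `&` fst @^-1` G0.
have mG : measurable G by exact: measurableI.
have gG : g G = 1%E.
  by apply: full_setI => //; [exact: full_of_ae|rewrite -muG0; exact: g1].
have [T [A [mT mA muA AG]]] : exists (T : borel M -> borel N) (A : set (borel M)),
    [/\ measurable_fun setT T, measurable A, mu A = 1%E & forall x, A x -> G (x, T x)].
  apply: graph_map g_opt.1 mG gG _ => // x y y' [h1 /= Gx] [h2 _].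
  exact: fun_contact h1 h2.
pose E : set (borel (M * N)%type) := G `&` fst @^-1` A.
have mfstA : measurable (fst @^-1` A : set (borel (M * N)%type)).
  by rewrite -[X in measurable X]setTI; exact: measurable_fst_borel.
have mE : measurable E by exact: measurableI.
have gE : g E = 1%E.
  by apply: full_setI => //; rewrite -muA; exact: g1.
have ET z : E z -> z.2 = T z.1.
  case: z => x y [[h1 /= Gx] /AG[h2 _]]; exact: fun_contact h1 h2.
exists T.
  split => // B mB; rewrite -(g2 _ mB).
  have mTB : measurable (T @^-1` B) by rewrite -[X in measurable X]setTI; exact: mT.
  rewrite -(g1 _ mTB); apply: (measure_full_eq mE) => //.
  - by rewrite -[X in measurable X]setTI; exact: measurable_fst_borel.
  - by rewrite -[X in measurable X]setTI; exact: measurable_snd_borel.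
  - by apply/seteqP; split => z [h Ez]; split => //; move: h; rewrite /= (ET _ Ez).
have mgraph := measurable_graph mT; have mc := measurable_cost.
have mcE : measurable_fun setT (fun z : borel (M * N)%type => (c z)%:E).
  by apply/measurable_EFinP.
have mcT : measurable_fun setT (fun x : borel M => (c (x, T x))%:E).
  exact: (measurableT_comp mcE mgraph).
rewrite /map_cost /plan_cost.
rewrite -(integral_pushforward_measurable measurable_fst_borel g1 mcT).
apply: ae_eq_integral => //.
  by apply: (measurableT_comp mcT); exact: measurable_fst_borel.
by apply: (ae_of_full mE gE) => -[x y] /ET /= ->.
Qed.

Lemma optimal_map_exists : exists T, is_optimal_map mu nu c T.
Proof.
have [T Tt Tg] := contact_map; exists T; split => // T' /graph_plan[g' [g'P <- _]].
by rewrite Tg; case: g_opt => _; exact.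
Qed.

(** By [contact_map] an optimal map costs at most as much as g; so does its plan, to which
    [contact_of_cost] applies. *)
Lemma optimal_map_contact T : is_optimal_map mu nu c T ->
  measurable [set x : borel M | contact (x, T x)] /\ mu [set x | contact (x, T x)] = 1%E.
Proof.
move=> [Tt Tmin]; have [T0 T0t T0g] := contact_map.
have [g' [g'P g'c g'E]] := graph_plan Tt.
have mc := measurable_contact; split.
  rewrite -[X in measurable X]setTI; exact: (measurable_graph Tt.1).
by rewrite -g'E//; apply: contact_of_cost; rewrite // g'c -T0g; exact: Tmin.
Qed.

End optimal_transport.

(** * Envelopes of the potential *)

Lemma cotangent_chart_eq (R : realType) (n : nat) (M : ptopologicalType)
    (S : smooth_structure R n M) (p q : cotangent S) th :
  base p = base q -> atlas S th -> dom th (base p) ->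
  Defs.coord p th = Defs.coord q th -> p = q.
Proof.
move=> bpq ath dth pq; apply: cotangent_eq => //; apply/funext => th'.
have [[ath' dth']|nth'] := pselect (atlas S th' /\ dom th' (base p)); last first.
  by rewrite !coord_out// -bpq.
rewrite (coord_change ath' ath dth' dth) pq bpq.
by rewrite -(@coord_change _ _ _ _ q th' th)// -bpq.
Qed.

Lemma semiconcave_subgradient (R : realType) (n : nat) (w : R -> R) (U : set 'rV[R]_n)
    (f : 'rV[R]_n -> R) (r : R) x : semiconcave w U f -> U x ->
  exists u, subgradient w U (fun z => r - f z) x u.
Proof.
move=> scf Ux; have [l hl] := scf x Ux.
pose u : 'cV[R]_n := \col_i - l (delta_mx 0 i).
have lu v : linform u v = - l v.
  rewrite linformE [in RHS](row_sum_delta v) linear_sum -sumrN; apply: eq_bigr => i _.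
  by rewrite mxE linearZ /= mulrN.
exists u => z Uz; rewrite lu; have := hl z Uz; lra.
Qed.

Section piece.
Context {R : realType} {n : nat} {M N : ptopologicalType} (S : smooth_structure R n M).
Variables (c : M * N -> R) (b : R) (phi : M -> \bar R) (psi : N -> \bar R).
Hypothesis c_ge : forall z, b <= c z.
Hypothesis sub : c_subsolution c phi psi.
Hypothesis mphi : measurable_fun setT (phi : borel M -> \bar R).
Variables (th : chart R n M) (w : R -> R) (Y : set N) (k : R).
Hypotheses (ath : atlas S th) (mw : modulus w).
Hypothesis HY : forall y, Y y ->
  semiconcave w (Defs.codom th) ((fun x => c (x, y)) \o cinv th).
Hypothesis psiY : forall y, Y y -> psi y \is a fin_num /\ fine (psi y) <= k.

Definition branch y z := fine (psi y) - c (cinv th z, y).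
(** The c-transform of psi restricted to the slice Y, read in the chart th. *)
Definition envelope := sup_fun Y branch.

Let U := Defs.codom th.
Let oU : open U := @open_codom _ _ _ th.

Lemma branch_le y z : Y y -> branch y z <= k - b.
Proof. by move=> /psiY[_ h]; rewrite /branch; have := c_ge (cinv th z, y); lra. Qed.

Lemma branch_subgradient y z : Y y -> U z -> exists u, subgradient w U (branch y) z u.
Proof. by move=> /HY scy Uz; exact: (semiconcave_subgradient _ scy Uz). Qed.

Lemma branch_contact x y : dom th x -> Y y -> contact c phi psi (x, y) ->
  phi x = (branch y (th x))%:E.
Proof.
move=> dx /psiY[+ _]; rewrite /contact/= /branch cmapK//.
have [+ _ _] := sub => /(_ x); case: (phi x) => [r| |] //; case: (psi y) => [s| |] //=.
by move=> _ _ [<-]; congr EFin; lra.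
Qed.

Lemma envelope_le_phi x : dom th x -> Y !=set0 -> ((envelope (th x))%:E <= phi x)%E.
Proof.
move=> dx Y0; have [+ _ subxy] := sub => /(_ x).
case E : (phi x) => [r| |] // _; last by rewrite leey.
rewrite lee_fin; apply: sup_fun_le => // y Yy.
have [+ _] := psiY Yy; rewrite /branch cmapK//; have := subxy x y; rewrite E.
by case: (psi y) => [s| |] //=; rewrite lee_fin => + _; lra.
Qed.

Lemma envelope_contact x y : dom th x -> Y y -> contact c phi psi (x, y) ->
  phi x = (envelope (th x))%:E /\ branch y (th x) = envelope (th x).
Proof.
move=> dx Yy cxy; have E := branch_contact dx Yy cxy.
have le1 : envelope (th x) <= branch y (th x).
  by rewrite -lee_fin -E; apply: envelope_le_phi => //; exists y.
have le2 : branch y (th x) <= envelope (th x).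
  exact: (@sup_fun_ub _ _ _ Y branch (k - b) (fun i z => @branch_le i z)).
have BE : branch y (th x) = envelope (th x) by apply/eqP; rewrite eq_le le1 le2.
by rewrite E BE.
Qed.

Definition touched : set M := [set x | dom th x /\ exists2 y, Y y & contact c phi psi (x, y)].
Definition fitted : set M := [set x | dom th x /\ phi x = (envelope (th x))%:E].

Lemma open_envelope_gt (a : R) : Y !=set0 -> open [set z | U z /\ a < envelope z].
Proof.
move=> Y0; apply: (@sup_fun_open_gt _ _ _ w U Y branch (k - b)) => //.
  by move=> y z; exact: branch_le.
by move=> y z; exact: branch_subgradient.
Qed.

Lemma measurable_fitted : Y !=set0 -> measurable (fitted : set (borel M)).
Proof.
move=> Y0.
have mdom : measurable (dom th : set (borel M)) by apply: open_borel; exact: open_dom.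
have menv : measurable_fun (dom th : set (borel M)) (fun x : borel M => (envelope (th x))%:E).
  apply/measurable_EFinP.
  apply: (measurability _ (RGenOInfty.measurableE R)) => _ [_ [a ->] <-].
  rewrite preimage_itvoy; apply: open_borel.
  rewrite openE => x [dx /= ax]; have Ux : U (th x) by exists x.
  have nd := open_nbhs_nbhs (conj (open_dom th) dx).
  have ng := continuous_cmap dx
    (open_nbhs_nbhs (conj (@open_envelope_gt a Y0) (conj Ux ax))).
  by apply: filterS2 nd ng => y dy /= [_ ay].
rewrite (_ : fitted = dom th `&` [set x | phi x = (envelope (th x))%:E])//.
apply: emeasurable_fun_eq => //; exact: measurable_funTS.
Qed.

Lemma measurable_chart_image (F : set (borel M)) : measurable F -> F `<=` dom th ->
  measurable (th @` F : set (borel 'rV[R]_n)).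
Proof.
move=> mF Fd; rewrite (_ : th @` F = U `&` cinv th @^-1` F).
  have mc : measurable_fun (U : set (borel 'rV[R]_n)) (cinv th : borel 'rV[R]_n -> borel M).
    by apply: continuous_borel => // z; exact: cinv_continuous.
  by apply: mc => //; exact: open_borel.
apply/seteqP; split => z.
  move=> [x Fx <-]; have dx := Fd _ Fx.
  by split; [exists x|rewrite /= cmapK].
by move=> [Uz Fz]; exists (cinv th z) => //; have [] := cinv_codom Uz.
Qed.

(** Where y is in contact, [branch y] equals phi, which bounds the envelope from above. *)
Lemma touched_fitted : touched `<=` fitted.
Proof. by move=> x [dx [y Yy cxy]]; split => //; have [] := envelope_contact dx Yy cxy. Qed.

Definition regular_point x := density_one (th @` fitted) (th x) /\
  exists u, has_gradient envelope (th x) u.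

(** The two ways to be irregular are null in the chart, by [density_one_ae] for the Borel
    set [fitted] and by [semiconvex_gradient_ae] for the touched points, at which the
    touching branch provides a subgradient. Absolute continuity brings this back to M. *)
Lemma touched_regular (mu : probability (borel M) R) : absolutely_continuous S mu ->
  exists Z : set (borel M), [/\ measurable Z, mu Z = 0%E &
    forall x, touched x -> ~ Z x -> regular_point x].
Proof.
move=> ac; have [Y0|] := pselect (Y !=set0); last first.
  by move=> Y0; exists set0; split => // x [_ [y Yy _]]; case: Y0; exists y.
have mF := measurable_fitted Y0.
have fitted_dom : fitted `<=` dom th by move=> x [].
have null1 := density_one_ae (measurable_chart_image mF fitted_dom).
have null2 : lebesgue_rV [set z | (th @` touched) z /\ ~ exists u, has_gradient envelope z u] = 0%E.
  apply: (@semiconvex_gradient_ae _ _ w U envelope (th @` touched) (k - b)) => //.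
  - apply: (@sup_fun_jensen _ _ _ w U Y branch (k - b)) => //.
      by move=> y z; exact: branch_le.
    by move=> y z; exact: branch_subgradient.
  - by move=> z _; apply: sup_fun_le => // y; exact: branch_le.
  - by move=> _ [x [dx _] <-]; exists x.
  - move=> _ [x [dx [y Yy cxy]] <-].
    have Ux : U (th x) by exists x.
    have [u hu] := branch_subgradient Yy Ux; exists u.
    have [_ e] := envelope_contact dx Yy cxy.
    by apply: (@sup_fun_subgradient _ _ _ w U Y branch (k - b) _ y) => // i z; exact: branch_le.
have null := lebesgue_null_setU null1 null2.
have [B [mB sB B0]] := lebesgue_null_borel null.
exists (dom th `&` th @^-1` B); split.
- have mth : measurable_fun (dom th : set (borel M)) (th : borel M -> borel 'rV[R]_n).
    by apply: continuous_borel; [exact: open_dom|move=> x; exact: continuous_cmap].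
  by apply: mth => //; apply: open_borel; exact: open_dom.
- exact: ac.
- move=> x tx nZ; have dx : dom th x by case: tx.
  split; apply: contrapT => h; apply: nZ; split => //; apply: sB.
    by left; split => //; exists x => //; exact: touched_fitted.
  by right; split => //; exists x.
Qed.

(** The function [envelope \o th] approximates phi to first order at x. A branch in contact
    at x touches the envelope from below, hence has the same gradient u, and the partial
    derivative of the cost is that of minus the branch. *)
Lemma regular_point_differential x u : dom th x -> has_gradient envelope (th x) u ->
  density_one (th @` fitted) (th x) -> exists p : cotangent S,
  [/\ base p = x, Defs.coord p th = u, is_approx_differential phi p &
      forall y, Y y -> contact c phi psi (x, y) -> is_partial1 c (x, y) (cotangent_opp p)].
Proof.
move=> dx eu dF; have Ux : U (th x) by exists x.
have ethu : has_gradient ((envelope \o th) \o cinv th) (th x) u.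
  apply: has_gradient_near eu; first by rewrite /= cmapK.
  apply: filterS (open_nbhs_nbhs (conj oU Ux)) => z /cinv_codom[_ /= e].
  by rewrite e.
have [p [bp dp pth]] := is_differential_exists ath dx ethu.
exists p; split => //.
- apply: (ex_intro2 _ _ (envelope \o th) dp) => th' ath'; rewrite bp => dx'.
  exact: (@density_one_chart _ _ _ S [set x | phi x = ((envelope \o th) x)%:E] x th th'
    ath ath' dx dx' dF).
- move=> y Yy cxy; have [_ e] := envelope_contact dx Yy cxy.
  have [u' hu'] := branch_subgradient Yy Ux.
  have gb : has_gradient (branch y) (th x) u.
    apply: (has_gradient_touch mw oU Ux eu hu') => // z _.
    exact: (@sup_fun_ub _ _ _ Y branch (k - b) (fun i z => @branch_le i z)).
  have gc : has_gradient ((fun x => c (x, y)) \o cinv th) (th x) (- u).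
    move=> r r0; have [d d0 dP] := has_gradientN gb r0; exists d => // v /dP.
    by rewrite /branch /= => h; apply: le_trans h; rewrite le_eqVlt; apply/orP; left;
      apply/eqP; congr `|_ - _|; lra.
  have [q [bq dq qth]] := is_differential_exists ath dx gc.
  suff -> : cotangent_opp p = q by split.
  by apply: (cotangent_chart_eq (th := th)) => //=; rewrite ?bp ?bq// pth qth.
Qed.

End piece.

(** * Borel dependence of a differential on the point *)

Lemma measurable_fun_mx (R : realType) m n d (X : measurableType d) (D : set X)
    (f : X -> 'M[R]_(m, n)) : measurable D ->
  (forall i j, measurable_fun D (fun x => f x i j)) ->
  measurable_fun D (f : X -> borel 'M[R]_(m, n)).
Proof.
move=> mD mf; apply: measurable_fun_borel => O oO.
have nr (a : 'M[R]_(m, n)) : exists r : R, O a -> 0 < r /\ ball a r `<=` O.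
  have [Oa|] := pselect (O a); last by exists 0.
  by have /nbhs_ballP[r r0 h] := open_nbhs_nbhs (conj oO Oa); exists r.
have [r hr] := choice nr.
have [|E [cE EO OE]] := @lindelof _ O (fun a => ball a (r a)) (second_countable_mx R m n).
  by move=> a /hr[r0 _]; exact: nbhsx_ballx.
rewrite (_ : D `&` f @^-1` O = \bigcup_(a in E) (D `&` f @^-1` ball a (r a))); last first.
  apply/seteqP; split => x.
    by move=> [Dx /OE[a Ea ax]]; exists a.
  by move=> [a Ea [Dx ax]]; split => //; have [_] := hr a (EO _ Ea); exact.
apply: measurable_bigcup_countable => // a /EO/hr[r0 _].
rewrite (_ : _ `&` _ = (\bigcap_(ij in [set: 'I_m * 'I_n])
    (D `&` (fun x => f x ij.1 ij.2) @^-1` ball (a ij.1 ij.2) (r a))) `&` D).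
  apply: measurableI => //; apply: fin_bigcap_measurable => // -[i j] _ /=.
  by apply: mf => //; apply: open_measurable; exact: ball_open.
apply/seteqP; split => x.
  by move=> [Dx [_ h]]; split => // -[i j] _; split => //=; exact: h.
move=> [h Dx]; split => //; split => // i j.
by have [_ /=] := h (i, j) I.
Qed.

Section cotangent_measurable.
Context {R : realType} {n : nat} {M : ptopologicalType} (S : smooth_structure R n M).

(** Membership of D x in an open set of the bundle only depends on the coordinates of D x
    in the chart th, and these are limits of measurable difference quotients of g. *)
Lemma measurable_differential (th : chart R n M) (A : set (borel M))
    (g : borel 'rV[R]_n -> R) (D : borel M -> borel (cotangent S)) :
  atlas S th -> measurable A -> A `<=` dom th -> measurable_fun setT g ->
  (forall x, A x -> base (D x) = x /\ has_gradient g (th x) (Defs.coord (D x) th)) ->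
  measurable_fun A D.
Proof.
move=> ath mA Ad mg AD.
have mth : measurable_fun A (th : borel M -> borel 'rV[R]_n).
  apply: (@measurable_funS _ _ (borel M) (borel 'rV[R]_n) (dom th) A th) => //.
    by apply: open_borel; exact: open_dom.
  by apply: continuous_borel; [exact: open_dom|move=> x; exact: continuous_cmap].
have mco : measurable_fun A ((fun x => Defs.coord (D x) th) : borel M -> borel 'cV[R]_n).
  apply: measurable_fun_mx => // i j; rewrite (ord1 j).
  pose h m (x : borel M) : R := m.+1%:R * (g (th x + m.+1%:R^-1 *: delta_mx 0 i) - g (th x)).
  apply: (@measurable_fun_cvg _ _ _ A h); last first.
    by move=> x /AD[_ gx]; exact: has_gradient_coord gx.
  move=> m; apply: measurable_funM => //; apply: measurable_funB; last first.
    exact: (measurableT_comp mg mth).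
  have mtr : measurable_fun setT
      ((fun z => z + m.+1%:R^-1 *: delta_mx 0 i) : borel 'rV[R]_n -> borel 'rV[R]_n).
    have ctr : continuous (fun z : 'rV[R]_n => z + m.+1%:R^-1 *: delta_mx 0 i).
      move=> z; apply: (@cvgD _ _ _ (nbhs z) _ id (cst _)); first exact: cvg_id.
      exact: cvg_cst.
    by apply: continuous_borel => [|z _]; [exact: openT|exact: ctr].
  exact: (measurableT_comp mg (measurableT_comp mtr mth)).
have mb := measurable_pair_borel mA (second_countable_mx R 1 n) (second_countable_mx R n 1) mth mco.
apply: measurable_fun_borel => W oW.
pose O := interior [set z | forall q : cotangent S, dom th (base q) -> bundle_chart th q = z -> W q].
have WO x : A x -> (W (D x) <-> O (th x, Defs.coord (D x) th)).
  move=> Ax; have [bx _] := AD x Ax; split => [Wx|/interior_subset/=]; last first.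
    by apply; rewrite /bundle_chart bx//; exact: Ad.
  have := oW (D x) th Wx ath; rewrite /bundle_chart bx; apply; exact: Ad.
rewrite (_ : A `&` D @^-1` W = A `&` (fun x => (th x, Defs.coord (D x) th)) @^-1` O).
  by apply: mb => //; apply: open_borel; exact: open_interior.
by apply/seteqP; split => x [Ax h]; split => //; exact/(WO x Ax).
Qed.

(** The extension by 0 makes sense of difference quotients that leave U. *)
Lemma measurable_extension (U : set 'rV[R]_n) (f : 'rV[R]_n -> R) : open U ->
  (forall a, open [set z | U z /\ a < f z]) ->
  measurable_fun setT ((fun z => if z \in U then f z else 0) : borel 'rV[R]_n -> R).
Proof.
move=> oU of_; apply: (measurability _ (RGenOInfty.measurableE R)) => _ [_ [a ->] <-].
rewrite setTI preimage_itvoy.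
have mc : measurable ([set z | ~ U z /\ a < 0] : set (borel 'rV[R]_n)).
  have [a0|a0] := ltP a 0.
    rewrite (_ : [set _ | _] = ~` U); first by apply: measurableC; exact: open_borel.
    by apply/seteqP; split => z //= [].
  rewrite (_ : [set _ | _] = set0)//; apply/seteqP.
  by split => z // -[].
rewrite (_ : [set _ | _] = [set z | U z /\ a < f z] `|` [set z | ~ U z /\ a < 0]).
  by apply: measurableU => //; exact: open_borel.
apply/seteqP; split => z /=.
  by case: ifPn => [|/negP]; rewrite inE; [left|right].
by move=> [[Uz h]|[nUz h]]; case: ifPn; rewrite ?inE// => /negP; rewrite inE.
Qed.

End cotangent_measurable.

(** * Countably many pieces *)

Section assembly.
Context {R : realType} {n : nat} {M N : ptopologicalType} (S : smooth_structure R n M).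
Variables (mu : probability (borel M) R) (c : M * N -> R) (b : R).
Variables (phi : M -> \bar R) (psi : N -> \bar R).
Hypotheses (scM : @second_countable M) (scN : @second_countable N).
Hypothesis c_semiconcave : semiconcave_loc_unif S c.
Hypothesis c_twist : left_twist S c.
Hypothesis mu_ac : absolutely_continuous S mu.
Hypothesis c_ge : forall z, b <= c z.
Hypothesis sub : c_subsolution c phi psi.
Hypothesis mphi : measurable_fun setT (phi : borel M -> \bar R).
Hypothesis mpsi : measurable_fun setT (psi : borel N -> \bar R).

(** The hypothesis gives such data around each point of M * N; by [lindelof] countably
    many of them suffice. *)
Lemma semiconcave_cover : exists (th : nat -> chart R n M) (w : nat -> R -> R) (V : nat -> set N),
  (forall j, [/\ atlas S (th j), modulus (w j), open (V j) & forall y, V j y ->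
    semiconcave (w j) (Defs.codom (th j)) ((fun x => c (x, y)) \o cinv (th j))]) /\
  forall x y, exists j, dom (th j) x /\ V j y.
Proof.
have local (z : M * N) : exists twV : chart R n M * (R -> R) * set N,
    [/\ atlas S twV.1.1, dom twV.1.1 z.1 /\ twV.2 z.2, modulus twV.1.2, open twV.2 &
      forall y, twV.2 y -> semiconcave twV.1.2 (Defs.codom twV.1.1)
        ((fun x => c (x, y)) \o cinv twV.1.1)].
  case: z => x y; have [V nV scV] := c_semiconcave y.
  have [th [ath dx [w mw scw]]] := scV x.
  exists (th, w, interior V); split => //=; first exact: open_interior.
  by move=> y' /interior_subset; exact: scw.
have [F hF] := choice local.
have [|D [cD _ cov]] := @lindelof _ setT (fun z => dom (F z).1.1 `*` (F z).2)
  (second_countable_prod scM scN).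
  move=> z _; have [_ [dz Vz] _ oV _] := hF z.
  by apply: open_nbhs_nbhs; split => //; apply: openX => //; exact: open_dom.
have [u Du] := countable_enum cD.
exists (fun j => (F (u j)).1.1), (fun j => (F (u j)).1.2), (fun j => (F (u j)).2); split.
  by move=> j; case: (hF (u j)).
move=> x y; have [z /Du[j _ <-] [/= dx Vy]] := cov (x, y) I.
by exists j.
Qed.

Variables (th : nat -> chart R n M) (w : nat -> R -> R) (V : nat -> set N).
Hypothesis pieces : forall j, [/\ atlas S (th j), modulus (w j), open (V j) & forall y, V j y ->
    semiconcave (w j) (Defs.codom (th j)) ((fun x => c (x, y)) \o cinv (th j))].
Hypothesis cover : forall x y, exists j, dom (th j) x /\ V j y.

Definition slice (j : nat * nat) : set N :=
  [set y | V j.1 y /\ (psi y \is a fin_num /\ fine (psi y) <= j.2%:R)].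

Lemma slice_cover x y : contact c phi psi (x, y) ->
  exists j, dom (th j.1) x /\ slice j y.
Proof.
move=> cxy; have [j [dx Vy]] := cover x y.
have psiy : psi y \is a fin_num.
  move: cxy; rewrite /contact/=; have [+ + _] := sub => /(_ x) + /(_ y).
  by case: (phi x) => [r| |] //; case: (psi y).
have [k _ /(_ k (leqnn k)) hk] : \forall k \near \oo, fine (psi y) <= k%:R.
  exact: nbhs_infty_ger.
by exists (j, k).
Qed.

Lemma measurable_slice j : measurable (slice j : set (borel N)).
Proof.
have [_ _ oV _] := pieces j.1.
rewrite (_ : slice j = V j.1 `&` (psi @^-1` [set` `]-oo, (j.2%:R)%:E]] `&` psi @^-1` [set y | y \is a fin_num])).
  apply: measurableI; first exact: open_borel.
  apply: measurableI; rewrite -[X in measurable X]setTI.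
    by apply: mpsi => //; exact: emeasurable_itv.
  exact: emeasurable_fin_num.
apply/seteqP; split => y /=.
  by move=> [Vy [fy le]]; split => //; split => //; rewrite in_itv/= -(fineK fy) lee_fin.
by move=> [Vy [+ fy]]; rewrite in_itv/= -{1}(fineK fy) lee_fin.
Qed.

(** The complement of the countable union of the null sets of [touched_regular]. *)
Lemma exists_regular_set : exists G : set (borel M), [/\ measurable G, mu G = 1%E &
  forall x j, G x -> touched c phi psi (th j.1) (slice j) x ->
    regular_point c phi psi (th j.1) (slice j) x].
Proof.
have nZ (j : nat * nat) : exists Z : set (borel M), [/\ measurable Z, mu Z = 0%E &
    forall x, touched c phi psi (th j.1) (slice j) x -> ~ Z x ->
      regular_point c phi psi (th j.1) (slice j) x].
  have [ath mw _ scV] := pieces j.1.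
  apply: (@touched_regular _ _ _ _ S c b phi psi c_ge sub mphi _ (w j.1) _ j.2%:R) => //.
    by move=> y [Vy _]; exact: scV.
  by move=> y [_ [fy le]].
have [Z hZ] := choice nZ.
pose Y k : set (borel M) := if unpickle k is Some j then Z j else set0.
have mY k : measurable (Y k) by rewrite /Y; case: unpickle => // j; case: (hZ j).
have mU : measurable (\bigcup_k Y k) by exact: bigcup_measurable.
exists (~` (\bigcup_k Y k)); split.
- exact: measurableC.
- have U0 : mu (\bigcup_k Y k) = 0%E.
    apply: measure_negligible => //; apply: negligible_bigcup => k.
    exists (Y k); split => //; rewrite /Y; case: unpickle => [j|]; last exact: measure0.
    by case: (hZ j).
  by have := probability_setC mu mU; rewrite U0 sube0.
- move=> x j nU tx; have [_ _ h] := hZ j; apply: h => // Zx; apply: nU.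
  by exists (pickle j) => //; rewrite /Y pickleK.
Qed.

Variable G : set (borel M).
Hypothesis G_regular : forall x j, G x -> touched c phi psi (th j.1) (slice j) x ->
    regular_point c phi psi (th j.1) (slice j) x.

Lemma contact_differential_slice x y j : G x -> contact c phi psi (x, y) ->
  dom (th j.1) x -> slice j y -> exists p : cotangent S,
  [/\ base p = x, is_approx_differential phi p, is_partial1 c (x, y) (cotangent_opp p) &
    has_gradient (envelope c psi (th j.1) (slice j)) (th j.1 x) (Defs.coord p (th j.1))].
Proof.
move=> Gx cxy dx Yy.
have [dF [u eu]] : regular_point c phi psi (th j.1) (slice j) x.
  by apply: G_regular => //; split => //; exists y.
have [ath mw _ scV] := pieces j.1.
have [p [bp pth ap part]] := @regular_point_differential _ _ _ _ S c b phi psi c_ge sub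
  (th j.1) (w j.1) (slice j) j.2%:R ath mw (fun y Yy => scV y Yy.1)
  (fun y Yy => Yy.2) x u dx eu dF.
by exists p; split => //; [exact: part|rewrite pth].
Qed.

Lemma contact_differential x y : G x -> contact c phi psi (x, y) ->
  exists p : cotangent S, [/\ base p = x, is_approx_differential phi p &
    is_partial1 c (x, y) (cotangent_opp p)].
Proof.
move=> Gx cxy; have [j [dx Yy]] := slice_cover cxy.
by have [p [bp ap part _]] := contact_differential_slice Gx cxy dx Yy; exists p.
Qed.

(** Both y and y' have minus the approximate differential of phi as partial derivative of
    the cost, and the twist condition applies. *)
Lemma contact_unique x y y' : G x -> contact c phi psi (x, y) ->
  contact c phi psi (x, y') -> y = y'.
Proof.
move=> Gx /(contact_differential Gx)[p [bp ap part]].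
move=> /(contact_differential Gx)[p' [bp' ap' part']].
have pp' : p = p' by apply: is_approx_differential_unique ap ap'; rewrite bp bp'.
by rewrite -pp' in part'; have [] := c_twist part part'.
Qed.

Definition approx_differential x : cotangent S :=
  xget point [set p | base p = x /\ is_approx_differential phi p].

Lemma approx_differentialE x p : base p = x -> is_approx_differential phi p ->
  approx_differential x = p.
Proof.
move=> bp ap; rewrite /approx_differential; case: xgetP => [q _ [bq aq]|/(_ p)[]//].
by apply: is_approx_differential_unique aq ap; rewrite bp bq.
Qed.

(** On the part of A where x lies in the j-th chart domain and T x in the j-th slice, the
    approximate differential is the differential of the j-th envelope. *)
Lemma measurable_approx_differential (T : borel M -> borel N) (A : set (borel M)) :
  measurable_fun setT T -> measurable A -> A `<=` G ->
  (forall x, A x -> contact c phi psi (x, T x)) ->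
  measurable_fun A (approx_differential : borel M -> borel (cotangent S)).
Proof.
move=> mT mA AG AT; apply: measurable_fun_borel => W oW.
pose P j : set (borel M) := A `&` (dom (th j.1) `&` T @^-1` slice j).
have mP j : measurable (P j).
  apply: measurableI => //; apply: measurableI.
    by apply: open_borel; exact: open_dom.
  by rewrite -[X in measurable X]setTI; apply: mT => //; exact: measurable_slice.
rewrite (_ : A `&` _ = \bigcup_j (P j `&` approx_differential @^-1` W)); last first.
  apply/seteqP; split => x; last by move=> [j _ [[Ax _] Wx]].
  move=> [Ax Wx]; have [j [dx Yx]] := slice_cover (AT x Ax).
  by exists j => //; split => //; split.
apply: measurable_bigcup_countable => // j _.
have [Y0|] := pselect (slice j !=set0); last first.
  move=> Y0; rewrite (_ : _ `&` _ = set0)//; apply/seteqP; split => // x [[_ [_ Yx]] _].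
  by case: Y0; exists (T x).
have [ath mw _ scV] := pieces j.1.
pose g z := if z \in Defs.codom (th j.1) then envelope c psi (th j.1) (slice j) z else 0.
have mg : measurable_fun setT (g : borel 'rV[R]_n -> R).
  apply: measurable_extension; first exact: open_codom.
  move=> a; apply: (@open_envelope_gt _ _ _ _ c b psi c_ge (th j.1) (w j.1) (slice j) j.2%:R) => //.
    by move=> y [Vy _]; exact: scV.
  by move=> y [].
suff mD : measurable_fun (P j) (approx_differential : borel M -> borel (cotangent S)).
  by apply: mD => //; exact: open_borel.
apply: (@measurable_differential R n M S (th j.1) (P j) g) => //.
  by move=> x [_ []].
move=> x [Ax [dx Yx]].
have [p [bp ap _ ep]] := contact_differential_slice (AG x Ax) (AT x Ax) dx Yx.
rewrite (approx_differentialE bp ap); split => //.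
have Ux : Defs.codom (th j.1) (th j.1 x) by exists x.
apply: has_gradient_near ep; first by rewrite /g mem_set.
by apply: filterS (open_nbhs_nbhs (conj (@open_codom _ _ _ (th j.1)) Ux)) => z Uz; rewrite /g mem_set.
Qed.

End assembly.

(** * Approximate differentiability and the optimal map *)

Theorem mainTheorem4 (R : realType) (n : nat)
    (M : ptopologicalType) (S : smooth_structure R n M)
    (hausdorffM : hausdorff_space M) (second_countableM : @second_countable M)
    (N : ptopologicalType) (polishN : polish_space R N)
    (mu : probability (borel M) R) (nu : probability (borel N) R)
    (c : M * N -> R)
    (c_lsc : lower_semicontinuous (fun z => (c z)%:E))
    (c_bounded_below : exists b : R, forall z, b <= c z)
    (c_semiconcave : semiconcave_loc_unif S c)
    (c_twist : left_twist S c)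
    (mu_ac : absolutely_continuous S mu)
    (cost_finite : ereal_inf [set plan_cost c g | g in is_plan mu nu]
                     \is a fin_num)
    (phi : M -> \bar R) (psi : N -> \bar R)
    (calibrated : calibrated_pair mu nu c phi psi) :
  {ae mu, forall x, exists p : cotangent S,
    base p = x /\ is_approx_differential phi p} /\
  (exists T, is_optimal_map mu nu c T) /\
  forall T, is_optimal_map mu nu c T ->
    [/\ forall T', is_optimal_map mu nu c T' -> {ae mu, forall x, T' x = T x},
        {ae mu, forall x, exists p : cotangent S,
          [/\ base p = x, is_approx_differential phi p &
              forall y, is_partial1 c (x, y) (cotangent_opp p) <-> y = T x]} &
        exists A : set (borel M),
          [/\ measurable A, mu A = 1%E,
              exists D : borel M -> borel (cotangent S),
                (forall x, A x ->
                  base (D x) = x /\ is_approx_differential phi (D x)) /\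
                measurable_fun A D &
              forall x, A x ->
                exists p : cotangent S, is_partial1 c (x, T x) p]].
Proof.
have [sub mphi mpsi [g g_opt g_ae]] := calibrated.
have [b c_ge] := c_bounded_below.
have scN := polish_second_countable polishN.
have regularM : @regular_space M.
  by move=> x; have [th _ dx] := atlas_cover S x; exact: chart_regular hausdorffM dx.
have [th [w [V [pieces cover]]]] := semiconcave_cover second_countableM scN c_semiconcave.
have [G [mG muG G_regular]] := exists_regular_set mu_ac c_ge sub mphi pieces.
have diff x y : G x -> contact c phi psi (x, y) -> exists p : cotangent S,
    [/\ base p = x, is_approx_differential phi p & is_partial1 c (x, y) (cotangent_opp p)].
  by move=> Gx cxy; exact: (contact_differential c_ge sub pieces cover G_regular Gx cxy).
have uniq x y y' : G x -> contact c phi psi (x, y) -> contact c phi psi (x, y') -> y = y'.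
  by move=> Gx c1 c2; exact: (contact_unique c_twist c_ge sub pieces cover G_regular Gx c1 c2).
have exT : exists T, is_optimal_map mu nu c T.
  apply: (optimal_map_exists second_countableM scN c_lsc mphi mpsi g_opt g_ae
    regularM polishN mG muG uniq).
have optA T : is_optimal_map mu nu c T -> exists A : set (borel M),
    [/\ measurable A, mu A = 1%E & forall x, A x -> G x /\ contact c phi psi (x, T x)].
  move=> Topt; have [mC muC] := optimal_map_contact second_countableM scN c_lsc c_ge
    cost_finite sub mphi mpsi g_opt g_ae regularM polishN mG muG uniq Topt.
  exists (G `&` [set x | contact c phi psi (x, T x)]); split => //.
    exact: measurableI.
  exact: full_setI.
split.
  have [T /optA[A [mA muA AT]]] := exT.
  apply: (ae_of_full mA muA) => x /AT[Gx cx].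
  by have [p [bp ap _]] := diff x _ Gx cx; exists p.
split => // T Topt; have [A [mA muA AT]] := optA T Topt; split.
- move=> T' /optA[A' [mA' muA' AT']].
  apply: (ae_of_full (measurableI _ _ mA mA') (full_setI mA mA' muA muA')).
  by move=> x [/AT[Gx cx] /AT'[_ cx']]; exact: uniq Gx cx' cx.
- apply: (ae_of_full mA muA) => x /AT[Gx cx].
  have [p [bp ap part]] := diff x _ Gx cx; exists p; split => // y.
  by split => [party|-> //]; have [] := c_twist _ _ _ party part.
- exists A; split => //.
    exists (approx_differential S phi); split.
      move=> x /AT[Gx cx]; have [p [bp ap _]] := diff x _ Gx cx.
      by rewrite (approx_differentialE bp ap).
    apply: (measurable_approx_differential c_ge sub mpsi pieces cover G_regular Topt.1.1 mA).
      by move=> x /AT[].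
    by move=> x /AT[].
  move=> x /AT[Gx cx]; have [p [_ _ part]] := diff x _ Gx cx.
  by exists (cotangent_opp p).
Qed.
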